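(* Let $m\in\mathbb{N}$, $0<\alpha<n$, $0<\eta\le1$, and let $T_\alpha$ be a fractional operator whose convolution kernel $K_\alpha$ satisfies the size condition $S_\alpha$ and the smoothness condition $H^*_{\alpha,\infty}$ with exponent $\eta$. Let $0<\delta<\min\{\eta,(n-\alpha)/m\}$ and $r=n/((m-1)\delta+\alpha)$. If $w\in A_{n/(m\delta+\alpha),\infty}$ and $b\in\Lambda(\delta)$, the following statements are equivalent. (i) $T^m_{\alpha,b}$ is bounded from $L^r_w(\mathbb{R}^n)$ into $\mathbb{L}_w(\delta)$. (ii) There exists a positive constant $C$ such that $$\frac{\|w\chi_B\|_\infty}{|B|^{1+\frac\delta n}}\int_B\left|\sum_{k=0}^m c_k\left[S(x,u,k)-(S(\cdot,u,k))_B\right]\right|dx\le C\,\|fw\|_{L^r}$$ for every ball $B\subset\mathbb{R}^n$, every $u\in B$ and every $f\in L^1_{\rm loc}(\mathbb{R}^n)$, where $c_k=\frac{m!}{k!(m-k)!}$, $S(x,u,k)=(b(x)-b_B)^{m-k}\,T_\alpha\big((b-b_B)^kf_2\big)(u)$ and $f_2=f\chi_{\mathbb{R}^n\setminus 2B}$.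
   Context: Operators: $T_\alpha f(x)=\int_{\mathbb{R}^n}K_\alpha(x-y)f(y)\,dy$, where $K_\alpha$ is not identically zero. For a symbol $b\in L^1_{\rm loc}(\mathbb{R}^n)$ the commutator of order $m$ is formally defined by $T^m_{\alpha,b}f(x)=\int_{\mathbb{R}^n}(b(x)-b(y))^mK_\alpha(x-y)f(y)\,dy$. Condition $S_\alpha$: there is $C>0$ with $\int_{s<|x|\le 2s}|K_\alpha(x)|\,dx\le Cs^\alpha$ for every $s>0$. Condition $H^*_{\alpha,\infty}$ (with exponent $0<\eta\le1$): there is $C>0$ such that $|K_\alpha(x-y)-K_\alpha(x'-y)|+|K_\alpha(y-x)-K_\alpha(y-x')|\le C\frac{|x-x'|^\eta}{|x-y|^{n-\alpha+\eta}}$ whenever $|x-y|\ge 2|x-x'|$. Symbols: for $0<\delta<1$, $\Lambda(\delta)$ is the set of functions $b$ for which there is $C>0$ with $|b(x)-b(y)|\le C|x-y|^\delta$ for all $x,y\in\mathbb{R}^n$. Weights: a weight is a non-negative locally integrable function $w$. $f\in L^r_w(\mathbb{R}^n)$ means $fw\in L^r(\mathbb{R}^n)$, with norm $\|fw\|_{L^r}$. $w\in A_{s,\infty}$ means $w^{-s'}\in A_1$ (Muckenhoupt's class), where $1/s+1/s'=1$. Averages: $g_B=\frac1{|B|}\int_Bg$; $(S(\cdot,u,k))_B=\frac1{|B|}\int_BS(z,u,k)\,dz$. $2B$ is the ball concentric with $B$ with twice its radius. Weighted Lipschitz spaces: $\mathbb{L}_w(\delta)$ is the set of $f\in L^1_{\rm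 loc}(\mathbb{R}^n)$ with $\|f\|_{\mathbb{L}_w(\delta)}:=\sup_B\frac{\|w\chi_B\|_\infty}{|B|^{1+\delta/n}}\int_B|f(x)-f_B|\,dx<\infty$, the supremum being over all balls $B$, and $\|\cdot\|_\infty$ the essential supremum. Boundedness in (i) means $\|T^m_{\alpha,b}f\|_{\mathbb{L}_w(\delta)}\le C\|fw\|_{L^r}$ for all $f\in L^r_w(\mathbb{R}^n)$, with $C$ independent of $f$. *)

(* Defs.v *)
From HB Require Import structures.
From mathcomp Require Import all_boot all_order all_algebra.
From mathcomp Require Import all_classical all_reals all_analysis.
From mathcomp Require Import measurable_realfun ess_sup_inf.
Set Implicit Arguments.
Unset Strict Implicit.
Unset Printing Implicit Defensive.
Import Order.TTheory GRing.Theory Num.Theory.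
Import numFieldNormedType.Exports.
Local Open Scope classical_set_scope.
Local Open Scope ring_scope.

(* Row vectors carry the sigma-algebra generated by the coordinates, that is
   the Borel sigma-algebra of R^n. *)
Definition rV_display : measure_display. Proof. exact: default_measure_display. Qed.

Section measurable_rV.
Context {R : realType} {n : nat}.

Let coors : 'I_n -> 'rV[R]_n -> R := fun i x => x ord0 i.

Let rV_set0 : g_sigma_preimage coors set0.
Proof. exact: sigma_algebra0. Qed.

Let rV_setC A : g_sigma_preimage coors A -> g_sigma_preimage coors (~` A).
Proof. exact: sigma_algebraC. Qed.

Let rV_bigcup (F : _^nat) : (forall i, g_sigma_preimage coors (F i)) ->
  g_sigma_preimage coors (\bigcup_i (F i)).
Proof. exact: sigma_algebra_bigcup. Qed.

HB.instance Definition _ := @isMeasurable.Build rV_display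
  'rV[R]_n (g_sigma_preimage coors) rV_set0 rV_setC rV_bigcup.

Lemma measurable_rV_coord (i : 'I_n) :
  measurable_fun [set: 'rV[R]_n] (fun x : 'rV[R]_n => x ord0 i).
Proof.
move=> _ Y mY; rewrite setTI; apply: sub_sigma_algebra => /=.
rewrite -bigcup_seq/=; exists i => /=; first by rewrite mem_index_enum.
by exists Y => //; rewrite setTI.
Qed.

Lemma measurable_fun_rVP d (T : measurableType d) (f : T -> 'rV[R]_n) :
  (forall i, measurable_fun [set: T] (fun t => f t ord0 i)) ->
  measurable_fun [set: T] f.
Proof.
move=> mf _ Y mY; rewrite setTI.
suff : g_sigma_preimage coors `<=` [set A | measurable (f @^-1` A)] by apply.
apply: smallest_sub.
  split => [|A|F] /=.
  - by rewrite preimage_set0.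
  - by rewrite setTD preimage_setC => /measurableC.
  - by move=> mF; rewrite preimage_bigcup; exact: bigcupT_measurable.
rewrite -bigcup_seq => A [i _ [B mB <-]] /=.
by rewrite setTI -[X in measurable X]setTI -comp_preimage; exact: mf.
Qed.

End measurable_rV.

Section rV_cons.
Context {R : realType} (n : nat).

Definition rV_cons (p : measurableTypeR R * 'rV[R]_n) : 'rV[R]_n.+1 :=
  \row_i (if unlift ord0 i is Some j then p.2 ord0 j else p.1).

Definition rV_uncons (x : 'rV[R]_n.+1) : measurableTypeR R * 'rV[R]_n :=
  (x ord0 ord0, \row_j x ord0 (lift ord0 j)).

Lemma rV_consK : cancel rV_cons rV_uncons.
Proof.
move=> [a v]; rewrite /rV_uncons /rV_cons mxE unlift_none; congr pair.
by apply/rowP => j; rewrite !mxE liftK.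
Qed.

Lemma measurable_rV_cons : measurable_fun [set: measurableTypeR R * 'rV[R]_n] rV_cons.
Proof.
apply: measurable_fun_rVP => i; under eq_fun do rewrite mxE.
case: (unlift ord0 i) => [j|]; last exact: measurable_fst.
exact: (measurableT_comp (measurable_rV_coord j)).
Qed.

Lemma measurable_rV_uncons : measurable_fun [set: 'rV[R]_n.+1] rV_uncons.
Proof.
apply/measurable_fun_pair; first exact: measurable_rV_coord.
apply: measurable_fun_rVP => i.
by under eq_fun do rewrite mxE; exact: measurable_rV_coord.
Qed.

Variable m : {sigma_finite_measure set 'rV[R]_n -> \bar R}.

Definition rV_cons_measure : set 'rV[R]_n.+1 -> \bar R :=
  pushforward (@lebesgue_measure R \x m)%E rV_cons.

Local Notation mu := rV_cons_measure.

Let mpre (A : set 'rV[R]_n.+1) : measurable A -> measurable (rV_cons @^-1` A).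
Proof. by move=> mA; rewrite -[X in measurable X]setTI; exact: measurable_rV_cons. Qed.

Let mu0 : mu set0 = 0%E.
Proof. by rewrite /rV_cons_measure /pushforward preimage_set0 measure0. Qed.

Let mu_ge0 A : (0 <= mu A)%E.
Proof. by rewrite /rV_cons_measure /pushforward; exact: measure_ge0. Qed.

Let mu_sigma_additive : semi_sigma_additive mu.
Proof.
move=> F mF tF mUF; rewrite /rV_cons_measure /pushforward preimage_bigcup.
apply: measure_semi_sigma_additive.
- by move=> k; exact: mpre.
- apply/trivIsetP => /= i j _ _ ij; rewrite -preimage_setI.
  by move/trivIsetP : tF => /(_ _ _ _ _ ij) ->//; rewrite preimage_set0.
- by rewrite -preimage_bigcup; exact: mpre.
Qed.

HB.instance Definition _ := isMeasure.Build _ _ _ mu mu0 mu_ge0 mu_sigma_additive.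

Let mu_sigma_finite : sigma_finite setT mu.
Proof.
have /sigma_finiteP[F [TF ndF Foo]] := sigma_finiteT (@lebesgue_measure R).
have /sigma_finiteP[G [TG ndG Goo]] := sigma_finiteT m.
exists (fun k => rV_uncons @^-1` (F k `*` G k)).
  rewrite -preimage_bigcup -[LHS](preimage_setT rV_uncons); congr (_ @^-1` _).
  rewrite -setXTT TF TG predeqE => -[x y]; split.
    move=> [/= [i _ Fix] [k _ Gky]]; exists (maxn i k) => //; split.
    - by move: x Fix; exact/subsetPset/ndF/leq_maxl.
    - by move: y Gky; exact/subsetPset/ndG/leq_maxr.
  by move=> [i _ []/= ? ?]; split; exists i.
move=> k; have [mF Fk] := Foo k; have [mG Gk] := Goo k.
have mFG : measurable (F k `*` G k) by exact: measurableX.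
split; first by rewrite -[X in measurable X]setTI; exact: measurable_rV_uncons.
rewrite /rV_cons_measure /pushforward -comp_preimage.
rewrite (_ : rV_uncons \o rV_cons = id); last exact/funext/rV_consK.
by rewrite preimage_id product_measure1E// lte_mul_pinfty// ge0_fin_numE.
Qed.

HB.instance Definition _ :=
  Measure_isSigmaFinite.Build _ _ _ mu mu_sigma_finite.

End rV_cons.

(* n-dimensional Lebesgue measure: the n-fold product of the Lebesgue measure
   of the line, for the identification rV_cons of R * R^n with R^(n+1) *)
Fixpoint leb (R : realType) (n : nat) :
    {sigma_finite_measure set 'rV[R]_n -> \bar R} :=
  match n with
  | 0 => \d_(0 : 'rV[R]_0)
  | n'.+1 => rV_cons_measure (leb R n')
  end.

Section definitions.
Context {R : realType} {n : nat}.
Implicit Types (x y c : 'rV[R]_n) (f g b w K : 'rV[R]_n -> R).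
Implicit Types (B : set 'rV[R]_n) (rho : R).

Local Notation mu := (leb R n).

(* The norm `|x| on row vectors is the sup norm, and `ball` is the associated
   cube. *)
Definition enorm x : R := Num.sqrt (\sum_(i < n) x ord0 i ^+ 2).

Definition eball c rho : set 'rV[R]_n := [set x | enorm (x - c) < rho].

Definition vol B : R := fine (mu B).

Definition mean B g : R := (vol B)^-1 * \int[mu]_(x in B) g x.

Definition locally_L1 (f : 'rV[R]_n -> \bar R) : Prop :=
  measurable_fun [set: 'rV[R]_n] f /\
  forall D, compact D -> (\int[mu]_(x in D) `|f x| < +oo)%E.

Definition weight (w : 'rV[R]_n -> \bar R) : Prop :=
  (forall x, 0 <= w x)%E /\ locally_L1 w.

(* Weights are extended-real valued here so that w^(-s') below is genuinely
   infinite where w vanishes.  The inequality is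
   w(B) / |B| <= C ess inf_B w. *)
Definition A1 (w : 'rV[R]_n -> \bar R) : Prop :=
  weight w /\
  exists2 C : R, 0 < C & forall c rho, 0 < rho ->
    {ae mu, forall x, eball c rho x ->
      ((vol (eball c rho))^-1%R%:E * \int[mu]_(y in eball c rho) w y
         <= C%:E * w x)%E}.

Definition conj_exponent (s : R) : R := s / (s - 1).

(* The inverse is the one of \bar R, for which 0^-1 = +oo; on the other hand
   0 `^ (- s') is 0. *)
Definition A_infty (s : R) w : Prop :=
  A1 (fun x => ((w x `^ conj_exponent s)%R%:E^-1)%E).

(* 'N[leb]_r[f w], with value +oo when f w is not in L^r *)
Definition wnorm (r : R) w f : \bar R := 'N[mu]_(r%:E)[EFin \o (f \* w)].

Definition in_Lw (r : R) w f : Prop :=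
  measurable_fun [set: 'rV[R]_n] f /\ (wnorm r w f < +oo)%E.

Definition Lip (delta : R) b : Prop :=
  exists2 C : R, 0 < C & forall x y, `|b x - b y| <= C * enorm (x - y) `^ delta.

Definition size_cond (alpha : R) K : Prop :=
  exists2 C : R, 0 < C & forall s : R, 0 < s ->
    (\int[mu]_(x in [set x | (s < enorm x <= 2 * s)%R]) `|K x|%:E
       <= (C * s `^ alpha)%:E)%E.

Definition smooth_cond (alpha eta : R) K : Prop :=
  exists2 C : R, 0 < C & forall x x' y, enorm (x - y) >= 2 * enorm (x - x') ->
    `|K (x - y) - K (x' - y)| + `|K (y - x) - K (y - x')|
      <= C * (enorm (x - x') `^ eta
              / enorm (x - y) `^ (n%:R - alpha + eta)).

(* These are total: for a measurable integrand, a real-valued \int is 0 unless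
   the integrand is absolutely integrable.  So an operator is set to 0 at the
   points where its defining integral does not converge absolutely. *)
Definition frac_op K f x : R := \int[mu]_y (K (x - y) * f y).

Definition commutator (m : nat) b K f x : R :=
  \int[mu]_y ((b x - b y) ^+ m * K (x - y) * f y).

(* ||w 1_B||_oo / |B|^(1 + delta/n) * \int_B |g| *)
Definition wlip_avg (delta : R) w B g : \bar R :=
  ('N[mu]_+oo[EFin \o (w \* \1_B)%R]
   * ((vol B `^ (1 + delta / n%:R))^-1)%R%:E
   * \int[mu]_(x in B) `|g x|%:E)%E.

Definition wlip_norm (delta : R) w f : \bar R :=
  ereal_sup [set v | exists c rho, 0 < rho /\
    v = wlip_avg delta w (eball c rho)
          (fun x => f x - mean (eball c rho) f)].

Definition in_wlip (delta : R) w f : Prop :=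
  locally_L1 (EFin \o f) /\ (wlip_norm delta w f < +oo)%E.

Definition bounded_Lw_wlip (r delta : R) w
    (T : ('rV[R]_n -> R) -> 'rV[R]_n -> R) : Prop :=
  exists2 C : R, 0 < C & forall f, in_Lw r w f ->
    in_wlip delta w (T f) /\
    (wlip_norm delta w (T f) <= C%:E * wnorm r w f)%E.

(* S(x, u, k) for the ball B = B(c, rho) *)
Definition Sterm (m : nat) b K f c rho (k : nat) (u x : 'rV[R]_n) : R :=
  let bB := mean (eball c rho) b in
  let f2 := f \* \1_(~` eball c (2 * rho)) in
  (b x - bB) ^+ (m - k) * frac_op K (fun y => (b y - bB) ^+ k * f2 y) u.

End definitions.

(* Main.v *)
Require Import Defs.
From HB Require Import structures.
From mathcomp Require Import all_boot all_order all_algebra.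
From mathcomp Require Import all_classical all_reals all_analysis.
From mathcomp Require Import measurable_realfun ess_sup_inf.
From mathcomp Require Import ring lra zify.
Set Implicit Arguments.
Unset Strict Implicit.
Unset Printing Implicit Defensive.
Import Order.TTheory GRing.Theory Num.Theory.
Import numFieldNormedType.Exports.
Local Open Scope classical_set_scope.
Local Open Scope ring_scope.

(** Fix a ball B of centre c and radius rho. For x and u in B and y off 2B, the
    smoothness of K and the Lipschitz bound on b give
      (b(x) - b(y))^m K(x - y) = (b_B - b(y))^m K(u - y)
          + m (b(x) - b_B) (b_B - b(y))^(m-1) K(u - y) + error(y),
    where the error is at most a constant times
      rho^(2 delta) |c - y|^(-p - delta) + rho^eta |c - y|^(-p - (eta - delta)),
    with p = n - (m - 1) delta - alpha = n (1 - 1/r) (far_commutator_le).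
    The A_1 condition on w^(-s') and Hoelder's inequality give
      sup_B w * int_B' |f| <= C |B'|^(1 - 1/r) |f w|_r   for all balls B in B',
    because sup_B' w / w >= 1 on B', so that its power r' is at most its power
    s' (A_infty_hoelder). Hence |c - y|^(-p) is exactly the critical decay at
    infinity: a kernel decaying faster by a factor |c - y|^(-theta) is
    integrable against |f| by dyadic summation, with the right bound, whereas
    at the exponent -p itself the dyadic sum diverges logarithmically. The error
    is harmless (far_error_lip_le), and so is the part of f inside 2B, by
    Tonelli's theorem (near_part_lip_le).

    Of the two terms that are left, the first does not depend on x and is not
    seen by an oscillation over B. Everything is thus governed by the second one,
    and both statements of the theorem are equivalent to the third statement
    obstruction_bounded:
      (|w 1_B|_oo / |B|^(1 + delta/n)) * int_B |b - b_B|
         * int_{off 2B} |b(y) - b_B|^(m-1) |K(u - y)| |f(y)| dy  <=  C |f w|_r.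
    In the sum over k of the ball inequality, the terms k <= m - 2 are bounded
    one by one by the error above, the term k = m is constant in x, and
    the term k = m - 1 is the obstruction (Ssum_expansion). Each of the two
    statements is tested on f cut off to an annulus, where all integrals
    converge, and with its signs changed so that the critical integrand becomes
    nonnegative; monotone convergence then gives the obstruction with the
    absolute values inside.

    Conversely, the integral that defines the commutator need not converge. When
    the obstruction is bounded, the difference between the integrand at x and the
    first term above is absolutely integrable off 2B for almost every x in B. So
    either the first term is integrable, and its integral is the constant to
    compare with, or it is not, and the commutator takes its default value 0 at
    almost every point of B, so that the constant 0 does. Both cases are one
    inequality, Rintegral_perturb, because a divergent integral has the value
    0. *)

(** * Powers, the Euclidean norm, volumes of balls and Borel sets *)

Section powR.
Context {R : realType}.
Implicit Types (x a : R).

Lemma powR_exprn x a j : 0 <= x -> (x `^ a) ^+ j = (x ^+ j) `^ a.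
Proof.
by move=> x0; rewrite -powR_mulrn ?powR_ge0// -powR_mulrn// -!powRrM mulrC.
Qed.

Lemma powR_inv x a : 0 <= x -> x^-1 `^ a = x `^ (- a).
Proof.
by move=> x0; rewrite -powR_inv1// -powRrM mulN1r.
Qed.

Lemma powR_add x a b : 0 < x -> x `^ (a + b) = x `^ a * x `^ b.
Proof. by move=> x0; rewrite powRD// (gt_eqF x0) implybT. Qed.

Lemma ler_npowR (p x y : R) : p <= 0 -> 0 < x -> x <= y -> y `^ p <= x `^ p.
Proof.
move=> p0 x0 xy; rewrite -(opprK p) !(powRN _ (- p)) lef_pV2 ?posrE ?powR_gt0//.
  by rewrite ge0_ler_powR ?nnegrE ?oppr_ge0// ltW// (lt_le_trans x0).
exact: lt_le_trans xy.
Qed.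

Lemma two_npowR_lt1 (th : R) : 0 < th -> 0 < 2 `^ (- th) < 1.
Proof.
move=> th0; rewrite powR_gt0//= powRN invf_lt1 ?powR_gt0//.
by rewrite -[ltLHS](congr1 (@^~ th) (powR1 R)) gt0_ltr_powR ?nnegrE// ltr1n.
Qed.

End powR.

Section euclidean_norm.
Context {R : realType} {n : nat}.
Implicit Types x y z c : 'rV[R]_n.

Lemma enorm_ge0 x : 0 <= enorm x.
Proof. exact: sqrtr_ge0. Qed.

Lemma sqr_enorm x : enorm x ^+ 2 = \sum_(i < n) x ord0 i ^+ 2.
Proof. by rewrite sqr_sqrtr// sumr_ge0// => i _; exact: sqr_ge0. Qed.

Lemma enorm0 : enorm (0 : 'rV[R]_n) = 0.
Proof.
by rewrite /enorm big1 ?sqrtr0// => i _; rewrite mxE expr0n.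
Qed.

Lemma enormN x : enorm (- x) = enorm x.
Proof. by congr Num.sqrt; apply: eq_bigr => i _; rewrite mxE sqrrN. Qed.

Lemma enorm_distC x y : enorm (x - y) = enorm (y - x).
Proof. by rewrite -enormN opprB. Qed.

Lemma coord_le_enorm x i : `|x ord0 i| <= enorm x.
Proof.
rewrite -sqrtr_sqr ler_wsqrtr// (bigD1 i)//= lerDl.
by apply: sumr_ge0 => j _; exact: sqr_ge0.
Qed.

Lemma enorm_eq0 x : enorm x = 0 -> x = 0.
Proof.
move=> x0; apply/rowP => i; rewrite mxE; apply/eqP.
by rewrite -normr_eq0 eq_le normr_ge0 -x0 coord_le_enorm.
Qed.

Lemma enorm_gt0 x : x != 0 -> 0 < enorm x.
Proof.
by move=> x0; rewrite lt_neqAle enorm_ge0 andbT eq_sym; apply: contra x0 => /eqP/enorm_eq0->.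
Qed.

(** Expanding the nonnegative sum of the squares (|y| x_i - |x| y_i)^2 gives
    the inequality multiplied by 2 |x| |y|. *)
Lemma cauchy_schwarz_row x y :
  \sum_(i < n) x ord0 i * y ord0 i <= enorm x * enorm y.
Proof.
have [->|/enorm_gt0 x0] := eqVneq x 0.
  by rewrite enorm0 mul0r big1// => i _; rewrite mxE mul0r.
have [->|/enorm_gt0 y0] := eqVneq y 0.
  by rewrite enorm0 mulr0 big1// => i _; rewrite mxE mulr0.
have : 0 <= \sum_(i < n) (enorm y * x ord0 i - enorm x * y ord0 i) ^+ 2.
  by apply: sumr_ge0 => i _; exact: sqr_ge0.
under eq_bigr => i _.
  rewrite (_ : _ ^+ 2 = enorm y ^+ 2 * x ord0 i ^+ 2 + enorm x ^+ 2 * y ord0 i ^+ 2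
    - 2 * enorm x * enorm y * (x ord0 i * y ord0 i)); last by ring.
  over.
rewrite sumrB big_split /= -!mulr_sumr -!sqr_enorm => h.
have : 0 <= 2 * (enorm x * enorm y)
    * (enorm x * enorm y - \sum_(i < n) x ord0 i * y ord0 i).
  by move: h; set X := enorm x; set Y := enorm y; set S := \sum_(_ < _) _; lra.
by rewrite pmulr_rge0 ?subr_ge0// !mulr_gt0.
Qed.

Lemma ler_enormD x y : enorm (x + y) <= enorm x + enorm y.
Proof.
rewrite -(@ler_pXn2r _ 2)// ?nnegrE ?addr_ge0 ?enorm_ge0//.
rewrite sqr_enorm (_ : \sum_(i < n) _ = \sum_(i < n) x ord0 i ^+ 2
  + \sum_(i < n) y ord0 i ^+ 2 + 2 * \sum_(i < n) x ord0 i * y ord0 i); last first.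
  by rewrite mulr_sumr -!big_split; apply: eq_bigr => i _ /=; rewrite mxE; ring.
rewrite -!sqr_enorm sqrrD -mulr_natl.
by have := cauchy_schwarz_row x y; lra.
Qed.

Lemma ler_enorm_dist z x y : enorm (x - y) <= enorm (x - z) + enorm (z - y).
Proof. by apply: le_trans (ler_enormD _ _); rewrite addrA subrK. Qed.

Lemma measurable_enorm : measurable_fun [set: 'rV[R]_n] (@enorm R n).
Proof.
have ms : measurable_fun [set: R] (@Num.sqrt R).
  by apply: continuous_measurable_fun; exact: sqrt_continuous.
apply: (measurableT_comp ms).
apply: measurable_sum => i; apply: measurable_funX; exact: measurable_rV_coord.
Qed.


Lemma measurable_enormB (c : 'rV[R]_n) : measurable_fun [set: 'rV[R]_n] (fun x => enorm (x - c)).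
Proof.
apply: (measurableT_comp measurable_enorm).
apply: measurable_fun_rVP => i; under eq_fun do rewrite !mxE.
by apply: measurable_funB => //; exact: measurable_rV_coord.
Qed.

Lemma measurable_eball c (rho : R) : measurable (eball c rho).
Proof.
rewrite -[X in measurable X]setTI.
have := @measurable_enormB c measurableT `]-oo, rho[%classic (measurable_itv _).
by congr measurable; congr setI; apply/seteqP; split => x /=; rewrite in_itv.
Qed.

Definition cube c (rho : R) : set 'rV[R]_n :=
  [set x | forall i, `|x ord0 i - c ord0 i| < rho].

Lemma eball_sub_cube c (rho : R) : eball c rho `<=` cube c rho.
Proof.
move=> x cx i; apply: le_lt_trans cx.
by have := coord_le_enorm (x - c) i; rewrite !mxE.
Qed.

(** The side rho / (n + 1), smaller than the sharp rho / sqrt n, makes the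
    inclusion strict in every dimension, 0 included. *)
Lemma cube_sub_eball c (rho : R) : 0 < rho -> cube c (rho / n.+1%:R) `<=` eball c rho.
Proof.
move=> r0 x cx; rewrite /eball/= -(@ltr_pXn2r _ 2)// ?nnegrE ?enorm_ge0 ?(ltW r0)//.
rewrite sqr_enorm.
apply: (@le_lt_trans _ _ (\sum_(i < n) (rho / n.+1%:R) ^+ 2)).
  apply: ler_sum => i _; rewrite !mxE -real_normK ?num_real// ler_pXn2r ?nnegrE//.
    exact/ltW/cx.
  by rewrite divr_ge0// ltW.
rewrite sumr_const card_ord -[ltLHS]mulr_natr expr_div_n -mulrA -[ltRHS]mulr1 ltr_pM2l ?exprn_gt0//.
rewrite mulrC ltr_pdivrMr ?exprn_gt0// mul1r -natrX ltr_nat.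
by rewrite expnS expn1 (leq_trans (ltnSn n))// leq_pmulr.
Qed.

Lemma eballS c (rho rho' : R) : rho <= rho' -> eball c rho `<=` eball c rho'.
Proof. by move=> h x /lt_le_trans; apply. Qed.

Lemma eball_center c (rho : R) : 0 < rho -> eball c rho c.
Proof. by rewrite /eball/= subrr enorm0. Qed.

End euclidean_norm.

Section volume.
Context {R : realType}.

(** Lebesgue measure is built one coordinate at a time, and so is a cube:
    under the identification of R^(n+1) with R * R^n it is a product of an
    interval and a cube. *)
Lemma leb_cube n (c : 'rV[R]_n) (rho : R) : 0 <= rho ->
  measurable (cube c rho) /\ leb R n (cube c rho) = ((2 * rho) ^+ n)%:E.
Proof.
move=> r0; elim: n c => [|n IHn] c.
  have -> : cube c rho = setT.
    by apply/seteqP; split => // x _ [].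
  split; first exact: measurableT.
  by rewrite /= diracT expr0.
set c' : 'rV[R]_n := \row_j c ord0 (lift ord0 j).
have [mI mE] := IHn c'.
have E : cube c rho = (@rV_uncons R n) @^-1` (`]c ord0 ord0 - rho, c ord0 ord0 + rho[ `*` cube c' rho).
  apply/seteqP; split => x /=.
    move=> cx; split.
      by have := cx ord0; rewrite in_itv/= ltr_distl.
    by move=> i; rewrite !mxE; exact: cx.
  rewrite in_itv/= -ltr_distl => -[h0 h] i.
  by have [j ->|->//] := unliftP ord0 i; have := h j; rewrite !mxE.
have mJ : measurable (`]c ord0 ord0 - rho, c ord0 ord0 + rho[%classic
    `*` cube c' rho : set (measurableTypeR R * 'rV[R]_n)).
  exact: measurableX.
split.
  by rewrite E -[X in measurable X]setTI; exact: measurable_rV_uncons.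
rewrite /= /rV_cons_measure /pushforward E -comp_preimage.
rewrite (_ : @rV_uncons R n \o _ = id); last exact/funext/rV_consK.
rewrite preimage_id product_measure1E//; rewrite mE.
rewrite [X in (X * _)%E](_ : _ = (2 * rho)%:E); first by rewrite -EFinM -exprS.
have -> : 2 * rho = (c ord0 ord0 + rho) - (c ord0 ord0 - rho) by ring.
rewrite [LHS]lebesgue_measure_itv/= lte_fin.
case: ltP => //; rewrite -subr_le0 (_ : _ - _ = 2 * rho); last by ring.
by rewrite pmulr_rle0// => r1; have -> : rho = 0; [lra|rewrite mulr0].
Qed.

Context {n : nat}.
Local Notation mu := (leb R n).
Implicit Types (c x y : 'rV[R]_n).

Lemma leb_eball_le c (rho : R) : 0 <= rho -> (mu (eball c rho) <= ((2 * rho) ^+ n)%:E)%E.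
Proof.
move=> r0; have [mI <-] := leb_cube c r0.
by apply: le_measure; rewrite ?inE//; [exact: measurable_eball|exact: eball_sub_cube].
Qed.

Lemma leb_eball_ge c (rho : R) : 0 < rho ->
  (((2 * (rho / n.+1%:R)) ^+ n)%:E <= mu (eball c rho))%E.
Proof.
move=> r0; have r1 : 0 <= rho / n.+1%:R by rewrite divr_ge0// ltW.
have [mI <-] := leb_cube c r1.
by apply: le_measure; rewrite ?inE//; [exact: measurable_eball|exact: cube_sub_eball].
Qed.

Lemma leb_eball c (rho : R) : 0 < rho -> mu (eball c rho) = (vol (eball c rho))%:E.
Proof.
move=> r0; rewrite /vol fineK// ge0_fin_numE//.
by apply: le_lt_trans (leb_eball_le c (ltW r0)) _; rewrite ltry.
Qed.

Lemma vol_eball_le c (rho : R) : 0 < rho -> vol (eball c rho) <= 2 ^+ n * rho ^+ n.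
Proof. by move=> r0; rewrite -exprMn -lee_fin -leb_eball// leb_eball_le// ltW. Qed.

(** The volume of the inscribed cube: bounds up to a constant that depends on n
    suffice in all estimates. *)
Lemma vol_eball_ge c (rho : R) : 0 < rho ->
  (2 / n.+1%:R) ^+ n * rho ^+ n <= vol (eball c rho).
Proof.
move=> r0; rewrite -exprMn -lee_fin -leb_eball// mulrAC -mulrA.
exact: leb_eball_ge.
Qed.

Lemma vol_eball_gt0 c (rho : R) : 0 < rho -> 0 < vol (eball c rho).
Proof.
move=> r0; apply: lt_le_trans (vol_eball_ge c r0).
by rewrite mulr_gt0// exprn_gt0// divr_gt0.
Qed.

End volume.

Section topology.
Context {R : realType} {n : nat}.
Local Notation mu := (leb R n).
Implicit Types (c x y : 'rV[R]_n).

(** A set that contains a cube around each of its points is the union of the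
    countably many cubes with rational centre and side 1 / (k + 1) that it
    contains. *)
Lemma cube_open_measurable (U : set 'rV[R]_n) :
  (forall x, U x -> exists2 e : R, 0 < e & cube x e `<=` U) -> measurable U.
Proof.
move=> oU.
pose F (p : 'rV[rat]_n * nat) := cube (map_mx ratr p.1 : 'rV[R]_n) p.2.+1%:R^-1.
have -> : U = \bigcup_(p in [set p | F p `<=` U]) F p.
  apply/seteqP; split => [x Ux|x [p /= pU]]; last exact: pU.
  have [e e0 xU] := oU _ Ux.
  have [k ke] : exists k : nat, k.+1%:R^-1 < e / 2.
    have [k /= _ /(_ _ (leqnn k)) ke] := near_infty_natSinv_lt (PosNum (divr_gt0 e0 (@ltr0Sn R 1))).
    by exists k.
  have /choice[q hq] : forall i, exists q : rat, `|x ord0 i - ratr q| < k.+1%:R^-1 :> R.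
    move=> i; have k0 : x ord0 i - k.+1%:R^-1 < x ord0 i + k.+1%:R^-1.
      by rewrite ltrBlDr -addrA ltrDl addr_gt0// invr_gt0.
    have [q] := rat_in_itvoo k0.
    by rewrite in_itv/= -ltr_distl => hq; exists q; rewrite distrC.
  exists (\row_i q i, k); last by move=> i; rewrite !mxE.
  move=> y /= hy; apply: xU => i.
  have := hy i; rewrite !mxE => {}hy.
  rewrite -(subrK (ratr (q i)) (y ord0 i)) -addrA.
  rewrite (le_lt_trans (ler_normD _ _))// (splitr e) ltrD//.
    exact: lt_trans ke.
  by rewrite distrC; exact: lt_trans ke.
rewrite bigcup_mkcond; apply: countable_bigcupT_measurable => [|p].
  exact: countableP.
case: ifPn => // _.
by have [] := @leb_cube R n (map_mx ratr p.1) p.2.+1%:R^-1.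
Qed.

Lemma compact_measurable_rV (D : set 'rV[R]_n) : compact D -> measurable D.
Proof.
move=> cD; have clD : closed D by apply: compact_closed => //; exact: norm_hausdorff.
rewrite -(setCK D); apply: measurableC; apply: cube_open_measurable => x Dx.
have : open (~` D) by exact: closed_openC.
move=> /(_ _ Dx) /nbhs_ballP[e /= e0 xe]; exists e => // y xy.
apply: xe; split => // i j; rewrite (ord1 i) /ball/= distrC; exact: xy.
Qed.

Lemma compact_sub_eball (D : set 'rV[R]_n) : compact D ->
  exists2 rho : R, 0 < rho & D `<=` eball 0 rho.
Proof.
move=> /compact_bounded[M [Mr hM]].
pose e := Num.max 1 (M + 1).
have e0 : 0 < e by rewrite lt_max ltr01.
have Me : M < e by rewrite lt_max ltrDl ltr01 orbT.
exists ((e + 1) * n.+1%:R); first by rewrite mulr_gt0// addr_gt0.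
move=> x /(hM _ Me) xe; apply: cube_sub_eball.
  by rewrite mulr_gt0// addr_gt0.
move=> i; rewrite mulfK// mxE subr0 (@le_lt_trans _ _ e)// ?ltrDl//.
apply: le_trans xe; rewrite [leRHS]/Num.norm/= mx_normrE.
by apply/bigmax_geP; right => /=; exists (ord0, i).
Qed.

(** Local integrability is stated on compact sets; this lets it be used on
    balls. *)
Lemma eball_sub_compact c (rho : R) : exists D : set 'rV[R]_n,
  [/\ compact D, measurable D & eball c rho `<=` D].
Proof.
pose D := [set v : 'rV[R]_n | forall i, v ord0 i \in `[(c ord0 i - rho), (c ord0 i + rho)]].
have cD : compact D.
  apply: (@rV_compact _ _ (fun i => `[(c ord0 i - rho), (c ord0 i + rho)]%classic)).
  by move=> i; exact: segment_compact.
exists D; split => //; first exact: compact_measurable_rV.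
move=> x /eball_sub_cube cx i; rewrite in_itv/= -ler_distl; exact/ltW/cx.
Qed.

Lemma Lip_measurable (delta : R) (b : 'rV[R]_n -> R) : 0 < delta -> Lip delta b ->
  measurable_fun [set: 'rV[R]_n] b.
Proof.
move=> d0 [C C0 bC]; apply: (measurability _ (RGenOInfty.measurableE R)) => //.
move=> _ [_ [a ->] <-].
rewrite setTI; apply: cube_open_measurable => x /=; rewrite in_itv/= andbT => ax.
pose g := (b x - a) / C.
have g0 : 0 < g by rewrite divr_gt0// subr_gt0.
pose e := g `^ delta^-1.
have e0 : 0 < e by rewrite powR_gt0.
exists (e / n.+1%:R); first by rewrite divr_gt0.
move=> y /(cube_sub_eball e0) xy; rewrite /= in_itv/= andbT.
have : b x - b y < C * g.
  apply: le_lt_trans (ler_norm _) _; apply: le_lt_trans (bC _ _) _.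
  rewrite ltr_pM2l// enorm_distC -[ltRHS](powRr1 (ltW g0)) -(@mulVf _ delta) ?gt_eqF//.
  by rewrite powRrM gt0_ltr_powR// nnegrE ?enorm_ge0// ltW.
by rewrite /g mulrC divfK ?gt_eqF// ltrBlDr -ltrBlDl opprB addrC subrK.
Qed.

End topology.

(** * Means and oscillations over balls *)

Section mean.
Context {R : realType} {n : nat}.
Local Notation mu := (leb R n).
Variables (c : 'rV[R]_n) (rho : R) (rho0 : 0 < rho).
Implicit Types (g h : 'rV[R]_n -> R) (a E : R).
Local Notation B := (eball c rho).
Let mB : measurable B. Proof. exact: measurable_eball. Qed.
Let V0 : 0 < vol B. Proof. exact: vol_eball_gt0. Qed.

Lemma eball_bounded_integrable g E : measurable_fun setT g ->
  (forall x, B x -> `|g x| <= E) -> mu.-integrable B (EFin \o g).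
Proof.
move=> mg gE; apply: measurable_bounded_integrable => //.
- by rewrite [ltLHS](leb_eball c rho0) ltry.
- exact: measurable_funS mg.
- exists E; split; first exact: num_real.
  by move=> M EM x /gE /le_trans; apply; exact: ltW.
Qed.

Lemma eball_cst_integrable a : mu.-integrable B (EFin \o cst a).
Proof. by apply: (@eball_bounded_integrable _ `|a|) => //. Qed.

Lemma mean_cst a : mean B (cst a) = a.
Proof.
by rewrite /mean Rintegral_cst//= -[fine _]/(vol B) mulrCA mulVf ?mulr1// gt_eqF.
Qed.

Lemma meanB g h : mu.-integrable B (EFin \o g) -> mu.-integrable B (EFin \o h) ->
  mean B (fun x => g x - h x) = mean B g - mean B h.
Proof. by move=> ig ih; rewrite /mean RintegralB// mulrBr. Qed.

Lemma meanZr g a : mu.-integrable B (EFin \o g) ->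
  mean B (fun x => g x * a) = mean B g * a.
Proof. by move=> ig; rewrite /mean RintegralZr// mulrA. Qed.

Lemma le_mean g h : mu.-integrable B (EFin \o g) -> mu.-integrable B (EFin \o h) ->
  (forall x, B x -> g x <= h x) -> mean B g <= mean B h.
Proof.
by move=> ig ih gh; rewrite /mean ler_pM2l ?invr_gt0//; exact: le_Rintegral.
Qed.

Lemma le_norm_mean g : mu.-integrable B (EFin \o g) ->
  `|mean B g| <= mean B (fun x => `|g x|).
Proof.
move=> ig; rewrite /mean normrM gtr0_norm ?invr_gt0// ler_pM2l ?invr_gt0//.
exact: le_normr_Rintegral.
Qed.

Lemma integrableB_cst g a : mu.-integrable B (EFin \o g) ->
  mu.-integrable B (EFin \o (fun x => g x - a)).
Proof.
move=> ig; have := integrableB mB ig (eball_cst_integrable a).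
by congr (mu.-integrable).
Qed.

Lemma integrable_normr g : mu.-integrable B (EFin \o g) ->
  mu.-integrable B (EFin \o (fun x => `|g x|)).
Proof. by move=> /integrable_norm. Qed.

Lemma integral_eball_mean g : mu.-integrable B (EFin \o g) ->
  (\int[mu]_(x in B) (g x)%:E = (vol B * mean B g)%:E)%E.
Proof.
move=> ig; rewrite /mean mulrA mulfV ?mul1r ?gt_eqF//.
rewrite /Rintegral fineK//; exact: integrable_fin_num.
Qed.

Lemma mean_near g a E : mu.-integrable B (EFin \o g) ->
  (forall x, B x -> `|g x - a| <= E) -> `|mean B g - a| <= E.
Proof.
move=> ig gE.
rewrite -{1}(mean_cst a) -meanB//; last exact: eball_cst_integrable.
have ih := integrableB_cst a ig.
apply: le_trans (le_norm_mean ih) _.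
rewrite -[leRHS](mean_cst E); apply: le_mean => //; first exact: integrable_normr.
exact: eball_cst_integrable.
Qed.

(** The mean is within a factor 2 of the best constant: |mean - a| is at most
    the mean of |g - a|. *)
Lemma oscillation_le g a : mu.-integrable B (EFin \o g) ->
  (\int[mu]_(x in B) `|g x - mean B g|%:E <= 2%:E * \int[mu]_(x in B) `|g x - a|%:E)%E.
Proof.
move=> ig; have ih := integrableB_cst a ig.
rewrite !integral_eball_mean ?integrable_normr ?integrableB_cst//.
rewrite -EFinM lee_fin [leRHS]mulrCA ler_pM2l// mulr_natl mulr2n.
have h : `|a - mean B g| <= mean B (fun x => `|g x - a|).
  by rewrite distrC -{1}(mean_cst a) -meanB ?le_norm_mean//; exact: eball_cst_integrable.
apply: (@le_trans _ _ (mean B (fun x => `|g x - a| - (- `|a - mean B g|)))).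
  apply: le_mean; rewrite ?integrableB_cst ?integrable_normr ?integrableB_cst//.
  by move=> x Bx; rewrite opprK; exact: ler_distD.
rewrite meanB ?mean_cst ?opprK ?lerD2l//; first exact: integrable_normr.
exact: eball_cst_integrable.
Qed.

(** Used with h the critical term, g the commutator and a the part that is
    constant in x: the oscillation of h is controlled by that of g. *)
Lemma oscillation_near g h a E :
  mu.-integrable B (EFin \o g) -> mu.-integrable B (EFin \o h) ->
  (forall x, B x -> `|g x - h x - a| <= E) ->
  (\int[mu]_(x in B) `|h x - mean B h|%:E
   <= \int[mu]_(x in B) `|g x - mean B g|%:E + (vol B * (2 * E))%:E)%E.
Proof.
move=> ig ih gh.
rewrite !integral_eball_mean ?integrable_normr ?integrableB_cst//.
rewrite -EFinD lee_fin -mulrDr ler_pM2l//.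
have igh : mu.-integrable B (EFin \o (fun x => g x - h x)).
  by have := integrableB mB ig ih; congr (mu.-integrable).
have := mean_near igh gh; rewrite meanB// => hm.
apply: (@le_trans _ _ (mean B (fun x => `|g x - mean B g| - (- (2 * E))))).
  apply: le_mean; rewrite ?integrableB_cst ?integrable_normr ?integrableB_cst//.
  move=> x Bx; have := gh _ Bx; move: hm; rewrite !ler_norml => /andP[h1 h2] /andP[h3 h4].
  have := ler_norm (g x - mean B g); have := ler_norm (- (g x - mean B g)).
  by rewrite normrN => h5 h6; apply/andP; split; lra.
rewrite meanB ?mean_cst ?opprK ?lerD2l//; rewrite ?integrable_normr ?integrableB_cst//.
exact: eball_cst_integrable.
Qed.

End mean.

(** * Weights *)

Section weight.
Context {R : realType} {n : nat}.
Local Notation mu := (leb R n).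
Implicit Types (c x y : 'rV[R]_n) (rho : R) (w : 'rV[R]_n -> R) (B : set 'rV[R]_n).

(** The real number behind the norm of w 1_B in the definition of the weighted
    Lipschitz space; finite for the weights considered here by A_infty_eball.
    *)
Definition wsup w B : R := fine ('N[mu]_+oo[EFin \o (w \* \1_B)%R])%E.

(** Turns statements that hold almost everywhere on a ball into statements
    about at least one point. *)
Lemma not_ae_eball c rho : 0 < rho -> ~ {ae mu, forall x, ~ eball c rho x}.
Proof.
move=> r0 /= h.
have mB : measurable (eball c rho) by exact: measurable_eball.
have : mu.-negligible (eball c rho).
  move: h; rewrite /almost_everywhere/= => h; apply: negligibleS h => x Bx /=.
  exact.
move/(negligibleP _ mB)/eqP; rewrite [X in X == _](leb_eball c r0) eqe.
by rewrite gt_eqF// vol_eball_gt0.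
Qed.

Lemma leb_setT_gt0 : (0 < mu [set: 'rV[R]_n])%E.
Proof.
apply: (@lt_le_trans _ _ (mu (eball 0 1))).
  by rewrite [ltRHS](leb_eball 0 ltr01) lte_fin vol_eball_gt0.
by apply: le_measure; rewrite ?inE//; exact: measurable_eball.
Qed.

Lemma Lnorm_oo (f : 'rV[R]_n -> \bar R) : ('N[mu]_+oo[f] = ess_sup mu (abse \o f))%E.
Proof. by rewrite unlock leb_setT_gt0. Qed.

Lemma measurable_inv_ge0 w : (forall x, 0 <= w x) ->
  measurable_fun setT w -> measurable_fun setT (fun x => (w x)^-1).
Proof.
move=> w0 mw; under eq_fun => x do rewrite -powR_inv1//.
exact: (measurableT_comp (measurable_powR _)).
Qed.

(** Let I be the integral of w^(-s') over B, which is positive since w is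
    finite and finite by local integrability. The A_1 inequality says that
    w^s' <= C |B| / I almost everywhere on B. This bounds the supremum M of w
    on B, and M^s' I <= C |B| is the last claim. *)
Lemma A_infty_eball (s : R) w : 1 < s -> weight (EFin \o w) -> A_infty s w ->
  let s' := conj_exponent s in
  exists2 C : R, 0 < C & forall c rho, 0 < rho ->
  let B := eball c rho in
  [/\ 0 < wsup w B, ('N[mu]_+oo[EFin \o (w \* \1_B)%R] = (wsup w B)%:E)%E,
      {ae mu, forall x, B x -> 0 < w x <= wsup w B} &
      (\int[mu]_(x in B) ((wsup w B / w x) `^ s')%:E <= (C * vol B)%:E)%E].
Proof.
move=> s1 [w0' [mw _]] hA s'.
have s'0 : 0 < s' by rewrite /s' /conj_exponent divr_gt0 ?subr_gt0// (lt_trans ltr01).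
have w0 x : 0 <= w x by have := w0' x; rewrite /= lee_fin.
move: hA => [[sig0 [msig lsig]] [C C0 hC]].
set sig := (fun x => _) in sig0 msig lsig hC.
have sig_ge0 x : (0 <= sig x)%E := sig0 x.
have {}lsig : forall D, compact D -> (\int[mu]_(x in D) `|sig x| < +oo)%E := lsig.
have sigE x : sig x = if w x `^ s' == 0 then +oo%E else ((w x `^ s')^-1)%:E.
  by rewrite /sig inver.
exists C => // c rho r0 B.
have mB : measurable B by exact: measurable_eball.
have V0 : 0 < vol B by exact: vol_eball_gt0.
have mwV : measurable_fun setT (fun x => (w x)^-1).
  by apply: measurable_inv_ge0 => //; exact/measurable_EFinP.
have msB : measurable_fun B sig by exact: measurable_funS msig.
pose I := (\int[mu]_(x in B) sig x)%E.
have Iy : (I < +oo)%E.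
  have [D [cD mD BD]] := eball_sub_compact c rho.
  apply: le_lt_trans (lsig D cD).
  rewrite (_ : I = \int[mu]_(x in B) `|sig x|)%E; last first.
    by apply: eq_integral => x _; rewrite gee0_abs//; exact: sig_ge0.
  apply: ge0_subset_integral => //.
  by apply: measurableT_comp => //; exact: measurable_funS msig.
have I_ge0 : (0 <= I)%E by exact: integral_ge0.
have isig : mu.-integrable B sig.
  apply/integrableP; split => //.
  by under eq_integral => x _ do rewrite gee0_abs//.
have sig_neq0 x : (sig x != 0)%E.
  by rewrite sigE; case: ifPn => // h; rewrite eqe invr_eq0.
have I_neq0 : (I != 0)%E.
  apply/eqP => I0.
  have : (\int[mu]_(x in B) `|sig x|)%E = 0%E.
    by rewrite -I0; apply: eq_integral => x _; rewrite gee0_abs.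
  move/(ae_eq_integral_abs mu mB msB) => h.
  apply: (@not_ae_eball c rho r0); move: h; apply: filterS => x /= h /h /eqP.
  exact/negP.
have IE : I = (fine I)%:E by rewrite fineK// ge0_fin_numE.
set i := fine I in IE.
have i0 : 0 < i.
  by rewrite lt_neqAle -lee_fin -IE I_ge0 andbT eq_sym -eqe -IE.
pose T := C * vol B / i.
have T0 : 0 < T by rewrite divr_gt0// mulr_gt0.
have ae1 : {ae mu, forall x, B x -> 0 < w x /\ w x `^ s' <= T}.
  have := integrable_ae mB isig.
  have := hC c rho r0.
  apply: filterS2 => x /= h1 h2 Bx; move: (h1 Bx) (h2 Bx).
  rewrite -/I IE sigE; case: ifPn => // wx h _; split.
    rewrite lt_neqAle w0 andbT; apply/eqP => w0x; move: wx.
    by rewrite -w0x powR0 ?eqxx// gt_eqF.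
  have wp : 0 < w x `^ s' by rewrite lt_neqAle eq_sym wx powR_ge0.
  move: h; rewrite -[X in (_ <= C%:E * X)%E]/(sig x) sigE (negbTE wx).
  rewrite -!EFinM lee_fin ler_pdivlMr// -ler_pdivlMl ?mulr_gt0 ?invr_gt0//.
  rewrite /T => /le_trans; apply.
  by rewrite invfM invrK mulrC mulrA.
have NT : ('N[mu]_+oo[EFin \o (w \* \1_B)%R] <= (T `^ s'^-1)%:E)%E.
  rewrite Lnorm_oo; apply/ess_supP; move: ae1; apply: filterS => x /= h.
  rewrite lee_fin indicE; have [xB|xB] := boolP (x \in B); last first.
    by rewrite mulr0 normr0 powR_ge0.
  move: xB; rewrite inE => /h[wx0 wT]; rewrite mulr1 ger0_norm//.
  rewrite -[leLHS]powRr1// -(@mulfV _ s') ?gt_eqF// powRrM.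
  by rewrite ge0_ler_powR ?nnegrE ?powR_ge0 ?invr_ge0// ltW.
have NE : ('N[mu]_+oo[EFin \o (w \* \1_B)%R] = (wsup w B)%:E)%E.
  by rewrite /wsup fineK// ge0_fin_numE ?Lnorm_ge0// (le_lt_trans NT)// ltry.
have ae2 : {ae mu, forall x, B x -> 0 < w x <= wsup w B}.
  have := ess_sup_ge mu (abse \o (EFin \o (w \* \1_B)%R)).
  rewrite -Lnorm_oo NE; move: ae1; apply: filterS2 => x /= h1 + Bx.
  have [-> _] := h1 Bx.
  by rewrite lee_fin indicE mem_set// mulr1 ger0_norm.
have M0 : 0 < wsup w B.
  rewrite ltNge; apply/negP => M0; apply: (@not_ae_eball c rho r0).
  move: ae2; apply: filterS => x h /h /andP[w1 w2].
  by have := lt_le_trans w1 (le_trans w2 M0); rewrite ltxx.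
have MT : wsup w B `^ s' <= T.
  rewrite NE lee_fin in NT.
  rewrite -[leRHS]powRr1 ?(ltW T0)// -(@mulVf _ s') ?gt_eqF// [leRHS]powRrM.
  by rewrite ge0_ler_powR ?nnegrE ?powR_ge0 ?(ltW M0)// ltW.
split => //.
apply: (@le_trans _ _ (\int[mu]_(x in B) ((wsup w B `^ s')%:E * sig x))%E).
  apply: ge0_le_integral => //.
  - by move=> x _; rewrite lee_fin powR_ge0.
  - apply/measurable_EFinP; apply: (measurableT_comp (measurable_powR _)).
    apply: measurable_funM => //; apply: measurable_funS mwV => //.
  - exact: measurable_funeM.
  - move=> x _; rewrite sigE; case: ifPn => h.
      by rewrite gt0_muley ?leey// lte_fin powR_gt0.
    rewrite -EFinM lee_fin powRM ?(ltW M0) ?invr_ge0//.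
    by rewrite powR_inv// powRN.
rewrite ge0_integralZl// ?lee_fin ?powR_ge0// -/I IE -EFinM lee_fin.
apply: le_trans (_ : T * i <= _); first by rewrite ler_pM2r.
by rewrite /T divfK// gt_eqF.
Qed.

Lemma wsup_le (w : 'rV[R]_n -> R) c rho c' rho' : (forall x, 0 <= w x) ->
  ('N[mu]_+oo[EFin \o (w \* \1_(eball c' rho'))%R] < +oo)%E ->
  eball c rho `<=` eball c' rho' -> wsup w (eball c rho) <= wsup w (eball c' rho').
Proof.
move=> w0 Ny BB'; rewrite /wsup.
have h : ('N[mu]_+oo[EFin \o (w \* \1_(eball c rho))%R] <=
          'N[mu]_+oo[EFin \o (w \* \1_(eball c' rho'))%R])%E.
  rewrite !Lnorm_oo; apply: le_ess_sup; apply/nearW => x /=.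
  rewrite lee_fin !indicE.
  have [xB|xB] := boolP (x \in eball c rho); last by rewrite mulr0 normr0.
  by rewrite mem_set//; apply: BB'; rewrite inE in xB.
apply: fine_le => //; rewrite ge0_fin_numE ?Lnorm_ge0//.
exact: le_lt_trans Ny.
Qed.

(** Since r > s, the conjugate exponent r' is below s'. Almost everywhere on B
    one has M / w >= 1, so (M / w)^r' <= (M / w)^s', whose integral is at most
    C |B|. Hoelder's inequality for M |f| = |f w| (M / w) concludes. *)
Lemma A_infty_hoelder (s r : R) w : 1 < s -> s < r ->
  weight (EFin \o w) -> A_infty s w ->
  exists2 C : R, 0 < C & forall c rho, 0 < rho -> forall f, in_Lw r w f ->
  ((wsup w (eball c rho))%:E * \int[mu]_(x in eball c rho) `|f x|%:E <=
   (C * vol (eball c rho) `^ (1 - r^-1))%:E * wnorm r w f)%E.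
Proof.
move=> s1 sr hw hA.
have [C C0 hC] := A_infty_eball s1 hw hA.
have r0 : 0 < r by apply: lt_trans sr; apply: lt_trans s1.
have r1 : 1 < r by exact: lt_trans sr.
pose r' := (1 - r^-1)^-1.
have q0 : 0 < 1 - r^-1 by rewrite subr_gt0 invf_lt1.
have r'0 : 0 < r' by rewrite invr_gt0.
have r's' : r' <= conj_exponent s.
  rewrite /r' /conj_exponent -(invrK (s / (s - 1))) lef_pV2 ?posrE//; last first.
    by rewrite invr_gt0 divr_gt0 ?subr_gt0// (lt_trans ltr01).
  rewrite invf_div mulrBl mulfV ?gt_eqF ?(lt_trans ltr01)// mul1r lerD2l lerN2.
  by rewrite lef_pV2 ?posrE// ?(lt_trans ltr01)// ltW.
exists (C `^ (1 - r^-1)); first by rewrite powR_gt0.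
move=> c rho rho0 f [mf fw]; have [M0 ME aeM hI] := hC c _ rho0.
set B := eball c rho in M0 ME aeM hI *; set M := wsup w B in M0 ME aeM hI *.
have mB : measurable B by exact: measurable_eball.
have [w0' [/measurable_EFinP mw _]] := hw.
have w0 x : 0 <= w x by have := w0' x; rewrite /= lee_fin.
have V0 : 0 < vol B by exact: vol_eball_gt0.
pose h x := M / w x * \1_B x.
have mh : measurable_fun setT h.
  apply: measurable_funM; last exact: measurable_indic.
  by apply: measurable_funM => //; exact: measurable_inv_ge0.
have fwm : measurable_fun setT (f \* w) by exact: measurable_funM.
have pq : r^-1 + r'^-1 = 1 by rewrite invrK addrC subrK.
have H := hoelder mu fwm mh r0 r'0 pq.
apply: (@le_trans _ _ ('N[mu]_1[EFin \o ((f \* w) \* h)%R])%E).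
  rewrite Lnorm1 -ge0_integralZl//; last 2 first.
  - by apply/measurable_EFinP; apply: measurableT_comp => //; exact: measurable_funS mf.
  - by rewrite lee_fin ltW.
  rewrite [leLHS]integral_mkcond.
  apply: ae_ge0_le_integral => //.
  - by move=> x _; rewrite patchE; case: ifPn => // _; rewrite mule_ge0// lee_fin ltW.
  - apply/measurable_restrict => //; rewrite setTI.
    apply: measurable_funeM; apply/measurable_EFinP.
    by apply: measurableT_comp => //; exact: measurable_funS mf.
  - by apply/measurable_EFinP; apply: measurableT_comp => //; exact: measurable_funM.
  - move: aeM; apply: filterS => x /= + _; rewrite patchE /h indicE; case: ifPn => xB; last first.
      by rewrite mulr0 mulr0 normr0.
    move=> /(_ (set_mem xB))/andP[wx _]; rewrite -EFinM lee_fin mulr1.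
    have -> : f x * w x * (M / w x) = M * f x by field; rewrite gt_eqF.
    by rewrite normrM (gtr0_norm M0).
apply: le_trans H _; rewrite muleC.
apply: lee_wpmul2r; first exact: Lnorm_ge0.
rewrite unlock invrK -powRM ?(ltW C0) ?(ltW V0)// -poweR_EFin.
apply: gt0_ler_poweR; first exact: ltW.
- by rewrite in_itv/= leey andbT; apply: integral_ge0 => x _; rewrite lee_fin powR_ge0.
- by rewrite in_itv/= leey andbT lee_fin mulr_ge0// ltW.
apply: le_trans hI; rewrite [leRHS]integral_mkcond.
apply: ae_ge0_le_integral => //.
- by move=> x _; rewrite lee_fin powR_ge0.
- apply: (measurableT_comp (measurable_poweR _)).
  by apply: measurableT_comp => //; exact/measurable_EFinP.
- by move=> x _; rewrite patchE; case: ifPn => // _; rewrite lee_fin powR_ge0.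
- apply/measurable_restrict => //; rewrite setTI.
  apply/measurable_EFinP; apply: (measurableT_comp (measurable_powR _)).
  apply: measurable_funM => //; apply: measurable_funS (measurable_inv_ge0 w0 mw) => //.
- move: aeM; apply: filterS => x /= + _; rewrite patchE /h indicE; case: ifPn => xB; last first.
    by rewrite mulr0 normr0 powR0// gt_eqF.
  move=> /(_ (set_mem xB))/andP[wx wM].
  rewrite lee_fin mulr1 ger0_norm ?divr_ge0 ?(ltW M0) ?(ltW wx)//.
  by apply: ler_powR => //; rewrite ler_pdivlMr// mul1r.
Qed.

End weight.

(** * Dyadic sums and potentials *)

Section dyadic.
Context {R : realType}.

Lemma nneseries_geometric_le (u : nat -> \bar R) (a q : R) :
  0 <= a -> 0 < q < 1 -> (forall j, 0 <= u j)%E ->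
  (forall j, u j <= (a * q ^+ j)%:E)%E ->
  (\sum_(0 <= j <oo) u j <= (a / (1 - q))%:E)%E.
Proof.
move=> a0 /andP[q0 q1] u0 ua; apply: lime_le.
  by apply: is_cvg_nneseries => j _ _.
near=> N; apply: (@le_trans _ _ (series (geometric a q) N)%:E).
  rewrite /series/= -sumEFin; exact: lee_sum.
rewrite lee_fin; apply: geometric_le_lim => //.
by rewrite gtr0_norm.
Unshelve. all: by end_near. Qed.

Context {d : measure_display} {T : measurableType d} (mu : {measure set T -> \bar R}).

(** A function that is bounded at each point by one of countably many
    functions is bounded by their sum. *)
Lemma integral_le_dyadic (D : set T) (g : T -> \bar R) (h : nat -> T -> \bar R) (a q : R) :
  measurable D -> measurable_fun D g -> (forall x, D x -> 0 <= g x)%E ->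
  (forall j, measurable_fun D (h j)) -> (forall j x, D x -> 0 <= h j x)%E ->
  (forall x, D x -> exists j, g x <= h j x)%E ->
  0 <= a -> 0 < q < 1 ->
  (forall j, \int[mu]_(x in D) h j x <= (a * q ^+ j)%:E)%E ->
  (\int[mu]_(x in D) g x <= (a / (1 - q))%:E)%E.
Proof.
move=> mD mg g0 mh h0 gh a0 q01 ha.
apply: (@le_trans _ _ (\int[mu]_(x in D) (\sum_(0 <= j <oo) h j x))%E).
  apply: ge0_le_integral => //.
  - by apply: ge0_emeasurable_sum => //; move=> j x Dx _; exact: h0.
  - move=> x Dx; have [j gj] := gh x Dx; apply: le_trans gj _.
    apply: le_trans (nneseries_lim_ge j.+1 _); last by move=> k _ _; exact: h0.
    rewrite big_nat_recr//=; apply: leeDr.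
    by apply: sume_ge0 => i _; exact: h0.
rewrite integral_nneseries//.
apply: nneseries_geometric_le => // j.
by apply: integral_ge0 => x Dx; exact: h0.
Qed.

End dyadic.

Section potentials.
Context {R : realType} {n : nat}.
Local Notation mu := (leb R n).
Implicit Types (c x y : 'rV[R]_n) (rho : R) (f : 'rV[R]_n -> R).

Lemma measurable_enormB_powR c (p : R) :
  measurable_fun [set: 'rV[R]_n] (fun y => enorm (c - y) `^ p).
Proof.
under eq_fun do rewrite enorm_distC.
exact: (measurableT_comp (measurable_powR _) (measurable_enormB c)).
Qed.

Lemma measurable_indic_eball D c rho :
  measurable_fun D (\1_(eball c rho) : 'rV[R]_n -> R).
Proof. by apply: measurable_indic; exact: measurable_eball. Qed.

(** The least k with t < 2^k rho is positive, and its predecessor is the shell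
    of t. *)
Lemma dyadic_shell (t rho : R) : 0 < rho -> rho <= t ->
  exists j : nat, 2 ^+ j * rho <= t < 2 ^+ j.+1 * rho.
Proof.
move=> r0 rt.
have ex : exists k, t < 2 ^+ k * rho.
  pose k := (Num.truncn (t / rho)).+1; exists k.
  rewrite -ltr_pdivrMr//.
  apply: (@lt_le_trans _ _ k%:R); first by rewrite truncnS_gt.
  by rewrite -natrX ler_nat ltnW// ltn_expl.
have [[|k] hk kmin] := ex_minnP ex.
  by move: hk; rewrite expr0 mul1r ltNge rt.
exists k; rewrite hk andbT leNgt; apply/negP => /kmin; by rewrite ltnn.
Qed.

(** On the shell 2^j rho <= |c - y| < 2^(j+1) rho the power is at most (2^j
    rho)^(-p - th), and the integral of |f| over the ball of radius 2^(j+1)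
    rho is at most A (2^(j+1) rho)^p. The products are geometric in j with
    ratio 2^(-th). *)
Lemma tail_integral_le (p th : R) : 0 <= p -> 0 < th ->
  exists2 C : R, 0 < C & forall f c rho (A : R), measurable_fun setT f ->
  0 < rho -> 0 <= A ->
  (forall t, rho <= t -> (\int[mu]_(x in eball c t) `|f x|%:E <= (A * t `^ p)%:E)%E) ->
  (\int[mu]_(y in ~` eball c rho) (enorm (c - y) `^ (- p - th) * `|f y|)%:E
    <= (C * (A * rho `^ (- th)))%:E)%E.
Proof.
move=> p0 th0; pose q := 2 `^ (- th) : R.
have q01 : 0 < q < 1.
  exact: two_npowR_lt1.
exists (2 `^ p / (1 - q)).
  by rewrite divr_gt0 ?powR_gt0// subr_gt0; case/andP: q01.
move=> f c rho A mf r0 A0 hA.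
pose h (j : nat) y := ((2 ^+ j * rho) `^ (- p - th) * (`|f y| * \1_(eball c (2 ^+ j.+1 * rho)) y))%:E.
have mD : measurable (~` eball c rho) by apply: measurableC; exact: measurable_eball.
have rj (j : nat) : 0 < 2 ^+ j * rho by rewrite mulr_gt0// exprn_gt0.
have mfa : measurable_fun setT (fun y => `|f y|) by exact: measurableT_comp.
have -> : 2 `^ p / (1 - q) * (A * rho `^ (- th)) = (2 `^ p * A * rho `^ (- th)) / (1 - q).
  by rewrite -!mulrA; congr (_ * _); rewrite mulrC mulrA.
apply: (@integral_le_dyadic _ _ _ _ _ _ h) => //.
- apply/measurable_EFinP; apply: measurable_funM; last exact: measurable_funS mfa.
  exact: measurable_funS (measurable_enormB_powR c _).
- by move=> y _; rewrite lee_fin mulr_ge0 ?powR_ge0.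
- move=> j; apply/measurable_EFinP; apply: measurable_funM => //.
  apply: measurable_funM; first exact: measurable_funS mfa.
  exact: measurable_indic_eball.
- by move=> j y _; rewrite lee_fin mulr_ge0 ?powR_ge0// mulr_ge0.
- move=> y /=; rewrite /eball/= => /negP; rewrite -leNgt => cy.
  have [j /andP[j1 j2]] := dyadic_shell r0 cy.
  exists j; rewrite lee_fin indicE mem_set//= mulr1 ler_wpM2r//.
  rewrite enorm_distC ler_npowR//.
  by rewrite -opprD oppr_le0 addr_ge0// ltW.
- by rewrite !mulr_ge0 ?powR_ge0.
- move=> j; rewrite /h.
  apply: (@le_trans _ _ (((2 ^+ j * rho) `^ (- p - th))%:E * \int[mu]_(y in eball c (2 ^+ j.+1 * rho)) `|f y|%:E)%E).
    rewrite [leLHS](_ : _ = ((2 ^+ j * rho) `^ (- p - th))%:E * \int[mu]_(y in ~` eball c rho) (`|f y| * \1_(eball c (2 ^+ j.+1 * rho)) y)%:E)%E; last first.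
      under eq_integral do rewrite EFinM.
      rewrite ge0_integralZl//; last by rewrite lee_fin powR_ge0.
      apply/measurable_EFinP; apply: measurable_funM; first exact: measurable_funS mfa.
      exact: measurable_indic_eball.
    apply: lee_wpmul2l; first by rewrite lee_fin powR_ge0.
    rewrite [leRHS]integral_mkcond.
    apply: (@le_trans _ _ (\int[mu]_y (`|f y| * \1_(eball c (2 ^+ j.+1 * rho)) y)%:E)%E).
      apply: ge0_subset_integral => //.
      apply/measurable_EFinP; apply: measurable_funM => //.
      exact: measurable_indic_eball.
    rewrite le_eqVlt; apply/orP; left; apply/eqP; apply: eq_integral => y _.
    by rewrite patchE indicE; case: ifPn => _; rewrite ?mulr1 ?mulr0.
  have h1 : rho <= 2 ^+ j.+1 * rho by rewrite ler_pMl// exprn_ege1// ler1n.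
  apply: le_trans (lee_wpmul2l _ (hA _ h1)) _; first by rewrite lee_fin powR_ge0.
  rewrite -EFinM lee_fin le_eqVlt; apply/orP; left; apply/eqP.
  rewrite /q powR_exprn//; set z := 2 ^+ j * rho.
  have z0 : 0 < z := rj j.
  have -> : 2 ^+ j.+1 * rho = 2 * z by rewrite exprS mulrA.
  rewrite powRM ?(ltW z0)//.
  have -> : z `^ (- p - th) = z `^ (- p) * z `^ (- th) by rewrite powR_add.
  have -> : z `^ (- th) = (2 ^+ j) `^ (- th) * rho `^ (- th) by rewrite powRM// ltW.
  have -> : z `^ (- p) = (z `^ p)^-1 by rewrite powRN.
  have : z `^ p != 0 by rewrite gt_eqF// powR_gt0.
  move: (2 `^ p) (z `^ p) ((2 ^+ j) `^ (- th)) (rho `^ (- th)) => a1 a2 a3 a4 hne.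
  by field.
Qed.

(** Shells again, now shrinking to the centre y, where the integrand has the
    value 0 because the exponent is not 0. *)
Lemma leb_eball_integral_powR (be : R) : 0 < be -> be < n%:R ->
  exists2 C : R, 0 < C & forall y rho, 0 < rho ->
  (\int[mu]_(x in eball y rho) (enorm (x - y) `^ (be - n%:R))%:E <= (C * rho `^ be)%:E)%E.
Proof.
move=> b0 bn; pose q := 2 `^ (- be) : R.
have q01 : 0 < q < 1.
  exact: two_npowR_lt1.
have nbe : be - n%:R <= 0 by rewrite subr_le0 ltW.
pose A := 4 ^+ n * 2 `^ (n%:R - be) : R.
have A0 : 0 < A by rewrite mulr_gt0 ?powR_gt0// exprn_gt0.
exists (A / (1 - q)).
  by rewrite divr_gt0// subr_gt0; case/andP: q01.
move=> y rho r0.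
pose t j := (2^-1 ^+ j * rho : R).
have t0 j : 0 < t j by rewrite mulr_gt0// exprn_gt0// invr_gt0.
have t20 j : 0 < 2 * t j by rewrite mulr_gt0.
(* twice the radius of the shell, so that its outer sphere is included *)
pose h (j : nat) x := ((t j / 2) `^ (be - n%:R) * \1_(eball y (2 * t j)) x)%:E.
have mD : measurable (eball y rho) by exact: measurable_eball.
rewrite mulrAC.
apply: (@integral_le_dyadic _ _ _ _ _ _ h) => //.
- apply/measurable_EFinP.
  exact: measurable_funS (measurableT_comp (measurable_powR _) (measurable_enormB y)).
- by move=> x _; rewrite lee_fin powR_ge0.
- move=> j; apply/measurable_EFinP; apply: measurable_funM => //.
  exact: measurable_indic_eball.
- by move=> j x _; rewrite lee_fin mulr_ge0 ?powR_ge0.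
- move=> x Bx; have [->|xy] := eqVneq x y.
    exists 0%N; rewrite lee_fin subrr enorm0 powR0 ?mulr_ge0 ?powR_ge0//.
    by rewrite lt_eqF// subr_lt0.
  have d0 : 0 < enorm (x - y) by rewrite enorm_gt0// subr_eq0.
  have [j] := dyadic_shell d0 (ltW Bx).
  rewrite -(ler_pdivlMl _ _ (exprn_gt0 _ _))// -(ltr_pdivrMl _ _ (exprn_gt0 _ _))//.
  rewrite -!exprVn => /andP[j1 j2]; exists j.
  have xE : 2^-1 ^+ j.+1 * rho = t j / 2 by rewrite /t exprSr; ring.
  rewrite lee_fin indicE mem_set//=.
    by rewrite mulr1 ler_npowR ?divr_gt0// -xE ltW.
  by rewrite /eball/= (le_lt_trans j1)// ltr_pMl ?ltr1n//; exact: t0.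
- by rewrite mulr_ge0 ?powR_ge0// ltW.
- move=> j; rewrite /h.
  apply: (@le_trans _ _ (((t j / 2) `^ (be - n%:R))%:E * mu (eball y (2 * t j)))%E).
    under eq_integral do rewrite EFinM.
    rewrite ge0_integralZl ?lee_fin ?powR_ge0//; last first.
      apply/measurable_EFinP.
      exact: measurable_indic_eball.
    apply: lee_wpmul2l; first by rewrite lee_fin powR_ge0.
    rewrite integral_indic//; last exact: measurable_eball.
    by apply: le_measure; rewrite ?inE//; [apply: measurableI => //|]; exact: measurable_eball.
  apply: le_trans (lee_wpmul2l _ (leb_eball_le y (ltW (t20 j)))) _.
    by rewrite lee_fin powR_ge0.
  rewrite -EFinM lee_fin le_eqVlt; apply/orP; left; apply/eqP.
  have -> : A * rho `^ be * q ^+ j = 4 ^+ n * 2 `^ (n%:R - be) * t j `^ be.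
    have -> : t j `^ be = (2^-1 ^+ j) `^ be * rho `^ be.
      by rewrite powRM ?(ltW r0)// exprn_ge0// invr_ge0.
    have -> : q ^+ j = (2^-1 ^+ j) `^ be.
      by rewrite /q powR_exprn// -powR_inv ?exprn_ge0// exprVn.
    rewrite /A; move: (2 `^ _) ((_ ^+ j) `^ be) (rho `^ be) (4 ^+ n) => a1 a2 a3 a4; ring.
  have -> : 2 * (2 * t j) = 4 * t j by ring.
  rewrite exprMn powRM ?invr_ge0 ?(ltW (t0 j))//.
  have -> : (2^-1 : R) `^ (be - n%:R) = 2 `^ (n%:R - be).
    by rewrite powR_inv// opprB.
  rewrite -[t j ^+ n]powR_mulrn ?(ltW (t0 j))//.
  have -> : t j `^ be = t j `^ (be - n%:R) * t j `^ n%:R.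
    by rewrite -powR_add ?subrK.
  move: (2 `^ (n%:R - be)) (t j `^ (be - n%:R)) (t j `^ n%:R) (4 ^+ n : R) => a1 a2 a3 a4; ring.
Qed.


Lemma measurable_rVB :
  measurable_fun setT (fun p : 'rV[R]_n * 'rV[R]_n => p.1 - p.2).
Proof.
apply: measurable_fun_rVP => i; under eq_fun do rewrite !mxE.
apply: measurable_funB.
  exact: (measurableT_comp (measurable_rV_coord i) measurable_fst).
exact: (measurableT_comp (measurable_rV_coord i) measurable_snd).
Qed.

(** By Tonelli's theorem the integral in x comes first; it runs over a ball
    inside the ball of centre y and radius 3 rho, and is therefore at most C
    rho^be. *)
Lemma local_integral_le (be : R) : 0 < be -> be < n%:R ->
  exists2 C : R, 0 < C & forall c rho f, 0 < rho -> measurable_fun setT f ->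
  (\int[mu]_(x in eball c rho) \int[mu]_(y in eball c (2 * rho))
     (enorm (x - y) `^ (be - n%:R) * `|f y|)%:E
   <= (C * rho `^ be)%:E * \int[mu]_(y in eball c (2 * rho)) `|f y|%:E)%E.
Proof.
move=> b0 bn; have [C C0 hC] := leb_eball_integral_powR b0 bn.
exists (C * 3 `^ be); first by rewrite mulr_gt0// powR_gt0.
move=> c rho f r0 mf.
have mfa : measurable_fun setT (fun y => `|f y|) by exact: measurableT_comp.
pose B := eball c rho; pose B2 := eball c (2 * rho).
have mB : measurable B by exact: measurable_eball.
have mB2 : measurable B2 by exact: measurable_eball.
pose F (p : 'rV[R]_n * 'rV[R]_n) :=
  (enorm (p.1 - p.2) `^ (be - n%:R) * `|f p.2| * \1_B p.1 * \1_B2 p.2)%:E.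
have mF : measurable_fun setT F.
  apply/measurable_EFinP; apply: measurable_funM.
    apply: measurable_funM.
      apply: measurable_funM.
        apply: (measurableT_comp (measurable_powR _)).
        exact: (measurableT_comp measurable_enorm measurable_rVB).
      exact: (measurableT_comp mfa measurable_snd).
    apply: (@measurableT_comp _ _ _ _ _ _ (\1_B : 'rV[R]_n -> R)) => //.
  apply: (@measurableT_comp _ _ _ _ _ _ (\1_B2 : 'rV[R]_n -> R)) => //.
have F0 p : (0 <= F p)%E by rewrite lee_fin !mulr_ge0// powR_ge0.
have mE x : measurable_fun B2 (fun y => (enorm (x - y) `^ (be - n%:R) * `|f y|)%:E).
  apply/measurable_EFinP; apply: measurable_funM; last exact: measurable_funS mfa.
  exact: measurable_funS (measurable_enormB_powR x _).
have -> : (\int[mu]_(x in eball c rho) \int[mu]_(y in eball c (2 * rho))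
     (enorm (x - y) `^ (be - n%:R) * `|f y|)%:E = \int[mu]_x \int[mu]_y F (x, y))%E.
  rewrite [LHS]integral_mkcond; apply: eq_integral => x _; rewrite patchE /F/= indicE.
  case: ifPn => xB; last first.
    by under eq_integral do rewrite mulr0 mul0r; rewrite integral0.
  rewrite [LHS]integral_mkcond; apply: eq_integral => y _; rewrite patchE indicE.
  by case: ifPn => _; rewrite !mulr1 ?mulr0.
rewrite (fubini_tonelli F mF F0).
rewrite -ge0_integralZl//; last 2 first.
- by apply/measurable_EFinP; exact: measurable_funS mfa.
- by rewrite lee_fin !mulr_ge0 ?powR_ge0// ltW.
rewrite [leRHS]integral_mkcond; apply: ge0_le_integral => //.
- by move=> y _; apply: integral_ge0.
- exact: measurable_fun_fubini_tonelli_G.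
- apply/measurable_restrict => //; rewrite setTI; apply: measurable_funeM.
  by apply/measurable_EFinP; exact: measurable_funS mfa.
- move=> y _; rewrite patchE /F/= indicE; case: ifPn => yB; last first.
    by under eq_integral do rewrite mulr0; rewrite integral0.
  rewrite inE in yB.
  have h : B `<=` eball y (3 * rho).
    move=> x Bx; rewrite /eball/= (le_lt_trans (ler_enorm_dist c _ _))//.
    rewrite (_ : 3 * rho = rho + 2 * rho); last by ring.
    by rewrite ltrD// enorm_distC.
  have m1 : measurable_fun setT (fun x => enorm (x - y) `^ (be - n%:R)).
    exact: (measurableT_comp (measurable_powR _) (measurable_enormB y)).
  rewrite (_ : (\int[mu]_x _)%E = (`|f y|%:E * \int[mu]_(x in B) (enorm (x - y) `^ (be - n%:R))%:E)%E); last first.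
    rewrite -ge0_integralZl//; last 2 first.
    - by apply/measurable_EFinP; exact: measurable_funS m1.
    - by move=> x _; rewrite lee_fin powR_ge0.
    rewrite [RHS]integral_mkcond; apply: eq_integral => x _; rewrite patchE indicE.
    by case: ifPn => _; rewrite !mulr1 ?mulr0// mulrC EFinM.
  rewrite muleC; apply: lee_wpmul2r => //.
  have r30 : 0 < 3 * rho by rewrite mulr_gt0.
  have := hC y _ r30; rewrite powRM ?(ltW r0)// mulrA; apply: le_trans.
  apply: ge0_subset_integral => //.
  + exact: measurable_eball.
  + by apply/measurable_EFinP; exact: measurable_funS m1.
  + by move=> x _; rewrite lee_fin powR_ge0.
Qed.

End potentials.

(** * Pointwise size of the kernel *)

Section kernel.
Context {R : realType} {n : nat}.
Local Notation mu := (leb R n).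
Implicit Types (c x y z u : 'rV[R]_n) (rho : R) (K f b : 'rV[R]_n -> R).

(** On the ball of centre z and radius |z| / 4, which lies in an annulus of
    the size condition, K differs from K(z) by at most C |z|^(alpha - n).
    Averaging K over that ball gives the bound. *)
Lemma kernel_size (alpha eta : R) K : 0 < alpha -> alpha < n%:R -> 0 < eta ->
  measurable_fun setT K -> size_cond alpha K -> smooth_cond alpha eta K ->
  exists2 C : R, 0 < C & forall z, z != 0 -> `|K z| <= C * enorm z `^ (alpha - n%:R).
Proof.
move=> a0 an e0 mK [C1 C10 hS] [C2 C20 hH].
pose v : R := (2 / n.+1%:R) ^+ n * 4^-1 ^+ n.
have v0 : 0 < v by rewrite mulr_gt0// exprn_gt0// ?invr_gt0// divr_gt0.
exists (C1 / v + C2); first by rewrite addr_gt0// divr_gt0.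
move=> z z0; set t := enorm z; have t0 : 0 < t by exact: enorm_gt0.
have t40 : 0 < t / 4 by rewrite divr_gt0.
pose B := eball z (t / 4).
have mB : measurable B by exact: measurable_eball.
have V0 : 0 < vol B by exact: vol_eball_gt0.
have near x : B x -> `|K z| <= `|K x| + C2 * t `^ (alpha - n%:R).
  move=> Bx; have zx : enorm (z - x) < t / 4 by rewrite enorm_distC.
  have := hH z x 0; rewrite !subr0 !sub0r => /(_ _).
  have h : 2 * enorm (z - x) <= enorm z by rewrite -/t; lra.
  move=> /(_ h) {}h.
  have h1 : `|K z - K x| <= C2 * (enorm (z - x) `^ eta / t `^ (n%:R - alpha + eta)).
    by apply: le_trans h; rewrite lerDl.
  have h2 : enorm (z - x) `^ eta / t `^ (n%:R - alpha + eta) <= t `^ (alpha - n%:R).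
    rewrite ler_pdivrMr ?powR_gt0// -powR_add//.
    rewrite (_ : alpha - n%:R + (n%:R - alpha + eta) = eta); last by ring.
    by rewrite ge0_ler_powR ?nnegrE ?enorm_ge0 ?(ltW e0) ?(ltW t0)//; lra.
  have h3 : C2 * (enorm (z - x) `^ eta / t `^ (n%:R - alpha + eta)) <= C2 * t `^ (alpha - n%:R).
    by rewrite ler_pM2l.
  have := ler_normD (K z - K x) (K x); rewrite subrK; lra.
have I1 : (\int[mu]_(x in B) `|K x|%:E <= (C1 * t `^ alpha)%:E)%E.
  apply: le_trans (_ : ((C1 * (3/4 * t) `^ alpha)%:E <= _)%E); last first.
    rewrite lee_fin ler_pM2l// ge0_ler_powR ?nnegrE ?(ltW a0) ?(ltW t0)//; lra.
  have s0 : 0 < 3/4 * t by lra.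
  apply: le_trans (hS _ s0); apply: ge0_subset_integral => //.
  - have -> : [set x | 3/4 * t < enorm x <= 2 * (3/4 * t)] =
        (@enorm R n) @^-1` `]3/4 * t, 2 * (3/4 * t)]%classic.
      by apply/seteqP; split => x /=; rewrite in_itv.
    rewrite -[X in measurable X]setTI; apply: measurable_enorm => //.
  - apply/measurable_EFinP; apply: measurableT_comp => //; exact: measurable_funS mK.
  - move=> x Bx /=.
    have h1 := ler_normD.
    have := ler_enormD x (z - x); rewrite addrC subrK enorm_distC => h2.
    have := ler_enormD z (x - z); rewrite addrC subrK => h3.
    have {}Bx : enorm (x - z) < t / 4 by [].
    by rewrite -/t in h2 h3; apply/andP; split; lra.
have T0 : 0 < t `^ (alpha - n%:R) by rewrite powR_gt0.
have [k0|k0] := leP (`|K z| - C2 * t `^ (alpha - n%:R)) 0.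
  have : 0 <= C1 / v * t `^ (alpha - n%:R) by rewrite mulr_ge0 ?divr_ge0// ltW.
  by move: k0; rewrite subr_le0 => k0 h; rewrite mulrDl; apply: le_trans k0 _; rewrite lerDr.
have I2 : (((`|K z| - C2 * t `^ (alpha - n%:R)) * vol B)%:E <= \int[mu]_(x in B) `|K x|%:E)%E.
  rewrite EFinM -[(vol B)%:E](leb_eball z t40) -integral_cst//.
  apply: ge0_le_integral => //.
  - by move=> x _; rewrite lee_fin ltW.
  - apply/measurable_EFinP; apply: measurableT_comp => //; exact: measurable_funS mK.
  - by move=> x Bx; rewrite lee_fin lerBlDr near.
have := le_trans I2 I1; rewrite lee_fin => I3.
have V1 : v * t ^+ n <= vol B.
  by apply: le_trans (vol_eball_ge z t40); rewrite /v [(t / 4) ^+ n]exprMn -mulrA [X in _ * X]mulrC.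
have I4 : (`|K z| - C2 * t `^ (alpha - n%:R)) * (v * t ^+ n) <= C1 * t `^ alpha.
  by apply: le_trans I3; rewrite ler_pM2l.
rewrite mulrDl -lerBlDr -(@ler_pM2r _ (v * t ^+ n)) ?mulr_gt0 ?exprn_gt0//.
apply: le_trans I4 _; rewrite le_eqVlt; apply/orP; left; apply/eqP.
have -> : t `^ alpha = t `^ (alpha - n%:R) * t ^+ n.
  by rewrite -powR_mulrn ?(ltW t0)// -powR_add// subrK.
move: (t `^ _) (t ^+ n) (gt_eqF v0) => a1 a2 v1; field.
by rewrite v1.
Qed.

End kernel.

(** * Kernel and symbol far from a ball *)

Lemma subn_add2 (k m : nat) : (k.+2 <= m -> m - k = 2 + (m - k.+2))%N.
Proof. lia. Qed.

Lemma subn2_add (k m : nat) : (k.+2 <= m -> m - k.+2 + k = m - 2)%N.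
Proof. lia. Qed.

Section pointwise.
Context {R : realType} {n : nat}.
Implicit Types (c x y z u : 'rV[R]_n) (rho : R).

(** Second order Taylor expansion of (s + t)^m in s. The remainders satisfy
    D_(m+1) = (s + t) D_m + m s^2 t^(m-1). The quotient ta^m / ta^2 is
    ta^(m-2), also for m = 1, where that exponent is negative. *)
Lemma binomial_remainder_le (m : nat) : (0 < m)%N ->
  exists2 C : R, 0 < C & forall s t sg ta : R, `|s| <= sg -> `|t| <= ta ->
    sg <= ta -> 0 < ta ->
  `|(s + t) ^+ m - t ^+ m - m%:R * s * t ^+ m.-1| <= C * (sg ^+ 2 * (ta ^+ m / ta ^+ 2)).
Proof.
elim: m => // -[|m] IH _.
  exists 1 => // s t sg ta _ _ _ ta0; rewrite (_ : _ - _ - _ = 0); last by rewrite /=; ring.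
  by rewrite normr0 mul1r mulr_ge0 ?sqr_ge0// expr1 divr_ge0 ?sqr_ge0// ltW.
have [C C0 h] := IH isT.
exists (2 * C + m.+1%:R); first by rewrite addr_gt0// mulr_gt0.
move=> s t sg ta hs ht st ta0.
have {}h := h _ _ _ _ hs ht st ta0.
have sg0 : 0 <= sg by apply: le_trans hs.
set D := (s + t) ^+ m.+1 - t ^+ m.+1 - m.+1%:R * s * t ^+ m in h *.
have -> : (s + t) ^+ m.+2 - t ^+ m.+2 - m.+2%:R * s * t ^+ m.+1 =
   (s + t) * D + m.+1%:R * s ^+ 2 * t ^+ m.
  rewrite /D -[in m.+2%:R]addn1 natrD !exprS; move: ((s + t) ^+ m) (t ^+ m) (m.+1%:R) => a1 a2 a3.
  ring.
have st2 : `|s + t| <= 2 * ta.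
  by apply: le_trans (ler_normD _ _) _; rewrite mulr_natl mulr2n lerD// (le_trans hs).
have -> : ta ^+ m.+2 / ta ^+ 2 = ta ^+ m.
  by rewrite -addn2 exprD mulfK// gt_eqF// exprn_gt0.
have e : ta ^+ m.+1 / ta ^+ 2 * ta = ta ^+ m.
  rewrite exprSr; field; by rewrite gt_eqF.
apply: le_trans (ler_normD _ _) _; rewrite [leRHS]mulrDl; apply: lerD.
  rewrite normrM; apply: le_trans (ler_pM _ _ st2 h) _ => //.
  by rewrite -e le_eqVlt; apply/orP; left; apply/eqP; ring.
rewrite !normrM !normrX normr_nat -mulrA ler_pM2l// ler_pM ?exprn_ge0//.
  by rewrite expr2 ler_pM.
by rewrite lerXn2r ?nnegrE// ltW.
Qed.

Section distances.
Variables (c : 'rV[R]_n) (rho : R) (rho0 : 0 < rho).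
Variables (x y : 'rV[R]_n).
Hypotheses (Bx : eball c rho x) (By : ~ eball c (2 * rho) y).

Lemma far_center : 2 * rho <= enorm (c - y).
Proof. by move/negP: By; rewrite -leNgt enorm_distC. Qed.

Lemma far_lower : enorm (c - y) / 2 <= enorm (x - y).
Proof.
have := ler_enorm_dist x c y; have := far_center.
have : enorm (c - x) < rho by rewrite enorm_distC.
lra.
Qed.

Lemma far_upper : enorm (x - y) <= 2 * enorm (c - y).
Proof.
have := ler_enorm_dist c x y; have := far_center.
have : enorm (x - c) < rho by [].
have := enorm_ge0 (c - y); lra.
Qed.

End distances.

Lemma enorm_eball2 c rho x u : eball c rho x -> eball c rho u -> enorm (x - u) <= 2 * rho.
Proof.
move=> Bx Bu; have := ler_enorm_dist c x u.
have : enorm (x - c) < rho by [].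
have : enorm (c - u) < rho by rewrite enorm_distC.
lra.
Qed.

Section kernel.
Variables (alpha eta CK CH : R) (K : 'rV[R]_n -> R).
Hypotheses (a0 : 0 < alpha) (an : alpha < n%:R) (e0 : 0 < eta).
Hypotheses (CK0 : 0 < CK) (CH0 : 0 < CH).
Hypothesis HK : forall z, z != 0 -> `|K z| <= CK * enorm z `^ (alpha - n%:R).
Hypothesis HH : forall x x' y, enorm (x - y) >= 2 * enorm (x - x') ->
    `|K (x - y) - K (x' - y)| <= CH * (enorm (x - x') `^ eta
              / enorm (x - y) `^ (n%:R - alpha + eta)).

(** Off 2B the distances to x and to the centre are comparable up to a factor
    2, hence the power of 2. *)
Definition far_size := CK * 2 `^ (n%:R - alpha).

Lemma kernel_far_size c rho x y : 0 < rho -> eball c rho x -> ~ eball c (2 * rho) y ->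
  `|K (x - y)| <= far_size * enorm (c - y) `^ (alpha - n%:R).
Proof.
move=> r0 Bx By.
have d0 : 0 < enorm (c - y) / 2 by have := far_center By; lra.
have := far_lower Bx By => h.
have xy : x - y != 0.
  by apply/eqP => xy0; move: h; rewrite xy0 enorm0 leNgt d0.
apply: le_trans (HK xy) _; rewrite /far_size -mulrA ler_pM2l//.
apply: le_trans (ler_npowR _ d0 h) _; first by rewrite subr_le0 ltW.
rewrite powRM ?enorm_ge0// powR_inv// opprB mulrC.
exact: lexx.
Qed.

(** The first summand comes from the points where the smoothness condition
    applies to x and u; the second one from those within distance 5 rho of the
    centre, where size alone suffices. *)
Definition far_smooth := CH * 2 `^ eta * 2 `^ (n%:R - alpha + eta) + 2 * far_size * 5 `^ eta.

Lemma far_size_gt0 : 0 < far_size.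
Proof. by rewrite mulr_gt0// powR_gt0. Qed.

Lemma far_smooth_gt0 : 0 < far_smooth.
Proof. by rewrite addr_gt0// !mulr_gt0 ?powR_gt0// far_size_gt0. Qed.

(** The smoothness condition requires |x - y| >= 2 |x - u|, which being off 2B
    does not ensure. If |x - y| >= 4 rho it applies. Otherwise |c - y| <= 5
    rho, and the size bound is as good as the claim. *)
Lemma kernel_far_smooth c rho x u y : 0 < rho ->
  eball c rho x -> eball c rho u -> ~ eball c (2 * rho) y ->
  `|K (x - y) - K (u - y)| <=
    far_smooth * (rho `^ eta * enorm (c - y) `^ (alpha - n%:R - eta)).
Proof.
move=> r0 Bx Bu By; set d := enorm (c - y).
have d2 : 2 * rho <= d by exact: far_center.
have d0 : 0 < d by lra.
have h1 : d / 2 <= enorm (x - y) by exact: far_lower Bx By.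
have xu := enorm_eball2 Bx Bu.
have [h|h] := leP (4 * rho) (enorm (x - y)).
  have h2 : 2 * enorm (x - u) <= enorm (x - y) by lra.
  apply: le_trans (HH h2) _.
  apply: (@le_trans _ _ (CH * ((2 * rho) `^ eta / (d / 2) `^ (n%:R - alpha + eta)))).
    rewrite ler_pM2l// ler_pM ?powR_ge0 ?invr_ge0 ?powR_ge0//.
      by rewrite ge0_ler_powR ?nnegrE ?enorm_ge0 ?(ltW e0)//; lra.
    rewrite -!powRN; apply: ler_npowR => //; last by rewrite divr_gt0.
    by rewrite oppr_le0 addr_ge0 ?subr_ge0// ltW.
  rewrite /far_smooth [leRHS]mulrDl -[leLHS]addr0 lerD//; last first.
    by rewrite !mulr_ge0 ?powR_ge0// ltW// far_size_gt0.
  rewrite -powRN powRM ?(ltW r0)// powRM ?(ltW d0)// powR_inv// opprK.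
  rewrite (_ : - (n%:R - alpha + eta) = alpha - n%:R - eta); last by ring.
  move: (2 `^ eta) (rho `^ eta) (2 `^ (n%:R - alpha + eta)) (d `^ (alpha - n%:R - eta)) => a1 a2 a3 a4.
  by rewrite le_eqVlt; apply/orP; left; apply/eqP; ring.
have dr : d <= 5 * rho.
  have := ler_enorm_dist x c y; have : enorm (c - x) < rho by rewrite enorm_distC.
  by rewrite -/d; lra.
have d50 : d `^ eta <= 5 `^ eta * rho `^ eta.
  by rewrite -powRM ?(ltW r0)// ge0_ler_powR ?nnegrE ?(ltW e0) ?(ltW d0)//; lra.
have E : d `^ (alpha - n%:R) = d `^ (alpha - n%:R - eta) * d `^ eta.
  by rewrite -powR_add// subrK.
apply: le_trans (ler_normB _ _) _.
apply: le_trans (lerD (kernel_far_size r0 Bx By) (kernel_far_size r0 Bu By)) _.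
rewrite -/d E /far_smooth [leRHS]mulrDl -[leLHS]add0r lerD//.
  by rewrite !mulr_ge0 ?powR_ge0// ltW.
have P0 : 0 <= d `^ (alpha - n%:R - eta) by exact: powR_ge0.
have S0 := far_size_gt0.
move: d50 P0; move: (d `^ eta) (5 `^ eta) (rho `^ eta) (d `^ _) => a1 a2 a3 a4 ha a40.
have := ler_wpM2l (mulr_ge0 (ltW S0) a40) ha.
by move: far_size => S; nra.
Qed.

Section symbol.
Variables (delta Cb : R) (b : 'rV[R]_n -> R).
Hypotheses (d0 : 0 < delta) (Cb0 : 0 < Cb).
Hypothesis Hb : forall x y, `|b x - b y| <= Cb * enorm (x - y) `^ delta.
Hypothesis mb : measurable_fun setT b.

Definition lip_far := Cb * 2 `^ delta.

Lemma lip_far_gt0 : 0 < lip_far.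
Proof. by rewrite mulr_gt0// powR_gt0. Qed.

Lemma symbol_le x y t : 0 <= t -> enorm (x - y) <= 2 * t -> `|b x - b y| <= lip_far * t `^ delta.
Proof.
move=> t0 xy; apply: le_trans (Hb _ _) _; rewrite /lip_far -mulrA -powRM// ler_pM2l//.
by rewrite ge0_ler_powR ?nnegrE ?enorm_ge0 ?(ltW d0) ?mulr_ge0.
Qed.

Lemma symbol_integrable c rho : 0 < rho -> (leb R n).-integrable (eball c rho) (EFin \o b).
Proof.
move=> r0; apply: (eball_bounded_integrable r0 (E := `|b c| + lip_far * rho `^ delta)) => //.
move=> x Bx; rewrite -lerBlDl; apply: le_trans (lerB_dist _ _) _.
apply: symbol_le; first exact: ltW.
have : enorm (x - c) < rho by []. lra.
Qed.

Lemma symbol_near_mean c rho x : 0 < rho -> eball c rho x ->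
  `|b x - mean (eball c rho) b| <= lip_far * rho `^ delta.
Proof.
move=> r0 Bx; rewrite distrC; apply: (mean_near r0); first exact: symbol_integrable.
move=> z Bz; apply: symbol_le; first exact: ltW.
exact: enorm_eball2 Bz Bx.
Qed.

Lemma symbol_far_mean c rho y : 0 < rho -> ~ eball c (2 * rho) y ->
  `|mean (eball c rho) b - b y| <= lip_far * enorm (c - y) `^ delta.
Proof.
move=> r0 By; apply: (mean_near r0); first exact: symbol_integrable.
move=> z Bz; apply: symbol_le; first exact: enorm_ge0.
exact: far_upper Bz By.
Qed.

Lemma symbol_far c rho x y : 0 < rho -> eball c rho x -> ~ eball c (2 * rho) y ->
  `|b x - b y| <= lip_far * enorm (c - y) `^ delta.
Proof.
move=> r0 Bx By; apply: symbol_le; first exact: enorm_ge0.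
exact: far_upper Bx By.
Qed.

Variable m : nat.
Hypothesis m0 : (0 < m)%N.

(** The common bound for everything that is harmless. In both summands the
    power of |c - y| is strictly below the critical exponent -p, and both
    integrals against |f| scale like rho^delta. *)
Definition far_weight c rho y : R :=
  let p := n%:R - (m%:R - 1) * delta - alpha in
  rho `^ eta * enorm (c - y) `^ (- p - (eta - delta)) +
  rho `^ (2 * delta) * enorm (c - y) `^ (- p - delta).

Local Notation bB c rho := (mean (eball c rho) b).

Lemma far_weight_ge0 c rho y : 0 <= far_weight c rho y.
Proof. by rewrite addr_ge0// mulr_ge0// powR_ge0. Qed.

Let far_gt0 c rho y : 0 < rho -> ~ eball c (2 * rho) y -> 0 < enorm (c - y).
Proof. by move=> r0 /far_center; lra. Qed.

Lemma lip_far_exp (t : R) : 0 < t -> (lip_far * t `^ delta) ^+ m = lip_far ^+ m * t `^ (m%:R * delta).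
Proof.
by move=> t0; rewrite exprMn -[(t `^ delta) ^+ m]powR_mulrn ?powR_ge0// -powRrM (mulrC delta).
Qed.

(** The size of the terms of order at least 2 in b(x) - b_B. *)
Lemma lip_far_exp_ratio rho (t : R) : 0 < rho -> 0 < t ->
  (lip_far * rho `^ delta) ^+ 2 * ((lip_far * t `^ delta) ^+ m / (lip_far * t `^ delta) ^+ 2)
  = lip_far ^+ m * (rho `^ (2 * delta) * t `^ ((m%:R - 2) * delta)).
Proof.
move=> r0 t0; rewrite lip_far_exp// !exprMn.
have -> : t `^ (m%:R * delta) = t `^ ((m%:R - 2) * delta) * (t `^ delta) ^+ 2.
  rewrite -[(t `^ delta) ^+ 2]powR_mulrn ?powR_ge0// -powRrM -powR_add//.
  by congr (_ `^ _); ring.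
have -> : rho `^ (2 * delta) = (rho `^ delta) ^+ 2.
  by rewrite -powR_mulrn ?powR_ge0// -powRrM mulrC.
have := lip_far_gt0; have := powR_gt0 delta t0.
move: (t `^ _) (t `^ _) (rho `^ _) lip_far => a1 a2 a3 a4 h1 h2.
by field; rewrite !gt_eqF.
Qed.

(** Split off the difference K(x - y) - K(u - y), which costs the term with
    eta, and expand the power of b(x) - b(y) around b_B to first order, which
    costs the term with 2 delta. *)
Lemma far_commutator_le : exists2 C : R, 0 < C & forall c rho x u y, 0 < rho ->
  eball c rho x -> eball c rho u -> ~ eball c (2 * rho) y ->
  `|(b x - b y) ^+ m * K (x - y) - (bB c rho - b y) ^+ m * K (u - y)
    - (b x - bB c rho) * (m%:R * (bB c rho - b y) ^+ m.-1 * K (u - y))|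
  <= C * far_weight c rho y.
Proof.
have [C C0 hC] := binomial_remainder_le m0.
have L0 := lip_far_gt0; have S0 := far_size_gt0.
have T0 := far_smooth_gt0.
exists (lip_far ^+ m * far_smooth + C * lip_far ^+ m * far_size).
  by rewrite addr_gt0// !mulr_gt0// exprn_gt0.
move=> c rho x u y r0 Bx Bu By; set d := enorm (c - y).
have dp : 0 < d by exact: far_gt0 By.
have rd : rho <= d by have := far_center By; rewrite -/d; lra.
pose sg := lip_far * rho `^ delta; pose ta := lip_far * d `^ delta.
have ta0 : 0 < ta by rewrite mulr_gt0// powR_gt0.
have sgta : sg <= ta.
  by rewrite ler_pM2l// ge0_ler_powR ?nnegrE// ltW.
have hs : `|b x - bB c rho| <= sg by exact: symbol_near_mean.
have ht : `|bB c rho - b y| <= ta by exact: symbol_far_mean.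
have hst : `|b x - b y| <= ta by exact: symbol_far Bx By.
have h1 := hC _ _ _ _ hs ht sgta ta0.
rewrite subrKA in h1.
rewrite (_ : _ - _ - _ = (b x - b y) ^+ m * (K (x - y) - K (u - y)) +
   ((b x - b y) ^+ m - (bB c rho - b y) ^+ m
    - m%:R * (b x - bB c rho) * (bB c rho - b y) ^+ m.-1) * K (u - y)); last by ring.
apply: le_trans (ler_normD _ _) _; rewrite !normrM mulrDl.
have hK1 := kernel_far_smooth r0 Bx Bu By; have hK2 := kernel_far_size r0 Bu By.
have hm : `|(b x - b y) ^+ m| <= ta ^+ m by rewrite normrX lerXn2r ?nnegrE// ltW.
apply: lerD.
  apply: le_trans (ler_pM _ _ hm hK1) _ => //.
  rewrite /ta lip_far_exp//; move: far_smooth T0 => T T0.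
  rewrite -/d -!mulrA ler_pM2l ?exprn_gt0//.
  rewrite mulrCA ler_pM2l// mulrCA /far_weight -/d -powR_add//.
  rewrite (_ : m%:R * delta + _ = - (n%:R - (m%:R - 1) * delta - alpha) - (eta - delta)); last by ring.
  by rewrite lerDl mulr_ge0// powR_ge0.
apply: le_trans (ler_pM _ _ h1 hK2) _ => //.
rewrite /sg /ta lip_far_exp_ratio//; move: far_size S0 => S S0.
rewrite -/d -!mulrA ler_pM2l// ler_pM2l ?exprn_gt0//.
rewrite (mulrCA _ S) (mulrCA _ S) ler_pM2l// /far_weight -/d -powR_add//.
rewrite (_ : (m%:R - 2) * delta + _ = - (n%:R - (m%:R - 1) * delta - alpha) - delta); last by ring.
by rewrite lerDr mulr_ge0// powR_ge0.
Qed.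

(** The summand of index k carries the power m - k >= 2 of b(x) - b_B, and
    |b(x) - b_B| is bounded by rho^delta, hence by |c - y|^delta: only two
    factors rho^delta are kept. *)
Lemma far_terms_le : exists2 C : R, 0 < C & forall k c rho x u y, (k.+2 <= m)%N -> 0 < rho ->
  eball c rho x -> eball c rho u -> ~ eball c (2 * rho) y ->
  `|b x - bB c rho| ^+ (m - k) * `|(b y - bB c rho) ^+ k * K (u - y)|
  <= C * far_weight c rho y.
Proof.
have L0 := lip_far_gt0; have S0 := far_size_gt0.
exists (lip_far ^+ m * far_size).
  by rewrite !mulr_gt0// exprn_gt0.
move=> k c rho x u y km r0 Bx Bu By; set d := enorm (c - y).
have dp : 0 < d by exact: far_gt0 By.
have rd : rho <= d by have := far_center By; rewrite -/d; lra.
pose sg := lip_far * rho `^ delta; pose ta := lip_far * d `^ delta.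
have ta0 : 0 < ta by rewrite mulr_gt0// powR_gt0.
have sg0 : 0 < sg by rewrite mulr_gt0// powR_gt0.
have sgta : sg <= ta.
  by rewrite ler_pM2l// ge0_ler_powR ?nnegrE// ltW.
have hs : `|b x - bB c rho| <= sg by exact: symbol_near_mean.
have ht : `|b y - bB c rho| <= ta by rewrite distrC; exact: symbol_far_mean.
have hK2 := kernel_far_size r0 Bu By.
have h : `|b x - bB c rho| ^+ (m - k) * `|b y - bB c rho| ^+ k <= sg ^+ 2 * (ta ^+ m / ta ^+ 2).
  apply: (@le_trans _ _ (sg ^+ (m - k) * ta ^+ k)).
    by apply: ler_pM; rewrite ?exprn_ge0// lerXn2r ?nnegrE// ltW.
  rewrite (subn_add2 km).
  rewrite exprD -mulrA ler_pM2l ?exprn_gt0//.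
  have -> : ta ^+ m / ta ^+ 2 = ta ^+ (m - k.+2) * ta ^+ k.
    rewrite -exprD.
    rewrite (subn2_add km).
    by rewrite -[in LHS](@subnK 2 m) ?(leq_trans _ km)// exprD mulfK// gt_eqF// exprn_gt0.
  by rewrite ler_pM2r ?exprn_gt0// lerXn2r ?nnegrE// ltW.
rewrite normrM normrX mulrA.
apply: le_trans (ler_pM _ _ h hK2) _ => //.
rewrite /sg /ta lip_far_exp_ratio//; move: far_size S0 => S S0.
rewrite -/d -!mulrA ler_pM2l ?exprn_gt0//.
rewrite (mulrCA _ S) (mulrCA _ S) ler_pM2l// /far_weight -/d -powR_add//.
rewrite (_ : (m%:R - 2) * delta + _ = - (n%:R - (m%:R - 1) * delta - alpha) - delta); last by ring.
by rewrite lerDr mulr_ge0// powR_ge0.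
Qed.

End symbol.
End kernel.
End pointwise.

(** * Integrals with value 0 when they diverge *)

Section Rintegral.
Context {d : measure_display} {T : measurableType d} {R : realType}.
Variable mu : {measure set T -> \bar R}.
Implicit Types (D : set T) (f g h : T -> R).

Lemma Rintegral_not_integrable D f : measurable D -> measurable_fun D f ->
  ~ mu.-integrable D (EFin \o f) -> \int[mu]_(x in D) f x = 0.
Proof.
move=> mD mf nf; rewrite /Rintegral.
have : (\int[mu]_(x in D) (f x)%:E)%E \isn't a fin_num.
  rewrite -integral_fin_num_abs//; apply/negP => h; apply: nf.
  by apply/integrableP; split => //; exact/measurable_EFinP.
by case: (\int[mu]_(x in D) _)%E.
Qed.

Lemma abs_Rintegral_le D f : measurable D -> measurable_fun D f ->
  (`| \int[mu]_(x in D) f x |%:E <= \int[mu]_(x in D) `|f x|%:E)%E.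
Proof.
move=> mD mf; have [fi|fni] := pselect (mu.-integrable D (EFin \o f)).
  rewrite EFin_normr_Rintegral//; apply: le_trans (le_abse_integral _ _ _) _ => //.
  exact/measurable_EFinP.
by rewrite Rintegral_not_integrable// normr0 integral_ge0.
Qed.

Lemma integrable_fin_abs D f : measurable_fun D f ->
  (\int[mu]_(x in D) `|f x|%:E < +oo)%E -> mu.-integrable D (EFin \o f).
Proof. by move=> mf h; apply/integrableP; split => //; exact/measurable_EFinP. Qed.

(** If the right-hand side is finite, then h is integrable on the whole space
    exactly when h0 is integrable on D. When they are not, both integrals on
    the left are 0. *)
Lemma Rintegral_perturb D h h0 : measurable D ->
  measurable_fun setT h -> measurable_fun setT h0 ->
  (`| \int[mu]_x h x - \int[mu]_(x in D) h0 x |%:E <=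
   \int[mu]_(x in ~` D) `|h x|%:E + \int[mu]_(x in D) `|h x - h0 x|%:E)%E.
Proof.
move=> mD mh mh0.
have mDC : measurable (~` D) by exact: measurableC.
have mS E f : measurable_fun setT f -> measurable_fun E f.
  by move=> mf; exact: measurable_funS mf.
have mB : measurable_fun setT (fun x => h x - h0 x) by exact: measurable_funB.
have e10 : (0 <= \int[mu]_(x in ~` D) `|h x|%:E)%E by exact: integral_ge0.
have e20 : (0 <= \int[mu]_(x in D) `|h x - h0 x|%:E)%E by exact: integral_ge0.
have [e1y|] := ltP (\int[mu]_(x in ~` D) `|h x|%:E)%E +oo%E; last first.
  by rewrite leye_eq => /eqP ->; rewrite addye ?leey// gt_eqF// (lt_le_trans _ e20).
have [e2y|] := ltP (\int[mu]_(x in D) `|h x - h0 x|%:E)%E +oo%E; last first.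
  by rewrite leye_eq => /eqP ->; rewrite addey ?leey// gt_eqF// (lt_le_trans _ e10).
have i1 := integrable_fin_abs (mS _ _ mh) e1y.
have i2 := integrable_fin_abs (mS _ _ mB) e2y.
have UT : ~` D `|` D = setT by exact: setvU.
have [i0|n0] := pselect (mu.-integrable D (EFin \o h0)).
  have iD : mu.-integrable D (EFin \o h).
    have := integrableD mD i2 i0; apply: eq_integrable => // x _ /=.
    by rewrite -EFinD subrK.
  have iT : mu.-integrable (~` D `|` D) (EFin \o h).
    apply: integrable_fin_abs; first exact: mS.
    rewrite ge0_integral_setU//.
    - by apply: lte_add_pinfty => //; move/integrableP : iD => [].
    - by apply/measurable_EFinP; apply: measurableT_comp => //; exact: mS.
    - by apply/disj_setPS; rewrite setICl.
  rewrite -{1}UT Rintegral_setU//; last by apply/disj_setPS; rewrite setICl.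
  rewrite -addrA -RintegralB//.
  apply: le_trans (_ : (`|\int[mu]_(x in ~` D) h x|%:E + `|\int[mu]_(x in D) (h x - h0 x)|%:E <= _)%E).
    by rewrite -EFinD lee_fin ler_normD.
  by apply: leeD; apply: abs_Rintegral_le => //; exact: mS.
rewrite (Rintegral_not_integrable mD (mS _ _ mh0) n0) subr0 Rintegral_not_integrable//.
  by rewrite normr0 adde_ge0.
move=> iT; apply: n0.
have iD : mu.-integrable D (EFin \o h) by apply: integrableS iT.
have := integrableB mD iD i2; apply: eq_integrable => // x _ /=.
by rewrite -EFinB opprB addrCA subrr addr0.
Qed.

(** Monotone convergence; the factor k is allowed to vanish while the integral
    is infinite. *)
Lemma le_integral_exhaustion (F : nat -> set T) (g : T -> \bar R) (k : R) (A : \bar R) :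
  {homo F : p q / (p <= q)%N >-> p `<=` q} -> (forall N, measurable (F N)) ->
  measurable_fun setT g -> (forall x, 0 <= g x)%E -> 0 <= k -> (0 <= A)%E ->
  (forall N, k%:E * \int[mu]_(x in F N) g x <= A)%E ->
  (k%:E * \int[mu]_(x in \bigcup_N F N) g x <= A)%E.
Proof.
move=> ndF mF mg g0 k0 A0 hA.
move: k0; rewrite le_eqVlt => /predU1P[<-|k0]; first by rewrite mul0e.
rewrite -lee_pdivlMl//.
have cv : (\int[mu]_(x in F i) g x)%E @[i --> \oo] --> (\int[mu]_(x in \bigcup_i F i) g x)%E.
  apply: ge0_nondecreasing_set_cvg_integral => //.
    by move=> p q pq; apply/subsetPset; exact: ndF.
  by move=> i; exact: measurable_funS mg.
rewrite -(cvg_lim _ cv)//; apply: lime_le; first by apply/cvg_ex; eexists; exact: cv.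
by near=> N; rewrite lee_pdivlMl.
Unshelve. all: by end_near. Qed.

End Rintegral.

Lemma measurable_Rintegral {d1 d2} {T1 : measurableType d1} {T2 : measurableType d2}
  {R : realType} (m2 : {sigma_finite_measure set T2 -> \bar R}) (h : T1 * T2 -> R) :
  measurable_fun setT h -> measurable_fun setT (fun x => \int[m2]_y h (x, y)).
Proof.
move=> mh.
have mE : measurable_fun setT (EFin \o h) by exact/measurable_EFinP.
apply: (@measurableT_comp _ _ _ _ _ _ (@fine R)); first exact: fine_measurable.
have -> : (fun x => \int[m2]_y (h (x, y))%:E)%E =
   (fun x => \int[m2]_y ((EFin \o h)^\+ (x, y)) - \int[m2]_y ((EFin \o h)^\- (x, y)))%E.
  apply/funext => x; rewrite [LHS]integralE.
  congr (_ - _)%E; apply: eq_integral => y _.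
    by rewrite !funeposE.
  by rewrite !funenegE.
apply: emeasurable_funB.
  by apply: measurable_fun_fubini_tonelli_F => //; exact: measurable_funepos.
by apply: measurable_fun_fubini_tonelli_F => //; exact: measurable_funeneg.
Qed.

(** * Weighted estimates of the harmless parts *)

Section weighted.
Context {R : realType} {n : nat}.
Local Notation mu := (leb R n).
Implicit Types (c x y z u : 'rV[R]_n) (rho : R) (f : 'rV[R]_n -> R).
Variables (r p : R) (w : 'rV[R]_n -> R) (CW : R).
Hypotheses (p0 : 0 <= p) (n0 : 0 < n%:R :> R).
Hypothesis rp : 1 - r^-1 = p / n%:R.
Hypothesis w0 : forall x, 0 <= w x.
Hypothesis CW0 : 0 < CW.
Hypothesis HM : forall c rho, 0 < rho ->
  0 < wsup w (eball c rho) /\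
  ('N[mu]_+oo[EFin \o (w \* \1_(eball c rho))%R] = (wsup w (eball c rho))%:E)%E.
Hypothesis HW : forall c rho, 0 < rho -> forall f, in_Lw r w f ->
  ((wsup w (eball c rho))%:E * \int[mu]_(x in eball c rho) `|f x|%:E <=
   (CW * vol (eball c rho) `^ (1 - r^-1))%:E * wnorm r w f)%E.

Definition nrm f : R := fine (wnorm r w f).

Lemma nrm_ge0 f : 0 <= nrm f.
Proof. by rewrite fine_ge0// Lnorm_ge0. Qed.

Lemma nrmE f : in_Lw r w f -> wnorm r w f = (nrm f)%:E.
Proof. by move=> [_ h]; rewrite /nrm fineK// ge0_fin_numE// Lnorm_ge0. Qed.

(** The size of f on every ball of radius at least rho around c, up to the
    scaling factor, when f has norm nrm f. *)
Definition nloc c rho f : R := nrm f / wsup w (eball c rho).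

Lemma nloc_ge0 c rho f : 0 < rho -> 0 <= nloc c rho f.
Proof. by move=> rho0; rewrite divr_ge0 ?nrm_ge0// ltW//; case: (HM c rho0). Qed.

(** The weight enters only through its supremum on the small ball, which is at
    most its supremum on the large one. *)
Lemma eball_L1_le : exists2 C : R, 0 < C & forall f c rho t, in_Lw r w f ->
  0 < rho -> rho <= t ->
  (\int[mu]_(x in eball c t) `|f x|%:E <= (C * nloc c rho f * t `^ p)%:E)%E.
Proof.
(* 2^p is the volume constant 2^n raised to the power 1 - 1/r = p / n *)
exists (CW * 2 `^ p); first by rewrite mulr_gt0 ?powR_gt0.
move=> f c rho t fw rho0 rt; have t0 : 0 < t by apply: lt_le_trans rt.
have [M0 ME] := HM c rho0; have [Mt0 MtE] := HM c t0.
have MM : wsup w (eball c rho) <= wsup w (eball c t).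
  by apply: wsup_le => //; [rewrite MtE ltry|exact: eballS].
have := HW c t0 fw; rewrite nrmE// -EFinM -lee_pdivlMl// => /le_trans; apply.
rewrite -EFinM lee_fin.
have N0 := nrm_ge0 f.
have V : vol (eball c t) `^ (1 - r^-1) <= 2 `^ p * t `^ p.
  have hn : (2 ^+ n * t ^+ n) `^ (p / n%:R) = 2 `^ p * t `^ p.
    rewrite -powRM ?(ltW t0)// -exprMn -powR_mulrn ?mulr_ge0 ?(ltW t0)// -powRrM.
    by rewrite mulrCA mulfV ?mulr1// gt_eqF.
  rewrite -hn rp ge0_ler_powR ?divr_ge0 ?nnegrE ?(ltW n0)//.
  - exact/ltW/vol_eball_gt0.
  - by rewrite mulr_ge0// exprn_ge0// ltW.
  - exact: vol_eball_le.
rewrite /nloc; apply: (@le_trans _ _ ((wsup w (eball c rho))^-1 * (CW * (2 `^ p * t `^ p) * nrm f))).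
  apply: ler_pM; rewrite ?invr_ge0 ?(ltW Mt0) ?mulr_ge0 ?powR_ge0 ?(ltW CW0)//.
    by rewrite lef_pV2.
  by rewrite ler_wpM2r// ler_pM2l.
move: (2 `^ p) (t `^ p) (nrm f) (_^-1) => a1 a2 a3 a4.
by rewrite le_eqVlt; apply/orP; left; apply/eqP; ring.
Qed.

Lemma in_Lw_locally_L1 f : in_Lw r w f -> locally_L1 (EFin \o f).
Proof.
move=> fw; have [C C0 hC] := eball_L1_le; have [mf _] := fw; split.
  exact/measurable_EFinP.
move=> D cD; have [rho rho0 Drho] := compact_sub_eball cD.
apply: (@le_lt_trans _ _ (\int[mu]_(x in eball 0 rho) `|f x|%:E)%E).
  apply: ge0_subset_integral => //; [exact: compact_measurable_rV|exact: measurable_eball|].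
  by apply/measurable_EFinP; apply: measurableT_comp => //; exact: measurable_funS mf.
by apply: le_lt_trans (hC _ _ _ _ fw rho0 (lexx _)) _; rewrite ltry.
Qed.

(** The hypothesis of tail_integral_le is eball_L1_le, with the critical
    exponent p. *)
Lemma tail_L1_le (th : R) : 0 < th -> exists2 C : R, 0 < C & forall f c rho,
  in_Lw r w f -> 0 < rho ->
  (\int[mu]_(y in ~` eball c (2 * rho)) (enorm (c - y) `^ (- p - th) * `|f y|)%:E
    <= (C * (rho `^ (- th) * nloc c rho f))%:E)%E.
Proof.
move=> th0; have [C1 C10 h1] := eball_L1_le.
have [C2 C20 h2] := tail_integral_le (n := n) p0 th0.
exists (C2 * C1); first by rewrite mulr_gt0.
move=> f c rho fw rho0; have [mf _] := fw.
have rho20 : 0 < 2 * rho by rewrite mulr_gt0.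
have N0 := nloc_ge0 c f rho0.
have A0 : 0 <= C1 * nloc c rho f by rewrite mulr_ge0// ltW.
have h t : 2 * rho <= t -> (\int[mu]_(x in eball c t) `|f x|%:E <= (C1 * nloc c rho f * t `^ p)%:E)%E.
  by move=> rt; apply: h1 => //; lra.
apply: le_trans (h2 _ _ _ _ mf rho20 A0 h) _; rewrite lee_fin.
have : (2 * rho) `^ (- th) <= rho `^ (- th).
  by apply: ler_npowR => //; [rewrite oppr_le0 ltW|lra].
move=> h3; have -> : C2 * C1 * (rho `^ (- th) * nloc c rho f) =
  C2 * (C1 * nloc c rho f * rho `^ (- th)) by ring.
by rewrite ler_pM2l// ler_wpM2l.
Qed.

Variable delta : R.
Hypothesis delta0 : 0 < delta.

Definition lip_factor c rho : R :=
  wsup w (eball c rho) * (vol (eball c rho) `^ (1 + delta / n%:R))^-1.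

Lemma lip_factor_gt0 c rho : 0 < rho -> 0 < lip_factor c rho.
Proof.
move=> rho0; rewrite /lip_factor mulr_gt0//; first by case: (HM c rho0).
by rewrite invr_gt0 powR_gt0 ?vol_eball_gt0.
Qed.

Lemma wlip_avgE c rho g : 0 < rho ->
  wlip_avg delta w (eball c rho) g =
  ((lip_factor c rho)%:E * \int[mu]_(x in eball c rho) `|g x|%:E)%E.
Proof.
by move=> rho0; rewrite /wlip_avg; have [_ ->] := HM c rho0; rewrite EFinM.
Qed.

(** The scaling that makes the two norms match: an integral over B of size
    rho^(n + delta) nloc is exactly what the norm allows. *)
Lemma lip_factor_le : exists2 C : R, 0 < C & forall f c rho, 0 < rho ->
  lip_factor c rho * (rho `^ (n%:R + delta) * nloc c rho f) <= C * nrm f.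
Proof.
pose v : R := (2 / n.+1%:R) ^+ n.
have v0 : 0 < v by rewrite exprn_gt0// divr_gt0.
exists (v `^ (1 + delta / n%:R))^-1; first by rewrite invr_gt0 powR_gt0.
move=> f c rho rho0; have [M0 _] := HM c rho0.
have V0 := vol_eball_gt0 c rho0.
have e0 : 0 < 1 + delta / n%:R by rewrite addr_gt0// divr_gt0.
have h : v `^ (1 + delta / n%:R) * rho `^ (n%:R + delta) <= vol (eball c rho) `^ (1 + delta / n%:R).
  have -> : rho `^ (n%:R + delta) = (rho ^+ n) `^ (1 + delta / n%:R).
    rewrite -powR_mulrn ?(ltW rho0)// -powRrM; congr (_ `^ _).
    by rewrite mulrDr mulr1 mulrCA mulfV ?mulr1// gt_eqF.
  rewrite -powRM ?(ltW v0) ?exprn_ge0 ?(ltW rho0)//.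
  rewrite ge0_ler_powR ?nnegrE ?mulr_ge0 ?exprn_ge0 ?(ltW e0) ?(ltW V0) ?(ltW v0) ?(ltW rho0)//.
  exact: vol_eball_ge.
have v1 : 0 < v `^ (1 + delta / n%:R) by rewrite powR_gt0.
have V1 : 0 < vol (eball c rho) `^ (1 + delta / n%:R) by rewrite powR_gt0.
rewrite /lip_factor /nloc.
have N0 := nrm_ge0 f.
move: (v `^ _) (vol _ `^ _) (rho `^ _) (wsup w _) (nrm f) v1 V1 h M0 N0 => a1 a2 a3 a4 a5 h1 h2 h3 h4 h5.
have -> : a4 * a2^-1 * (a3 * (a5 / a4)) = (a3 / a2) * a5 by field; rewrite !gt_eqF.
apply: ler_wpM2r => //; rewrite ler_pdivrMr// mulrC ler_pdivlMr// mulrC.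
exact: h3.
Qed.

Lemma vol_scale c rho : 0 < rho ->
  vol (eball c rho) * rho `^ delta <= 2 ^+ n * rho `^ (n%:R + delta).
Proof.
move=> rho0; rewrite powR_add// mulrA ler_pM2r ?powR_gt0//.
by rewrite powR_mulrn ?(ltW rho0)// vol_eball_le.
Qed.

Variables (m : nat) (alpha eta : R) (K b : 'rV[R]_n -> R).
Hypotheses (m0 : (0 < m)%N) (alpha0 : 0 < alpha) (deta : delta < eta).
Hypothesis hp : p = n%:R - (m%:R - 1) * delta - alpha.
Hypothesis mdn : m%:R * delta + alpha < n%:R.
Hypotheses (mK : measurable_fun setT K) (mb : measurable_fun setT b).
Variables (CK Cb : R).
Hypotheses (CK0 : 0 < CK) (Cb0 : 0 < Cb).
Hypothesis HK : forall z, z != 0 -> `|K z| <= CK * enorm z `^ (alpha - n%:R).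
Hypothesis Hb : forall x y, `|b x - b y| <= Cb * enorm (x - y) `^ delta.

Lemma measurable_far_weight c rho :
  measurable_fun setT (fun y => far_weight alpha eta delta m c rho y).
Proof. by apply: measurable_funD; apply: measurable_funM => //; exact: measurable_enormB_powR. Qed.

Definition far_error c rho f : \bar R :=
  (\int[mu]_(y in ~` eball c (2 * rho)) (far_weight alpha eta delta m c rho y * `|f y|)%:E)%E.

Let mB c rho : measurable (eball c rho) := measurable_eball c rho.
Let mBC c rho : measurable (~` eball c rho) := measurableC (measurable_eball c rho).
Let mS D (f : 'rV[R]_n -> R) : measurable_fun setT f -> measurable_fun D f.
Proof. by move=> mf; exact: measurable_funS mf. Qed.
Let mnS D (f : 'rV[R]_n -> R) : measurable_fun setT f -> measurable_fun D (fun x => `|f x|%:E).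
Proof. by move=> mf; apply/measurable_EFinP; apply: measurableT_comp => //; exact: mS. Qed.

(** Both summands of far_weight fall below the critical exponent, by eta -
    delta > 0 and by delta > 0. *)
Lemma far_error_le : exists2 C : R, 0 < C & forall f c rho, in_Lw r w f -> 0 < rho ->
  (far_error c rho f <= (C * (rho `^ delta * nloc c rho f))%:E)%E.
Proof.
have ed0 : 0 < eta - delta by rewrite subr_gt0.
have [C1 C10 h1] := tail_L1_le ed0.
have [C2 C20 h2] := tail_L1_le delta0.
exists (C1 + C2); first by rewrite addr_gt0.
move=> f c rho fw rho0; have [mf _] := fw.
have mfa : measurable_fun setT (fun y => `|f y|) by exact: measurableT_comp.
rewrite /far_error /far_weight -hp.
have mG (a e : R) : measurable_fun (~` eball c (2 * rho)) (fun y => (a * (enorm (c - y) `^ e * `|f y|))%:E).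
  apply/measurable_EFinP; apply: measurable_funM => //; apply: mS; apply: measurable_funM => //.
  exact: measurable_enormB_powR.
have mH (e : R) : measurable_fun (~` eball c (2 * rho)) (fun y => (enorm (c - y) `^ e * `|f y|)%:E).
  apply/measurable_EFinP; apply: mS; apply: measurable_funM => //.
  exact: measurable_enormB_powR.
under eq_integral do rewrite mulrDl -!mulrA EFinD.
rewrite ge0_integralD//; last 2 first.
- by move=> y _; rewrite lee_fin !mulr_ge0 ?powR_ge0.
- by move=> y _; rewrite lee_fin !mulr_ge0 ?powR_ge0.
under eq_integral do rewrite EFinM.
under [X in (_ + X)%E]eq_integral do rewrite EFinM.
rewrite !ge0_integralZl//; try by rewrite lee_fin powR_ge0.
- have l1 := lee_wpmul2l (_ : (0 <= (rho `^ eta)%:E)%E) (h1 f c rho fw rho0).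
  have l2 := lee_wpmul2l (_ : (0 <= (rho `^ (2 * delta))%:E)%E) (h2 f c rho fw rho0).
  apply: le_trans (leeD (l1 _) (l2 _)) _; rewrite ?lee_fin ?powR_ge0//.
  have -> : rho `^ delta = rho `^ eta * rho `^ (- (eta - delta)).
    by rewrite -powR_add//; congr (_ `^ _); ring.
  have e2 : rho `^ eta * rho `^ (- (eta - delta)) = rho `^ (2 * delta) * rho `^ (- delta).
    by rewrite -!powR_add//; congr (_ `^ _); ring.
  rewrite [leRHS]mulrDl lerD//.
    by rewrite le_eqVlt; apply/orP; left; apply/eqP; ring.
  by rewrite e2 le_eqVlt; apply/orP; left; apply/eqP; ring.
- by move=> y _; rewrite lee_fin !mulr_ge0 ?powR_ge0.
- by move=> y _; rewrite lee_fin !mulr_ge0 ?powR_ge0.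
Qed.

Lemma far_error_lip_le : exists2 C : R, 0 < C & forall f c rho, in_Lw r w f -> 0 < rho ->
  ((lip_factor c rho * vol (eball c rho))%:E * far_error c rho f <= (C * nrm f)%:E)%E.
Proof.
have [C1 C10 h1] := far_error_le; have [C2 C20 h2] := lip_factor_le.
exists (C1 * 2 ^+ n * C2); first by rewrite !mulr_gt0// exprn_gt0.
move=> f c rho fw rho0.
have q0 := lip_factor_gt0 c rho0.
have V0 := vol_eball_gt0 c rho0.
have qV0 : 0 <= lip_factor c rho * vol (eball c rho) by rewrite mulr_ge0// ltW.
apply: le_trans (lee_wpmul2l _ (h1 _ _ _ fw rho0)) _; first by rewrite lee_fin.
rewrite -EFinM lee_fin.
have N0 : 0 <= nloc c rho f by exact: nloc_ge0.
have h3 := vol_scale c rho0.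
have h4 := h2 f c _ rho0.
apply: le_trans (_ : C1 * 2 ^+ n * (lip_factor c rho * (rho `^ (n%:R + delta) * nloc c rho f)) <= _).
  have -> : lip_factor c rho * vol (eball c rho) * (C1 * (rho `^ delta * nloc c rho f)) =
    C1 * (lip_factor c rho * ((vol (eball c rho) * rho `^ delta) * nloc c rho f)) by ring.
  have -> : C1 * 2 ^+ n * (lip_factor c rho * (rho `^ (n%:R + delta) * nloc c rho f)) =
    C1 * (lip_factor c rho * ((2 ^+ n * rho `^ (n%:R + delta)) * nloc c rho f)) by ring.
  by rewrite ler_pM2l// ler_pM2l// ler_wpM2r.
by rewrite -[leRHS]mulrA ler_pM2l// mulr_gt0// exprn_gt0.
Qed.

(** The absolute integral over 2B of the integrand of the commutator at x. *)
Definition near_part c rho f x : \bar R :=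
  (\int[mu]_(y in eball c (2 * rho)) `|(b x - b y) ^+ m * K (x - y) * f y|%:E)%E.

(** At x = y, where the size bound on K is not available, the left-hand side
    vanishes since m > 0. *)
Lemma commutator_kernel_le x y :
  `|(b x - b y) ^+ m * K (x - y)| <= Cb ^+ m * CK * enorm (x - y) `^ (m%:R * delta + alpha - n%:R).
Proof.
have [->|xy] := eqVneq x y.
  by rewrite subrr expr0n (gtn_eqF m0) mul0r normr0 !mulr_ge0 ?exprn_ge0 ?powR_ge0 ?(ltW Cb0) ?(ltW CK0).
have xy0 : x - y != 0 by rewrite subr_eq0.
have d0 := enorm_gt0 xy0.
rewrite normrM normrX.
apply: (@le_trans _ _ ((Cb * enorm (x - y) `^ delta) ^+ m * (CK * enorm (x - y) `^ (alpha - n%:R)))).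
  apply: ler_pM => //.
    by rewrite lerXn2r ?nnegrE ?mulr_ge0 ?powR_ge0 ?(ltW Cb0).
  exact: HK.
rewrite exprMn -[(_ `^ delta) ^+ m]powR_mulrn ?powR_ge0// -powRrM (mulrC delta).
have -> : enorm (x - y) `^ (m%:R * delta + alpha - n%:R) =
    enorm (x - y) `^ (m%:R * delta) * enorm (x - y) `^ (alpha - n%:R).
  by rewrite -powR_add// addrA.
by rewrite le_eqVlt; apply/orP; left; apply/eqP; ring.
Qed.

Lemma measurable_commutator_kernel f : measurable_fun setT f ->
  measurable_fun setT (fun z : 'rV[R]_n * 'rV[R]_n => (b z.1 - b z.2) ^+ m * K (z.1 - z.2) * f z.2).
Proof.
move=> mf; apply: measurable_funM; last exact: (measurableT_comp mf measurable_snd).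
apply: measurable_funM; last exact: (measurableT_comp mK measurable_rVB).
apply: measurable_funX; apply: measurable_funB.
  exact: (measurableT_comp mb measurable_fst).
exact: (measurableT_comp mb measurable_snd).
Qed.

Lemma measurable_rVB2 x : measurable_fun setT (fun y : 'rV[R]_n => x - y).
Proof.
apply: measurable_fun_rVP => i; under eq_fun do rewrite !mxE.
by apply: measurable_funB => //; exact: measurable_rV_coord.
Qed.

Lemma measurable_commutator_kernel2 f x : measurable_fun setT f ->
  measurable_fun setT (fun y => (b x - b y) ^+ m * K (x - y) * f y).
Proof.
move=> mf; apply: measurable_funM => //.
apply: measurable_funM; last exact: (measurableT_comp mK (measurable_rVB2 x)).
by apply: measurable_funX; exact: measurable_funB.
Qed.

Lemma measurable_commutator f : measurable_fun setT f ->
  measurable_fun setT (commutator m b K f).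
Proof. by move=> mf; exact: measurable_Rintegral (measurable_commutator_kernel mf). Qed.

Lemma measurable_near_part c rho f : measurable_fun setT f ->
  measurable_fun setT (near_part c rho f).
Proof.
move=> mf; rewrite /near_part.
pose F (z : 'rV[R]_n * 'rV[R]_n) := (`|(b z.1 - b z.2) ^+ m * K (z.1 - z.2) * f z.2| * \1_(eball c (2 * rho)) z.2)%:E.
have mF : measurable_fun setT F.
  apply/measurable_EFinP; apply: measurable_funM.
    by apply: measurableT_comp => //; exact: measurable_commutator_kernel.
  by apply: (@measurableT_comp _ _ _ _ _ _ (\1_(eball c (2 * rho)) : 'rV[R]_n -> R)).
have F0 q : (0 <= F q)%E by rewrite lee_fin mulr_ge0.
have := measurable_fun_fubini_tonelli_F (m2 := mu) F mF F0.
congr (measurable_fun _); apply/funext => x.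
rewrite [RHS]integral_mkcond; apply: eq_integral => y _.
by rewrite patchE /F/= indicE; case: ifPn => _; rewrite ?mulr1 ?mulr0.
Qed.

(** The exponents add up: m delta + alpha from the kernel and p from f make n
    + delta. *)
Lemma near_part_lip_le : exists2 C : R, 0 < C & forall f c rho, in_Lw r w f -> 0 < rho ->
  ((lip_factor c rho)%:E * \int[mu]_(x in eball c rho) near_part c rho f x
    <= (C * nrm f)%:E)%E.
Proof.
have be0 : 0 < m%:R * delta + alpha by rewrite addr_gt0// mulr_gt0// ltr0n.
have [C1 C10 h1] := local_integral_le be0 mdn.
have [C2 C20 h2] := eball_L1_le.
have [C3 C30 h3] := lip_factor_le.
pose k := Cb ^+ m * CK.
have k0 : 0 < k by rewrite mulr_gt0// exprn_gt0.
exists (k * C1 * C2 * 2 `^ p * C3); first by rewrite !mulr_gt0 ?powR_gt0 ?exprn_gt0.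
move=> f c rho fw rho0; have [mf _] := fw.
have mfa : measurable_fun setT (fun y => `|f y|) by exact: measurableT_comp.
have q0 := lip_factor_gt0 c rho0.
have N0 : 0 <= nloc c rho f by exact: nloc_ge0.
have rho2 : rho <= 2 * rho by lra.
pose g x := (\int[mu]_(y in eball c (2 * rho)) (enorm (x - y) `^ (m%:R * delta + alpha - n%:R) * `|f y|)%:E)%E.
have mE x : measurable_fun (eball c (2 * rho)) (fun y => (enorm (x - y) `^ (m%:R * delta + alpha - n%:R) * `|f y|)%:E).
  apply/measurable_EFinP; apply: measurable_funM; last exact: mS.
  exact: measurable_funS (measurable_enormB_powR x _).
have mg : measurable_fun setT g.
  pose F (z : 'rV[R]_n * 'rV[R]_n) := (enorm (z.1 - z.2) `^ (m%:R * delta + alpha - n%:R) * `|f z.2| * \1_(eball c (2 * rho)) z.2)%:E.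
  have mF : measurable_fun setT F.
    apply/measurable_EFinP; apply: measurable_funM.
      apply: measurable_funM.
        apply: (measurableT_comp (measurable_powR _)).
        exact: (measurableT_comp measurable_enorm measurable_rVB).
      exact: (measurableT_comp mfa measurable_snd).
    by apply: (@measurableT_comp _ _ _ _ _ _ (\1_(eball c (2 * rho)) : 'rV[R]_n -> R)).
  have F0 q : (0 <= F q)%E by rewrite lee_fin !mulr_ge0// powR_ge0.
  have := measurable_fun_fubini_tonelli_F (m2 := mu) F mF F0.
  congr (measurable_fun _); apply/funext => x.
  rewrite [RHS]integral_mkcond; apply: eq_integral => y _.
  by rewrite patchE /F/= indicE; case: ifPn => _; rewrite ?mulr1 ?mulr0.
have h4 : (\int[mu]_(x in eball c rho) near_part c rho f x <= k%:E * \int[mu]_(x in eball c rho) g x)%E.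
  rewrite -ge0_integralZl//; last 3 first.
  - exact: measurable_funS mg.
  - by move=> x _; apply: integral_ge0 => y _; rewrite lee_fin mulr_ge0// powR_ge0.
  - by rewrite lee_fin ltW.
  apply: ge0_le_integral => //.
  - by move=> x _; exact: integral_ge0.
  - exact: measurable_funS (measurable_near_part c rho mf).
  - by apply: measurable_funeM; exact: measurable_funS mg.
  - move=> x _; rewrite /near_part /g -ge0_integralZl//; last 2 first.
    + by move=> y _; rewrite lee_fin mulr_ge0// powR_ge0.
    + by rewrite lee_fin ltW.
    apply: ge0_le_integral => //.
    + exact: mnS (measurable_commutator_kernel2 x mf).
    + exact: measurable_funeM.
    + move=> y _; rewrite -EFinM lee_fin normrM mulrA ler_wpM2r//.
      exact: commutator_kernel_le.
apply: le_trans (lee_wpmul2l _ h4) _; first by rewrite lee_fin ltW.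
have h5 := le_trans (h1 c rho f rho0 mf) (lee_wpmul2l (_ : (0 <= (C1 * rho `^ (m%:R * delta + alpha))%:E)%E) (h2 f c rho _ fw rho0 rho2)).
have h6 : (0 <= (C1 * rho `^ (m%:R * delta + alpha))%:E)%E by rewrite lee_fin mulr_ge0 ?powR_ge0// ltW.
have {h5}h5 := h5 h6.
rewrite muleA -EFinM; apply: le_trans (lee_wpmul2l _ h5) _.
  by rewrite lee_fin mulr_ge0// ltW.
rewrite -!EFinM lee_fin powRM ?(ltW rho0)//.
have -> : lip_factor c rho * k *
  (C1 * rho `^ (m%:R * delta + alpha) * (C2 * nloc c rho f * (2 `^ p * rho `^ p))) =
  k * C1 * C2 * 2 `^ p * (lip_factor c rho * (rho `^ (n%:R + delta) * nloc c rho f)).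
  have -> : rho `^ (n%:R + delta) = rho `^ (m%:R * delta + alpha) * rho `^ p.
    by rewrite -powR_add//; congr (_ `^ _); rewrite hp; ring.
  ring.
by rewrite -[leRHS]mulrA ler_pM2l ?h3// !mulr_gt0 ?powR_gt0 ?exprn_gt0.
Qed.

End weighted.

(** * Truncation, the obstruction and the two equivalences *)

Section truncation.
Context {R : realType} {n : nat}.
Local Notation mu := (leb R n).
Implicit Types (c x y z u : 'rV[R]_n) (rho : R) (f k : 'rV[R]_n -> R).

Definition annulus c rho (N : nat) : set 'rV[R]_n :=
  eball c N%:R `&` ~` eball c (2 * rho).

Lemma measurable_annulus c rho N : measurable (annulus c rho N).
Proof. by apply: measurableI; [|apply: measurableC]; exact: measurable_eball. Qed.

Lemma bigcup_annulus c rho : \bigcup_N annulus c rho N = ~` eball c (2 * rho).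
Proof.
apply/seteqP; split => [y [N _ []]//|y By].
exists (Num.truncn (enorm (y - c))).+1 => //; split => //.
by rewrite /eball/= truncnS_gt.
Qed.

Lemma annulus_nd c rho : {homo annulus c rho : p q / (p <= q)%N >-> p `<=` q}.
Proof.
by move=> p q pq y [h1 h2]; split => //; apply: eballS h1; rewrite ler_nat.
Qed.

(** f cut off to an annulus, with the signs that make its product with k
    nonnegative. *)
Definition aligned c rho N k f : 'rV[R]_n -> R := fun y =>
  (if 0 <= k y then `|f y| else - `|f y|) * \1_(annulus c rho N) y.

Lemma measurable_aligned c rho N k f : measurable_fun setT k -> measurable_fun setT f ->
  measurable_fun setT (aligned c rho N k f).
Proof.
move=> mk mf; have mfa : measurable_fun setT (fun y => `|f y|) by exact: measurableT_comp.
apply: measurable_funM; last by apply: measurable_indic; exact: measurable_annulus.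
apply: measurable_fun_ifT => //.
- by apply: measurable_fun_ler => //; exact: measurable_cst.
- by apply: measurableT_comp => //.
Qed.

Lemma mul_aligned c rho N k f y :
  k y * aligned c rho N k f y = `|k y| * `|f y| * \1_(annulus c rho N) y.
Proof.
rewrite /aligned; case: ifPn => h; first by rewrite mulrA (ger0_norm h).
by move: h; rewrite -ltNge => h; rewrite mulrA mulrN -mulNr (ltr0_norm h).
Qed.

Lemma norm_aligned c rho N k f y :
  `|aligned c rho N k f y| = `|f y| * \1_(annulus c rho N) y.
Proof.
rewrite /aligned normrM; congr (_ * _).
  by case: ifPn => _; rewrite ?normrN normr_id.
by rewrite indicE; case: (_ \in _); rewrite ?normr1 ?normr0.
Qed.

Lemma aligned_le c rho N k f y : `|aligned c rho N k f y| <= `|f y|.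
Proof.
by rewrite norm_aligned indicE; case: (_ \in _); rewrite ?mulr1// mulr0.
Qed.

Variables (r : R) (w : 'rV[R]_n -> R).
Hypotheses (r0 : 0 < r) (mw : measurable_fun setT w).

Lemma wnorm_le (f g : 'rV[R]_n -> R) : measurable_fun setT f -> measurable_fun setT g ->
  (forall x, `|f x| <= `|g x|) -> (wnorm r w f <= wnorm r w g)%E.
Proof.
move=> mf mg fg; rewrite /wnorm unlock.
have m (h : 'rV[R]_n -> R) : measurable_fun setT h -> measurable_fun setT (fun x => (`|(EFin \o (h \* w)%R) x| `^ r)%E).
  move=> mh; apply: (measurableT_comp (measurable_poweR _)).
  by apply: measurableT_comp => //; apply/measurable_EFinP; exact: measurable_funM.
apply: gt0_ler_poweR; first by rewrite invr_ge0 ltW.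
- by rewrite in_itv/= leey andbT; apply: integral_ge0 => x _; rewrite lee_fin powR_ge0.
- by rewrite in_itv/= leey andbT; apply: integral_ge0 => x _; rewrite lee_fin powR_ge0.
apply: ge0_le_integral => //; try exact: m.
- by move=> x _; rewrite lee_fin powR_ge0.
- move=> x _; rewrite lee_fin /= ge0_ler_powR ?nnegrE ?(ltW r0)//.
  by rewrite !normrM ler_wpM2r.
Qed.

Lemma in_Lw_aligned c rho N k f : measurable_fun setT k -> in_Lw r w f ->
  in_Lw r w (aligned c rho N k f) /\ nrm r w (aligned c rho N k f) <= nrm r w f.
Proof.
move=> mk fw; have [mf fy] := fw.
have ma := measurable_aligned c rho N mk mf.
have le := wnorm_le ma mf (aligned_le c rho N k f).
have aw : in_Lw r w (aligned c rho N k f) by split => //; exact: le_lt_trans fy.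
by split => //; rewrite -lee_fin -!nrmE.
Qed.

End truncation.

Section equivalence.
Context {R : realType} {n : nat}.
Local Notation mu := (leb R n).
Implicit Types (c x y z u : 'rV[R]_n) (rho : R) (f : 'rV[R]_n -> R).
Variables (r alpha eta delta : R) (m : nat) (K b w : 'rV[R]_n -> R).
Hypotheses (r0 : 0 < r) (m0 : (0 < m)%N).
Hypotheses (mK : measurable_fun setT K) (mb : measurable_fun setT b) (mw : measurable_fun setT w).
Hypothesis HM : forall c rho, 0 < rho ->
  0 < wsup w (eball c rho) /\
  ('N[mu]_+oo[EFin \o (w \* \1_(eball c rho))%R] = (wsup w (eball c rho))%:E)%E.
Hypothesis HL : forall f, in_Lw r w f -> locally_L1 (EFin \o f).
Variables (Cfar Cterm C1 C2 : R).
Hypotheses (Cfar0 : 0 < Cfar) (Cterm0 : 0 < Cterm) (C10 : 0 < C1) (C20 : 0 < C2).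

Local Notation bB c rho := (mean (eball c rho) b).
Local Notation far c rho y := (far_weight alpha eta delta m c rho y).
Local Notation far_error := (far_error delta m alpha eta).
Local Notation near_part := (near_part m K b).
Local Notation q c rho := (lip_factor w delta c rho).
Local Notation T := (commutator m b K).

Hypothesis Hb : forall c rho, 0 < rho -> mu.-integrable (eball c rho) (EFin \o b).
Hypothesis Hcomm : forall c rho x u y, 0 < rho ->
  eball c rho x -> eball c rho u -> ~ eball c (2 * rho) y ->
  `|(b x - b y) ^+ m * K (x - y) - (bB c rho - b y) ^+ m * K (u - y)
    - (b x - bB c rho) * (m%:R * (bB c rho - b y) ^+ m.-1 * K (u - y))|
  <= Cfar * far c rho y.
Hypothesis Hterm : forall k c rho x u y, (k.+2 <= m)%N -> 0 < rho ->
  eball c rho x -> eball c rho u -> ~ eball c (2 * rho) y ->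
  `|b x - bB c rho| ^+ (m - k) * `|(b y - bB c rho) ^+ k * K (u - y)|
  <= Cterm * far c rho y.
Hypothesis Hann : forall c rho u N k, 0 < rho -> eball c rho u ->
  exists E : R, forall y, annulus c rho N y -> `|(b y - bB c rho) ^+ k * K (u - y)| <= E.
Hypothesis Hfar : forall f c rho, in_Lw r w f -> 0 < rho ->
  ((q c rho * vol (eball c rho))%:E * far_error c rho f <= (C1 * nrm r w f)%:E)%E.
Hypothesis Hnear : forall f c rho, in_Lw r w f -> 0 < rho ->
  ((q c rho)%:E * \int[mu]_(x in eball c rho) near_part c rho f x <= (C2 * nrm r w f)%:E)%E.
Hypothesis Hbb : forall c rho, 0 < rho -> exists E : R, forall x, eball c rho x -> `|b x - bB c rho| <= E.
Hypothesis mnear : forall f c rho, measurable_fun setT f -> measurable_fun setT (near_part c rho f).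

Let mB c rho : measurable (eball c rho) := measurable_eball c rho.
Let mBC c rho : measurable (~` eball c rho) := measurableC (measurable_eball c rho).
Let mS D (f : 'rV[R]_n -> R) : measurable_fun setT f -> measurable_fun D f.
Proof. by move=> mf; exact: measurable_funS mf. Qed.
Let mnS D (f : 'rV[R]_n -> R) : measurable_fun setT f -> measurable_fun D (fun x => `|f x|%:E).
Proof. by move=> mf; apply/measurable_EFinP; apply: measurableT_comp => //; exact: mS. Qed.

Definition osc c rho : R := \int[mu]_(x in eball c rho) `|b x - bB c rho|.

(** The function of y against which f is integrated in the critical term. *)
Definition crit c rho u y : R := (b y - bB c rho) ^+ m.-1 * K (u - y).

(** The integral of the absolute values in the critical term; possibly
    infinite, and then multiplied by an oscillation of b that has to vanish.
    *)
Definition core c rho u f : \bar R :=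
  (\int[mu]_(y in ~` eball c (2 * rho)) (`|crit c rho u y| * `|f y|)%:E)%E.

(** The condition between the two statements of the theorem. *)
Definition obstruction_bounded := exists2 C : R, 0 < C &
  forall c rho u f, 0 < rho -> eball c rho u -> in_Lw r w f ->
  ((q c rho * osc c rho)%:E * core c rho u f <= (C * nrm r w f)%:E)%E.

Lemma oscE c rho : 0 < rho ->
  (\int[mu]_(x in eball c rho) `|b x - bB c rho|%:E = (osc c rho)%:E)%E.
Proof.
move=> rho0; rewrite /osc /Rintegral fineK//; apply: integrable_fin_num => //.
by apply: integrable_normr => //; apply: integrableB_cst => //; exact: Hb.
Qed.

Lemma osc_ge0 c rho : 0 <= osc c rho.
Proof. by rewrite /osc; exact: Rintegral_ge0. Qed.

Lemma measurable_crit c rho u : measurable_fun setT (crit c rho u).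
Proof.
apply: measurable_funM; last exact: (measurableT_comp mK (measurable_rVB2 u)).
by apply: measurable_funX; exact: measurable_funB.
Qed.

Lemma far_error_ge0 c rho f : (0 <= far_error c rho f)%E.
Proof.
by apply: integral_ge0 => y _; rewrite lee_fin mulr_ge0//; exact: far_weight_ge0.
Qed.

Let q0 c rho : 0 < rho -> 0 < q c rho.
Proof. by move=> rho0; exact: lip_factor_gt0. Qed.

Lemma far_errorE c rho f : in_Lw r w f -> 0 < rho ->
  far_error c rho f = (fine (far_error c rho f))%:E /\
  q c rho * vol (eball c rho) * fine (far_error c rho f) <= C1 * nrm r w f.
Proof.
move=> fw rho0; have h := Hfar c fw rho0.
have qV0 : 0 < q c rho * vol (eball c rho) by rewrite mulr_gt0 ?q0 ?vol_eball_gt0.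
have E : far_error c rho f = (fine (far_error c rho f))%:E.
  rewrite fineK// ge0_fin_numE ?far_error_ge0//.
  by move: h; rewrite -lee_pdivlMl// => /le_lt_trans; apply; rewrite -EFinM ltry.
by split => //; rewrite -lee_fin EFinM -E.
Qed.

(** The two terms of the expansion of the commutator off 2B: ker0 does not
    depend on x, and ker1 is multiplied by b(x) - b_B. *)
Definition ker0 c rho u f y : R := (bB c rho - b y) ^+ m * K (u - y) * f y.
Definition ker1 c rho u f y : R := m%:R * (bB c rho - b y) ^+ m.-1 * K (u - y) * f y.

Lemma measurable_ker0 c rho u f : measurable_fun setT f -> measurable_fun setT (ker0 c rho u f).
Proof.
move=> mf; apply: measurable_funM => //.
apply: measurable_funM; last exact: (measurableT_comp mK (measurable_rVB2 u)).
by apply: measurable_funX; exact: measurable_funB.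
Qed.

Lemma measurable_ker1 c rho u f : measurable_fun setT f -> measurable_fun setT (ker1 c rho u f).
Proof.
move=> mf; apply: measurable_funM => //.
apply: measurable_funM; last exact: (measurableT_comp mK (measurable_rVB2 u)).
by apply: measurable_funM => //; apply: measurable_funX; exact: measurable_funB.
Qed.

Lemma kernel_expansion c rho x u y f : 0 < rho ->
  eball c rho x -> eball c rho u -> ~ eball c (2 * rho) y ->
  `|(b x - b y) ^+ m * K (x - y) * f y -
    (ker0 c rho u f y + (b x - bB c rho) * ker1 c rho u f y)| <= Cfar * (far c rho y * `|f y|).
Proof.
move=> rho0 Bx Bu By; rewrite [leRHS]mulrA.
rewrite (_ : _ - _ = ((b x - b y) ^+ m * K (x - y) - (bB c rho - b y) ^+ m * K (u - y)
    - (b x - bB c rho) * (m%:R * (bB c rho - b y) ^+ m.-1 * K (u - y))) * f y); last first.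
  by rewrite /ker0 /ker1; ring.
by rewrite normrM ler_wpM2r//; exact: Hcomm.
Qed.

Lemma far_error_integral c rho f (a : R) : 0 <= a -> measurable_fun setT f ->
  (\int[mu]_(y in ~` eball c (2 * rho)) (a * (far c rho y * `|f y|))%:E =
   a%:E * far_error c rho f)%E.
Proof.
move=> a0 mf; under eq_integral do rewrite EFinM.
rewrite ge0_integralZl//.
- apply/measurable_EFinP; apply: mS; apply: measurable_funM.
    exact: measurable_far_weight.
  exact: measurableT_comp.
- by move=> y _; rewrite lee_fin mulr_ge0//; exact: far_weight_ge0.
Qed.

(** When f vanishes on 2B and both terms converge, the commutator is on B an
    affine function of b, up to the harmless error. *)
Lemma commutator_affine c rho x u f : 0 < rho -> in_Lw r w f ->
  (forall y, eball c (2 * rho) y -> f y = 0) ->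
  eball c rho x -> eball c rho u ->
  mu.-integrable (~` eball c (2 * rho)) (EFin \o ker0 c rho u f) ->
  mu.-integrable (~` eball c (2 * rho)) (EFin \o ker1 c rho u f) ->
  `|T f x - (b x - bB c rho) * (\int[mu]_(y in ~` eball c (2 * rho)) ker1 c rho u f y)
    - \int[mu]_(y in ~` eball c (2 * rho)) ker0 c rho u f y|
  <= Cfar * fine (far_error c rho f).
Proof.
move=> rho0 fw f0 Bx Bu i0 i1; have [mf _] := fw; have [fE _] := far_errorE c fw rho0.
rewrite -lee_fin [leRHS]EFinM -fE -far_error_integral ?(ltW Cfar0)//.
have i1' : mu.-integrable (~` eball c (2 * rho)) (EFin \o (fun y => (b x - bB c rho) * ker1 c rho u f y)).
  by have := integrableZl (mBC c (2 * rho)) (b x - bB c rho) i1; apply: eq_integrable.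
rewrite -addrA -opprD [X in T f x - X]addrC -RintegralZl// -RintegralD//.
have mk0 := measurable_ker0 c rho u mf; have mk1 := measurable_ker1 c rho u mf.
have mk : measurable_fun setT (fun y => ker0 c rho u f y + (b x - bB c rho) * ker1 c rho u f y).
  by apply: measurable_funD => //; exact: measurable_funM.
have mh : measurable_fun setT (fun y => (b x - b y) ^+ m * K (x - y) * f y).
  exact: measurable_commutator_kernel2.
apply: le_trans (Rintegral_perturb mu (mBC c (2 * rho)) mh mk) _.
rewrite setCK [X in (X + _)%E](_ : _ = 0)%E ?add0e; last first.
  apply: integral0_eq => y By; by rewrite f0// mulr0 normr0.
apply: ge0_le_integral => //.
- by apply: mnS; exact: measurable_funB.
- apply/measurable_EFinP; apply: mS; apply: measurable_funM => //; apply: measurable_funM.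
    exact: measurable_far_weight.
  exact: measurableT_comp.
- by move=> y By; rewrite lee_fin; exact: kernel_expansion.
Qed.

Lemma ker1_crit c rho u f y : `|ker1 c rho u f y| = m%:R * (`|crit c rho u y| * `|f y|).
Proof.
rewrite /ker1 /crit !normrM normr_nat !normrX -[bB c rho - b y]opprB normrN.
by rewrite !mulrA.
Qed.

(** Valid at every point, whether or not the integrals converge: if the
    commutator diverges because ker0 does, both numbers on the left are 0. *)
Lemma commutator_near c rho f x : 0 < rho -> in_Lw r w f -> eball c rho x ->
  (`|T f x - \int[mu]_(y in ~` eball c (2 * rho)) ker0 c rho c f y|%:E <=
   near_part c rho f x + (`|b x - bB c rho|%:E * (m%:R%:E * core c rho c f)
     + Cfar%:E * far_error c rho f))%E.
Proof.
move=> rho0 fw Bx; have [mf _] := fw.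
have Bc : eball c rho c by exact: eball_center.
have mk0 := measurable_ker0 c rho c mf; have mk1 := measurable_ker1 c rho c mf.
have mh : measurable_fun setT (fun y => (b x - b y) ^+ m * K (x - y) * f y).
  exact: measurable_commutator_kernel2.
apply: le_trans (Rintegral_perturb mu (mBC c (2 * rho)) mh mk0) _.
rewrite setCK; apply: leeD => //.
have mC : measurable_fun setT (fun y => `|crit c rho c y| * `|f y|).
  apply: measurable_funM; apply: measurableT_comp => //; exact: measurable_crit.
have mF : measurable_fun setT (fun y => Cfar * (far c rho y * `|f y|)).
  apply: measurable_funM => //; apply: measurable_funM; last exact: measurableT_comp.
  exact: measurable_far_weight.
have F0 y : 0 <= Cfar * (far c rho y * `|f y|).
  by rewrite mulr_ge0 ?(ltW Cfar0)// mulr_ge0//; exact: far_weight_ge0.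
rewrite -far_error_integral ?(ltW Cfar0)// /core -ge0_integralZl//; last first.
  by apply/measurable_EFinP; exact: mS.
rewrite -ge0_integralZl//; last first.
- by apply: measurable_funeM; apply/measurable_EFinP; exact: mS.
- rewrite -ge0_integralD//; last 3 first.
  + by do 2 apply: measurable_funeM; apply/measurable_EFinP; exact: mS.
  + by move=> y _; rewrite lee_fin.
  + by apply/measurable_EFinP; exact: mS.
  + apply: ge0_le_integral => //.
    * by apply: mnS; exact: measurable_funB.
    * by apply: emeasurable_funD; [do 2 apply: measurable_funeM|]; apply/measurable_EFinP; exact: mS.
    * move=> y By; rewrite -!EFinM -EFinD lee_fin -ker1_crit -normrM.
      have := kernel_expansion f rho0 Bx Bc By.
      set X := (_ * K (x - y) * f y); set Y := ker0 _ _ _ _ _; set Z := (_ - bB c rho) * _ => h.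
      have -> : X - Y = Z + (X - (Y + Z)) by ring.
      by apply: le_trans (ler_normD _ _) _; rewrite lerD2l.
Qed.


Lemma core_ge0 c rho u f : (0 <= core c rho u f)%E.
Proof. by apply: integral_ge0 => y _; rewrite lee_fin mulr_ge0. Qed.

(** Integrate commutator_near over B. The product of the oscillation of b and
    the core is integrated in extended arithmetic, so an infinite core is
    harmless where b is constant. *)
Lemma commutator_deviation_le : obstruction_bounded -> exists2 C : R, 0 < C &
  forall c rho f, 0 < rho -> in_Lw r w f -> exists a : R,
  ((q c rho)%:E * \int[mu]_(x in eball c rho) `|T f x - a|%:E <= (C * nrm r w f)%:E)%E.
Proof.
move=> [C3 C30 hobs]; exists (C2 + (m%:R * C3 + Cfar * C1)).
  by rewrite addr_gt0// addr_gt0 ?mulr_gt0// ltr0n.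
move=> c rho f rho0 fw; have [mf _] := fw.
exists (\int[mu]_(y in ~` eball c (2 * rho)) ker0 c rho c f y); set a := \int[mu]_(_ in _) _.
have qp := q0 c rho0.
have Bc : eball c rho c by exact: eball_center.
have mT : measurable_fun setT (T f) by exact: measurable_commutator.
have [fE hE] := far_errorE c fw rho0; set E0 := fine _ in fE hE.
have mbB : measurable_fun setT (fun x => `|b x - bB c rho|).
  by apply: measurableT_comp => //; exact: measurable_funB.
have mbE : measurable_fun (eball c rho) (fun x => `|b x - bB c rho|%:E).
  by apply/measurable_EFinP; exact: mS.
have cge0 : (0 <= m%:R%:E * core c rho c f)%E by rewrite mule_ge0 ?lee_fin ?core_ge0.
have E00 : 0 <= E0 by rewrite fine_ge0// far_error_ge0.
have mc : measurable_fun (eball c rho) (fun x => (`|b x - bB c rho|%:E * (m%:R%:E * core c rho c f))%E).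
  by under eq_fun do rewrite muleC; exact: measurable_funeM.
have nge0 x : (0 <= near_part c rho f x)%E by exact: integral_ge0.
apply: (@le_trans _ _ ((q c rho)%:E * (\int[mu]_(x in eball c rho) near_part c rho f x
   + ((osc c rho)%:E * (m%:R%:E * core c rho c f) + Cfar%:E * (vol (eball c rho) * E0)%:E)))%E).
  apply: lee_wpmul2l; first by rewrite lee_fin ltW.
  apply: (@le_trans _ _ (\int[mu]_(x in eball c rho) (near_part c rho f x +
     (`|b x - bB c rho|%:E * (m%:R%:E * core c rho c f) + (Cfar * E0)%:E)))%E).
    apply: ge0_le_integral => //.
    - by apply: mnS; exact: measurable_funB.
    - apply: emeasurable_funD; last by apply: emeasurable_funD.
      by apply: measurable_funS (mnear c rho mf).
    - move=> x Bx; have := commutator_near rho0 fw Bx.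
      by rewrite -/a fE EFinM.
  rewrite ge0_integralD//; last 3 first.
  - by apply: measurable_funS (mnear c rho mf).
  - by move=> x _; apply: adde_ge0; [exact: mule_ge0|rewrite lee_fin mulr_ge0// ltW].
  - by apply: emeasurable_funD.
  rewrite [X in (_ + X <= _)%E]ge0_integralD//; last 2 first.
  - by move=> x _; rewrite mule_ge0.
  - by move=> x _; rewrite lee_fin mulr_ge0// ltW.
  apply: leeD => //; apply: leeD.
    under eq_integral do rewrite muleC.
    by rewrite ge0_integralZl// oscE// muleC.
  have -> : (\int[mu]_(_ in eball c rho) (Cfar * E0)%:E = (Cfar * E0)%:E * (vol (eball c rho))%:E)%E.
    by rewrite -leb_eball// -integral_cst.
  rewrite -!EFinM lee_fin.
  by rewrite le_eqVlt; apply/orP; left; apply/eqP; ring.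
rewrite ge0_muleDr ?integral_ge0//; last first.
  rewrite adde_ge0 ?mule_ge0 ?lee_fin ?osc_ge0 ?core_ge0 ?(ltW Cfar0)//.
  by rewrite mulr_ge0// ltW// vol_eball_gt0.
rewrite mulrDl EFinD; apply: leeD; first exact: Hnear.
rewrite ge0_muleDr; last 2 first.
- by rewrite !mule_ge0 ?lee_fin ?osc_ge0 ?core_ge0.
- by rewrite -EFinM lee_fin !mulr_ge0 ?(ltW Cfar0)// ltW// vol_eball_gt0.
rewrite mulrDl EFinD; apply: leeD.
  have -> : ((q c rho)%:E * ((osc c rho)%:E * (m%:R%:E * core c rho c f)) =
      m%:R%:E * ((q c rho * osc c rho)%:E * core c rho c f))%E.
    by rewrite [(q c rho * osc c rho)%:E]EFinM (muleCA (osc c rho)%:E) (muleCA (q c rho)%:E) -!muleA.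
  apply: le_trans (lee_wpmul2l _ (hobs c rho c f rho0 Bc fw)) _; first by rewrite lee_fin.
  by rewrite -EFinM mulrA.
rewrite -!EFinM lee_fin.
have -> : q c rho * (Cfar * (vol (eball c rho) * E0)) =
  Cfar * (q c rho * vol (eball c rho) * E0) by ring.
by rewrite -[leRHS]mulrA ler_pM2l.
Qed.

Lemma commutator_eball_integrable c rho f a : 0 < rho -> in_Lw r w f ->
  (\int[mu]_(x in eball c rho) `|T f x - a|%:E < +oo)%E ->
  mu.-integrable (eball c rho) (EFin \o T f).
Proof.
move=> rho0 fw h; have [mf _] := fw.
have mT := measurable_commutator m mK mb mf.
have i1 : mu.-integrable (eball c rho) (EFin \o (fun x => T f x - a)).
  by apply: integrable_fin_abs h; apply: mS; exact: measurable_funB.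
have := integrableB_cst rho0 (- a) i1; apply: eq_integrable => // x _.
by rewrite /= opprK subrK.
Qed.

Lemma obstruction_bounded_commutator : obstruction_bounded ->
  bounded_Lw_wlip r delta w T.
Proof.
move=> /commutator_deviation_le[C C0 hC].
have hint f c rho : 0 < rho -> in_Lw r w f -> mu.-integrable (eball c rho) (EFin \o T f).
  move=> rho0 fw; have [a ha] := hC c rho f rho0 fw.
  apply: (commutator_eball_integrable (a := a) rho0 fw).
  by move: ha; rewrite -lee_pdivlMl ?q0// => /le_lt_trans; apply; rewrite -EFinM ltry.
exists (2 * C); first by rewrite mulr_gt0.
move=> f fw; have [mf fy] := fw.
have mT := measurable_commutator m mK mb mf.
have norm_le : (wlip_norm delta w (T f) <= (2 * C)%:E * wnorm r w f)%E.
  apply: ge_ereal_sup => _ [c [rho [rho0 ->]]].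
  rewrite (wlip_avgE HM)//; have [a ha] := hC c rho f rho0 fw.
  have := oscillation_le rho0 a (hint f c rho rho0 fw) => /(lee_wpmul2l (_ : 0 <= (q c rho)%:E)%E) h.
  apply: le_trans (h _) _; first by rewrite lee_fin ltW// q0.
  rewrite muleCA nrmE// -EFinM -mulrA EFinM; exact: lee_wpmul2l ha.
split => //; split; last first.
  by apply: le_lt_trans norm_le _; rewrite nrmE// -EFinM ltry.
split; first exact/measurable_EFinP.
move=> D cD; have [rho rho0 Drho] := compact_sub_eball cD.
have /integrableP[_] := hint f 0 rho rho0 fw; apply: le_lt_trans.
apply: ge0_subset_integral => //; first exact: compact_measurable_rV.
exact: mnS.
Qed.


Lemma annulus_integrable c rho N f (E : R) (D : set 'rV[R]_n) (h : 'rV[R]_n -> R) :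
  in_Lw r w f -> measurable D -> measurable_fun setT h ->
  (forall y, `|h y| <= E * (`|f y| * \1_(annulus c rho N) y)) ->
  mu.-integrable D (EFin \o h).
Proof.
move=> fw mD mh hE; have [mf _] := fw.
have mA := measurable_annulus c rho N.
have E0 : 0 <= `|E| by [].
have mi : measurable_fun setT (\1_(annulus c rho N) : 'rV[R]_n -> R) by exact: measurable_indic.
have mg : measurable_fun setT (fun y => `|f y| * \1_(annulus c rho N) y).
  by apply: measurable_funM => //; exact: measurableT_comp.
apply: integrable_fin_abs; first exact: mS.
apply: (@le_lt_trans _ _ (\int[mu]_y (`|E|%:E * (`|f y| * \1_(annulus c rho N) y)%:E))%E).
  apply: (@le_trans _ _ (\int[mu]_y `|h y|%:E)%E).
    by apply: ge0_subset_integral => //; exact: mnS.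
  apply: ge0_le_integral => //.
  - exact: mnS.
  - by apply: measurable_funeM; exact/measurable_EFinP.
  - move=> y _; rewrite -EFinM lee_fin; apply: le_trans (hE y) _.
    by rewrite ler_wpM2r ?ler_norm// mulr_ge0.
rewrite ge0_integralZl//; last exact/measurable_EFinP.
have [_ hf] := HL fw; have [D' [cD' mD' BD']] := eball_sub_compact c (N%:R : R).
apply: lte_mul_pinfty => //; apply: le_lt_trans (hf _ cD').
rewrite [leRHS]integral_mkcond; apply: ge0_le_integral => //.
- exact/measurable_EFinP.
- by apply/measurable_restrict => //; rewrite setTI; exact: mnS.
- move=> y _; rewrite patchE indicE; have [yA|yA] := boolP (y \in annulus c rho N).
    by rewrite mulr1 mem_set//; apply: BD'; move: yA; rewrite inE => -[].
  by rewrite mulr0; case: ifPn => _; [rewrite lee_fin|exact: lexx].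
Qed.

Definition crit_trunc c rho u N f y : R := `|crit c rho u y| * `|f y| * \1_(annulus c rho N) y.

Lemma measurable_crit_trunc c rho u N f : measurable_fun setT f ->
  measurable_fun setT (crit_trunc c rho u N f).
Proof.
move=> mf; apply: measurable_funM; last by apply: measurable_indic; exact: measurable_annulus.
by apply: measurable_funM; apply: measurableT_comp => //; exact: measurable_crit.
Qed.

Lemma crit_trunc_integrable c rho u N f (D : set 'rV[R]_n) : 0 < rho -> eball c rho u ->
  in_Lw r w f -> measurable D -> mu.-integrable D (EFin \o crit_trunc c rho u N f).
Proof.
move=> rho0 Bu fw mD; have [mf _] := fw; have [E hE] := Hann N m.-1 rho0 Bu.
apply: (annulus_integrable (E := E) (f := f) (N := N) (c := c) (rho := rho)) => //.
  exact: measurable_crit_trunc.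
move=> y; rewrite /crit_trunc indicE; have [yA|yA] := boolP (y \in annulus c rho N).
  rewrite !mulr1 ger0_norm ?mulr_ge0// ler_wpM2r//; apply: hE; by rewrite inE in yA.
by rewrite !mulr0 normr0.
Qed.

(** The value of the critical term on a function aligned with its kernel. *)
Definition crit_value c rho u N f : R :=
  \int[mu]_(y in ~` eball c (2 * rho)) crit_trunc c rho u N f y.

Lemma crit_valueE c rho u N f : 0 < rho -> eball c rho u -> in_Lw r w f ->
  (\int[mu]_(y in annulus c rho N) (`|crit c rho u y| * `|f y|)%:E
   = (crit_value c rho u N f)%:E)%E.
Proof.
move=> rho0 Bu fw; rewrite /crit_value /Rintegral fineK; last first.
  by apply: integrable_fin_num => //; exact: crit_trunc_integrable.
rewrite [LHS]integral_mkcond [RHS]integral_mkcond; apply: eq_integral => y _.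
rewrite !patchE /crit_trunc indicE; have [yA|yA] := boolP (y \in annulus c rho N).
  rewrite mulr1; case: ifPn => // /negP h; exfalso; apply: h.
  by move: yA; rewrite !inE => -[].
by rewrite mulr0; case: ifPn.
Qed.

Lemma crit_value_ge0 c rho u N f : 0 <= crit_value c rho u N f.
Proof. by apply: Rintegral_ge0 => y _; rewrite /crit_trunc !mulr_ge0. Qed.

Local Notation trunc c rho u N f := (aligned c rho N (crit c rho u) f).

Lemma trunc_eq0 c rho u N f y : eball c (2 * rho) y -> trunc c rho u N f y = 0.
Proof.
move=> By; rewrite /aligned indicE (_ : (y \in _) = false) ?mulr0//.
by apply/negP; rewrite inE => -[].
Qed.

Lemma ker0_trunc_integrable c rho u N f : 0 < rho -> eball c rho u -> in_Lw r w f ->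
  mu.-integrable (~` eball c (2 * rho)) (EFin \o ker0 c rho u (trunc c rho u N f)).
Proof.
move=> rho0 Bu fw; have [mf _] := fw; have [E hE] := Hann N m rho0 Bu.
apply: (annulus_integrable (E := E) (f := f) (N := N) (c := c) (rho := rho)) => //.
  by apply: measurable_ker0; apply: measurable_aligned => //; exact: measurable_crit.
move=> y; rewrite /ker0 normrM norm_aligned indicE.
have [yA|yA] := boolP (y \in annulus c rho N); last by rewrite !mulr0.
rewrite !mulr1 ler_wpM2r// normrM normrX -opprB normrN -normrX -normrM.
by apply: hE; rewrite inE in yA.
Qed.

Lemma ker1_trunc c rho u N f y :
  ker1 c rho u (trunc c rho u N f) y = m%:R * (-1) ^+ m.-1 * crit_trunc c rho u N f y.
Proof.
rewrite /ker1 /crit_trunc -mul_aligned /crit -[bB c rho - b y]opprB [(- (b y - bB c rho)) ^+ _]exprNn.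
by rewrite -!mulrA.
Qed.

Lemma ker1_trunc_integrable c rho u N f : 0 < rho -> eball c rho u -> in_Lw r w f ->
  mu.-integrable (~` eball c (2 * rho)) (EFin \o ker1 c rho u (trunc c rho u N f)).
Proof.
move=> rho0 Bu fw.
have := integrableZl (mBC c (2 * rho)) (m%:R * (-1) ^+ m.-1)
  (crit_trunc_integrable N rho0 Bu fw (mBC c (2 * rho))).
by apply: eq_integrable => // y _ /=; rewrite ker1_trunc EFinM.
Qed.

Lemma ker1_trunc_value c rho u N f : 0 < rho -> eball c rho u -> in_Lw r w f ->
  `|\int[mu]_(y in ~` eball c (2 * rho)) ker1 c rho u (trunc c rho u N f) y|
  = m%:R * crit_value c rho u N f.
Proof.
move=> rho0 Bu fw; under eq_Rintegral do rewrite ker1_trunc.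
rewrite RintegralZl//; last exact: crit_trunc_integrable.
rewrite !normrM normr_nat normrX normrN1 expr1n mulr1 ger0_norm//.
exact: crit_value_ge0.
Qed.

(** Annuli exhaust the complement of 2B, so it suffices to bound the
    obstruction on functions aligned with the critical kernel. *)
Lemma obstruction_bounded_trunc (C : R) : 0 < C ->
  (forall c rho u N f, 0 < rho -> eball c rho u -> in_Lw r w f ->
    q c rho * osc c rho * crit_value c rho u N f <= C * nrm r w f) ->
  obstruction_bounded.
Proof.
move=> C0 hC; exists C => // c rho u f rho0 Bu fw; have [mf _] := fw.
rewrite /core -bigcup_annulus; apply: le_integral_exhaustion => //.
- exact: annulus_nd.
- by move=> N; exact: measurable_annulus.
- apply/measurable_EFinP; apply: measurable_funM; apply: measurableT_comp => //.
  exact: measurable_crit.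
- by rewrite mulr_ge0 ?osc_ge0// ltW// q0.
- by rewrite lee_fin mulr_ge0 ?nrm_ge0// ltW.
- by move=> N; rewrite crit_valueE// -EFinM lee_fin; exact: hC.
Qed.

Lemma mean_symbolB c rho : 0 < rho -> mean (eball c rho) (fun x => b x - bB c rho) = 0.
Proof.
move=> rho0; rewrite meanB ?mean_cst ?subrr//; first exact: Hb.
exact: eball_cst_integrable.
Qed.

Lemma symbolB_integrable c rho : 0 < rho ->
  mu.-integrable (eball c rho) (EFin \o (fun x => b x - bB c rho)).
Proof. by move=> rho0; apply: integrableB_cst => //; exact: Hb. Qed.

Lemma integral_symbolBM c rho (A : R) : 0 < rho ->
  (\int[mu]_(x in eball c rho) `|(b x - bB c rho) * A|%:E = (osc c rho * `|A|)%:E)%E.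
Proof.
move=> rho0; under eq_integral do rewrite normrM mulrC EFinM.
rewrite ge0_integralZl// ?oscE// -?EFinM 1?mulrC//.
by apply: mnS; exact: measurable_funB.
Qed.

(** On B the commutator of the aligned function g is, up to a constant and the
    harmless error, (b - b_B) A with |A| = m crit_value. The oscillation of
    this function is |A| times that of b, and is bounded by the oscillation of
    the commutator of g. *)
Lemma commutator_obstruction_bounded : bounded_Lw_wlip r delta w T -> obstruction_bounded.
Proof.
move=> [C C0 hC]; apply: (@obstruction_bounded_trunc (C + 2 * Cfar * C1)).
  by rewrite addr_gt0// !mulr_gt0.
move=> c rho u N f rho0 Bu fw; have [mf _] := fw.
set g := trunc c rho u N f.
have [gw gf] := in_Lw_aligned r0 mw c rho N (measurable_crit c rho u) fw.
rewrite -/g in gw gf.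
have [[[mTg lTg] _] hTg] := hC g gw.
have iT : mu.-integrable (eball c rho) (EFin \o T g).
  apply/integrableP; split; first exact: measurable_funS mTg.
  have [D [cD mD BD]] := eball_sub_compact c rho.
  apply: le_lt_trans (lTg D cD); apply: ge0_subset_integral => //.
  by apply: measurableT_comp => //; exact: measurable_funS mTg.
have [_ hE] := far_errorE c gw rho0; set E := fine _ in hE.
set A := \int[mu]_(y in ~` eball c (2 * rho)) ker1 c rho u g y.
have near x : eball c rho x -> `|T g x - (b x - bB c rho) * A
    - \int[mu]_(y in ~` eball c (2 * rho)) ker0 c rho u g y| <= Cfar * E.
  move=> Bx; apply: commutator_affine => //.
  - by move=> y; exact: trunc_eq0.
  - exact: ker0_trunc_integrable.
  - exact: ker1_trunc_integrable.
have ib := symbolB_integrable c rho0.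
have iA : mu.-integrable (eball c rho) (EFin \o (fun x => (b x - bB c rho) * A)).
  by have := integrableZr (mB c rho) A ib; apply: eq_integrable.
have := oscillation_near rho0 iT iA near.
rewrite meanZr// mean_symbolB// mul0r.
under eq_integral do rewrite subr0.
rewrite integral_symbolBM// ker1_trunc_value// => h.
have := lee_wpmul2l (_ : 0 <= (q c rho)%:E)%E h.
rewrite lee_fin (ltW (q0 c rho0)) => /(_ isT); rewrite ge0_muleDr; last 2 first.
- exact: integral_ge0.
- by rewrite lee_fin !mulr_ge0 ?(ltW Cfar0) ?(ltW (vol_eball_gt0 c rho0))// fine_ge0// far_error_ge0.
rewrite -(wlip_avgE HM)// => {}h.
have h1 : (wlip_avg delta w (eball c rho) (fun x => (T g x - mean (eball c rho) (T g))%R) <=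
   (C * nrm r w g)%:E)%E.
  rewrite EFinM -nrmE//; apply: le_trans hTg; apply: ereal_sup_ubound.
  by exists c, rho.
have := le_trans h (leeD h1 (lexx _)); rewrite -!EFinM -EFinD lee_fin => h2.
apply: (@le_trans _ _ ((C + 2 * Cfar * C1) * nrm r w g)); last first.
  by rewrite ler_pM2l// addr_gt0// !mulr_gt0.
apply: (@le_trans _ _ (q c rho * (osc c rho * (m%:R * crit_value c rho u N f)))).
  rewrite -mulrA ler_pM2l ?q0// ler_wpM2l ?osc_ge0// ler_peMl ?crit_value_ge0//.
  by rewrite ler1n.
apply: le_trans h2 _; rewrite [leRHS]mulrDl lerD2l.
have -> : q c rho * (vol (eball c rho) * (2 * (Cfar * E))) =
  2 * Cfar * (q c rho * vol (eball c rho) * E) by ring.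
by rewrite -[leRHS]mulrA ler_pM2l// mulr_gt0.
Qed.


Definition far_cut c rho f : 'rV[R]_n -> R := f \* \1_(~` eball c (2 * rho)).

(** The factor of the summand of index k that does not depend on x; its value
    is 0 when the integral diverges. *)
Definition moment c rho u f k : R :=
  frac_op K (fun y => (b y - bB c rho) ^+ k * far_cut c rho f y) u.

Lemma measurable_far_cut c rho f : measurable_fun setT f -> measurable_fun setT (far_cut c rho f).
Proof. by move=> mf; apply: measurable_funM => //; exact: measurable_indic. Qed.

Lemma moment_le c rho u f k : measurable_fun setT f ->
  (`|moment c rho u f k|%:E <=
   \int[mu]_(y in ~` eball c (2 * rho)) (`|(b y - bB c rho) ^+ k * K (u - y)| * `|f y|)%:E)%E.
Proof.
move=> mf; apply: le_trans (abs_Rintegral_le mu measurableT _) _.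
  apply: measurable_funM; first exact: (measurableT_comp mK (measurable_rVB2 u)).
  apply: measurable_funM; last exact: measurable_far_cut.
  by apply: measurable_funX; exact: measurable_funB.
rewrite [leRHS]integral_mkcond le_eqVlt; apply/orP; left; apply/eqP.
apply: eq_integral => y _; rewrite patchE /far_cut /= indicE.
case: ifPn => _; last by rewrite !mulr0 normr0.
by rewrite mulr1 -normrM; congr (`|_|%:E); ring.
Qed.

Lemma Sterm_moment c rho u x f k :
  Sterm m b K f c rho k u x = (b x - bB c rho) ^+ (m - k) * moment c rho u f k.
Proof. by []. Qed.

Lemma Sterm_le k c rho u x f : (k.+2 <= m)%N -> 0 < rho -> eball c rho u -> eball c rho x ->
  in_Lw r w f -> `|Sterm m b K f c rho k u x| <= Cterm * fine (far_error c rho f).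
Proof.
move=> km rho0 Bu Bx fw; have [mf _] := fw; have [fE _] := far_errorE c fw rho0.
rewrite Sterm_moment normrM normrX -lee_fin EFinM.
apply: le_trans (lee_wpmul2l _ (moment_le c rho u k mf)) _; first by rewrite lee_fin exprn_ge0.
have mfa : measurable_fun setT (fun y => `|f y|) by exact: measurableT_comp.
have mF : measurable_fun setT (fun y => far c rho y * `|f y|).
  by apply: measurable_funM => //; exact: measurable_far_weight.
have mC : measurable_fun setT (fun y => `|(b y - bB c rho) ^+ k * K (u - y)| * `|f y|).
  apply: measurable_funM => //; apply: measurableT_comp => //.
  apply: measurable_funM; last exact: (measurableT_comp mK (measurable_rVB2 u)).
  by apply: measurable_funX; exact: measurable_funB.
rewrite EFinM -fE -far_error_integral ?(ltW Cterm0)// -ge0_integralZl//; last first.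
  by apply/measurable_EFinP; exact: mS.
apply: ge0_le_integral => //.
- by apply: measurable_funeM; apply/measurable_EFinP; exact: mS.
- by apply/measurable_EFinP; apply: mS; exact: measurable_funM.
- by move=> y By; rewrite -EFinM lee_fin !mulrA ler_wpM2r//; exact: Hterm.
Qed.

Lemma measurable_Sterm c rho u f k : measurable_fun setT (Sterm m b K f c rho k u).
Proof.
by apply: measurable_funM => //; apply: measurable_funX; exact: measurable_funB.
Qed.

Lemma Sterm_integrable c rho u f k : 0 < rho ->
  mu.-integrable (eball c rho) (EFin \o Sterm m b K f c rho k u).
Proof.
move=> rho0; have [E hE] := Hbb c rho0.
apply: (eball_bounded_integrable rho0 (E := E ^+ (m - k) * `|moment c rho u f k|)).
  exact: measurable_Sterm.
move=> x Bx; rewrite Sterm_moment normrM normrX ler_wpM2r// lerXn2r ?nnegrE ?hE//.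
exact: le_trans (hE _ Bx).
Qed.

Definition coefm k : R := m`!%:R / (k`!%:R * (m - k)`!%:R).

Definition Ssum c rho u f x : R := \sum_(0 <= k < m.+1)
  coefm k * (Sterm m b K f c rho k u x - mean (eball c rho) (Sterm m b K f c rho k u)).

Lemma measurable_Ssum c rho u f : measurable_fun setT (Ssum c rho u f).
Proof.
apply: measurable_sum => k; apply: measurable_funM => //.
by apply: measurable_funB => //; exact: measurable_Sterm.
Qed.

Lemma coefm_ge0 k : 0 <= coefm k.
Proof. by rewrite /coefm divr_ge0// mulr_ge0. Qed.

Lemma coefm_last : coefm m.-1 = m%:R.
Proof.
rewrite /coefm -[X in X`!%:R / _](prednK m0) factS -[X in (X - _)%N](prednK m0) subSnn.
by rewrite (factS 0) fact0 muln1 mulr1 natrM mulfK ?pnatr_eq0 ?gtn_eqF ?fact_gt0// prednK.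
Qed.

(** The total contribution of the summands k <= m - 2. *)
Definition Cexp : R := \sum_(0 <= k < m.-1) coefm k * (2 * Cterm).

Lemma Cexp_ge0 : 0 <= Cexp.
Proof. by apply: sumr_ge0 => k _; rewrite !mulr_ge0 ?coefm_ge0// ltW. Qed.

(** The summands k <= m - 2 are bounded separately, the summand k = m is
    constant in x and disappears with its mean, and the mean of b - b_B is 0
    in the summand k = m - 1. *)
Lemma Ssum_expansion c rho u x f : 0 < rho -> eball c rho u -> eball c rho x -> in_Lw r w f ->
  `|Ssum c rho u f x - m%:R * ((b x - bB c rho) * moment c rho u f m.-1)|
  <= Cexp * fine (far_error c rho f).
Proof.
move=> rho0 Bu Bx fw; set E0 := fine _.
have -> : Ssum c rho u f x = \sum_(0 <= k < m.-1)
  coefm k * (Sterm m b K f c rho k u x - mean (eball c rho) (Sterm m b K f c rho k u))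
  + m%:R * ((b x - bB c rho) * moment c rho u f m.-1).
  rewrite /Ssum -[in X in index_iota _ X](prednK m0) big_nat_recr//= big_nat_recr//=.
  rewrite coefm_last prednK// -addrA; congr (_ + _).
  have -> : Sterm m b K f c rho m.-1 u = fun x => (b x - bB c rho) * moment c rho u f m.-1.
    by apply/funext => z; rewrite Sterm_moment -[X in (X - _)%N](prednK m0) subSnn expr1.
  rewrite meanZr ?mean_symbolB ?mul0r ?subr0//; last exact: symbolB_integrable.
  have -> : Sterm m b K f c rho m u = cst (moment c rho u f m).
    by apply/funext => z; rewrite Sterm_moment subnn expr0 mul1r.
  by rewrite mean_cst//= subrr mulr0 addr0.
rewrite addrK /Cexp mulr_suml; apply: le_trans (ler_norm_sum _ _ _) _.
rewrite big_nat [leRHS]big_nat; apply: ler_sum => k /andP[_ km].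
have km2 : (k.+2 <= m)%N by rewrite -[X in (_ <= X)%N](prednK m0) ltnS.
rewrite normrM ger0_norm ?coefm_ge0// -mulrA ler_wpM2l ?coefm_ge0//.
have h z : eball c rho z -> `|Sterm m b K f c rho k u z| <= Cterm * E0 by move=> Bz; exact: Sterm_le.
have hm : `|mean (eball c rho) (Sterm m b K f c rho k u)| <= Cterm * E0.
  rewrite -[X in `|X|]subr0; apply: mean_near => //; first exact: Sterm_integrable.
  by move=> z Bz; rewrite subr0; exact: h.
apply: le_trans (ler_normB _ _) _; have := h x Bx; lra.
Qed.

Definition Ssum_bounded := exists2 C : R, 0 < C &
  forall c rho, 0 < rho -> forall u, eball c rho u ->
  forall f, locally_L1 (EFin \o f) ->
  (wlip_avg delta w (eball c rho) (Ssum c rho u f) <= C%:E * wnorm r w f)%E.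

Lemma integral_main_error c rho (A E : R) : 0 < rho -> 0 <= E ->
  (\int[mu]_(x in eball c rho) (`|m%:R * ((b x - bB c rho) * A)| + E)%:E
   = (m%:R * (osc c rho * `|A|) + vol (eball c rho) * E)%:E)%E.
Proof.
move=> rho0 E0.
under eq_integral do rewrite EFinD.
have mbA : measurable_fun setT (fun x => (b x - bB c rho) * A).
  by apply: measurable_funM => //; exact: measurable_funB.
rewrite ge0_integralD//; last 1 first.
- by apply: mnS; exact: measurable_funM.
rewrite EFinD; congr (_ + _)%E.
  under eq_integral do rewrite normrM normr_nat EFinM.
  by rewrite ge0_integralZl// ?integral_symbolBM//; exact: mnS.
by rewrite mulrC EFinM -leb_eball// -integral_cst.
Qed.

(** The critical moment is at most the core, also when it diverges and has the
    value 0. *)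
Lemma obstruction_bounded_Ssum : obstruction_bounded -> Ssum_bounded.
Proof.
move=> [C C0 hC]; exists (m%:R * C + Cexp * C1 + 1).
  by rewrite ltr_wpDl// addr_ge0 ?mulr_ge0 ?Cexp_ge0 ?(ltW C10) ?(ltW C0).
move=> c rho rho0 u Bu f lf.
have C'0 : 0 < m%:R * C + Cexp * C1 + 1.
  by rewrite ltr_wpDl// addr_ge0 ?mulr_ge0 ?Cexp_ge0 ?(ltW C10) ?(ltW C0).
have [mf _] := lf; have {}mf : measurable_fun setT f by exact/measurable_EFinP.
have [fy|] := ltP (wnorm r w f) +oo%E; last first.
  by rewrite leye_eq => /eqP ->; rewrite gt0_muley ?leey// lte_fin.
have fw : in_Lw r w f by split.
have [fE hE] := far_errorE c fw rho0; set E0 := fine _ in fE hE.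
have E00 : 0 <= E0 by rewrite fine_ge0// far_error_ge0.
have N0 := nrm_ge0 r w f.
set A := moment c rho u f m.-1.
have CE0 : 0 <= Cexp * E0 by rewrite mulr_ge0 ?Cexp_ge0.
rewrite (wlip_avgE HM)// nrmE//.
have h1 : (\int[mu]_(x in eball c rho) `|Ssum c rho u f x|%:E <=
   (m%:R * (osc c rho * `|A|) + vol (eball c rho) * (Cexp * E0))%:E)%E.
  rewrite -integral_main_error//; apply: ge0_le_integral => //.
  - by apply: mnS; exact: measurable_Ssum.
  - apply/measurable_EFinP; apply: mS; apply: measurable_funD => //.
    apply: measurableT_comp => //; apply: measurable_funM => //.
    by apply: measurable_funM => //; exact: measurable_funB.
  - move=> x Bx; rewrite lee_fin -lerBlDl; apply: le_trans (lerB_dist _ _) _.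
    exact: Ssum_expansion.
apply: le_trans (lee_wpmul2l _ h1) _; first by rewrite lee_fin ltW// q0.
have h2 : q c rho * osc c rho * `|A| <= C * nrm r w f.
  rewrite -lee_fin EFinM; apply: le_trans (hC c rho u f rho0 Bu fw).
  apply: lee_wpmul2l; first by rewrite lee_fin mulr_ge0 ?osc_ge0// ltW// q0.
  exact: moment_le.
rewrite -!EFinM lee_fin.
have -> : q c rho * (m%:R * (osc c rho * `|A|) + vol (eball c rho) * (Cexp * E0)) =
  m%:R * (q c rho * osc c rho * `|A|) + Cexp * (q c rho * vol (eball c rho) * E0) by ring.
rewrite [leRHS]mulrDl mul1r; apply: le_trans (_ : _ <= (m%:R * C + Cexp * C1) * nrm r w f) _; last by rewrite lerDl.
rewrite [leRHS]mulrDl -!(mulrA _ _ (nrm r w f)).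
by apply: lerD; apply: ler_wpM2l => //; exact: Cexp_ge0.
Qed.

Lemma moment_trunc c rho u N f :
  moment c rho u (trunc c rho u N f) m.-1 = crit_value c rho u N f.
Proof.
rewrite /moment /frac_op /crit_value [RHS]Rintegral_mkcond; apply: eq_Rintegral => y _.
rewrite patchE /crit_trunc -mul_aligned /far_cut /= indicE /crit.
by case: ifPn => _; rewrite ?mulr0// mulr1; ring.
Qed.

(** On an aligned function the critical moment is crit_value, whatever the
    signs in the sum. *)
Lemma Ssum_obstruction_bounded : Ssum_bounded -> obstruction_bounded.
Proof.
move=> [C C0 hC]; apply: (@obstruction_bounded_trunc (C + Cexp * C1)).
  by rewrite ltr_wpDr// mulr_ge0 ?Cexp_ge0// ltW.
move=> c rho u N f rho0 Bu fw; have [mf _] := fw.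
set g := trunc c rho u N f.
have [gw gf] := in_Lw_aligned r0 mw c rho N (measurable_crit c rho u) fw.
rewrite -/g in gw gf.
have [fE hE] := far_errorE c gw rho0; set E0 := fine _ in fE hE.
have E00 : 0 <= E0 by rewrite fine_ge0// far_error_ge0.
have CE0 : 0 <= Cexp * E0 by rewrite mulr_ge0 ?Cexp_ge0.
have X0 := crit_value_ge0 c rho u N f.
have qp := q0 c rho0.
have h := hC c rho rho0 u Bu g (HL gw).
rewrite (wlip_avgE HM)// nrmE// in h.
have h1 : (\int[mu]_(x in eball c rho) (`|m%:R * ((b x - bB c rho) * crit_value c rho u N f)| + 0)%:E <=
   \int[mu]_(x in eball c rho) `|Ssum c rho u g x|%:E + (vol (eball c rho) * (Cexp * E0))%:E)%E.
  have -> : ((vol (eball c rho) * (Cexp * E0))%:E = \int[mu]_(x in eball c rho) cst (Cexp * E0)%:E x)%E.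
    by rewrite integral_cst// mulrC EFinM -leb_eball.
  rewrite -ge0_integralD//; last 1 first.
    by apply: mnS; exact: measurable_Ssum.
  apply: ge0_le_integral => //.
  - apply/measurable_EFinP; apply: mS; apply: measurable_funD => //.
    apply: measurableT_comp => //; apply: measurable_funM => //.
    by apply: measurable_funM => //; exact: measurable_funB.
  - by apply: emeasurable_funD => //; apply: mnS; exact: measurable_Ssum.
  - move=> x Bx; rewrite -EFinD lee_fin addr0 -lerBlDl; apply: le_trans (lerB_dist _ _) _.
    by rewrite distrC -(moment_trunc c rho u N f); exact: Ssum_expansion.
rewrite integral_main_error// mulr0 addr0 (ger0_norm X0) in h1.
have := lee_wpmul2l (_ : 0 <= (q c rho)%:E)%E h1.
rewrite lee_fin (ltW qp) => /(_ isT); rewrite ge0_muleDr; last 2 first.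
- exact: integral_ge0.
- by rewrite lee_fin mulr_ge0// ltW// vol_eball_gt0.
move=> /le_trans/(_ (leeD h (lexx _))); rewrite -!EFinM -EFinD lee_fin => h2.
apply: (@le_trans _ _ ((C + Cexp * C1) * nrm r w g)); last first.
  by rewrite ler_wpM2l// addr_ge0 ?(ltW C0)// mulr_ge0 ?Cexp_ge0// ltW.
apply: (@le_trans _ _ (q c rho * (m%:R * (osc c rho * crit_value c rho u N f)))).
  rewrite -mulrA ler_pM2l// ler_peMl ?mulr_ge0 ?osc_ge0//.
  by rewrite ler1n.
apply: le_trans h2 _; rewrite [leRHS]mulrDl lerD2l.
have -> : q c rho * (vol (eball c rho) * (Cexp * E0)) =
  Cexp * (q c rho * vol (eball c rho) * E0) by ring.
by rewrite -[leRHS]mulrA ler_wpM2l ?Cexp_ge0.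
Qed.

Lemma bounded_iff_Ssum_bounded : bounded_Lw_wlip r delta w T <-> Ssum_bounded.
Proof.
split=> [/commutator_obstruction_bounded/obstruction_bounded_Ssum//|].
by move=> /Ssum_obstruction_bounded/obstruction_bounded_commutator.
Qed.

End equivalence.

(** * Integrability on annuli and the equivalence *)

(** An annulus around B stays away from u and is bounded, so K and b are
    bounded there. *)
Lemma annulus_kernel_bounded (R : realType) (n : nat) (alpha CK delta Cb : R)
    (K b : 'rV[R]_n -> R) :
  alpha < n%:R -> 0 < CK ->
  (forall z, z != 0 -> `|K z| <= CK * enorm z `^ (alpha - n%:R)) ->
  0 < delta -> 0 < Cb ->
  (forall x y, `|b x - b y| <= Cb * enorm (x - y) `^ delta) -> measurable_fun setT b ->
  forall c (rho : R) u (N k : nat), 0 < rho -> eball c rho u ->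
  exists E : R, forall y, annulus c rho N y ->
    `|(b y - mean (eball c rho) b) ^+ k * K (u - y)| <= E.
Proof.
move=> an CK0 HK d0 Cb0 Hb mb c rho u N k rho0 Bu.
exists ((lip_far delta Cb * N%:R `^ delta) ^+ k *
  (far_size (n := n) alpha CK * (2 * rho) `^ (alpha - n%:R))).
move=> y [yN By].
have L0 := lip_far_gt0 delta Cb0; have S0 := far_size_gt0 alpha CK0 (n := n).
have hb : `|b y - mean (eball c rho) b| <= lip_far delta Cb * N%:R `^ delta.
  rewrite distrC; apply: le_trans (symbol_far_mean d0 Cb0 Hb mb rho0 By) _.
  rewrite ler_pM2l// ge0_ler_powR ?nnegrE ?enorm_ge0 ?(ltW d0)//.
  by rewrite enorm_distC; exact: ltW.
rewrite normrM normrX; apply: ler_pM => //.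
  by rewrite lerXn2r ?nnegrE// (le_trans _ hb).
apply: le_trans (kernel_far_size an CK0 HK rho0 Bu By) _.
rewrite ler_pM2l// ler_npowR ?subr_le0 ?(ltW an) ?mulr_gt0//.
exact: far_center By.
Qed.

Theorem theorem2p6 (R : realType) (n m : nat) (alpha eta delta : R)
    (K b w : 'rV[R]_n -> R) :
  (0 < m)%N ->
  0 < alpha -> alpha < n%:R ->
  0 < eta -> eta <= 1 ->
  measurable_fun [set: 'rV[R]_n] K ->
  (exists x, K x != 0) ->
  size_cond alpha K ->
  smooth_cond alpha eta K ->
  0 < delta -> delta < Num.min eta ((n%:R - alpha) / m%:R) ->
  weight (EFin \o w) ->
  A_infty (n%:R / (m%:R * delta + alpha)) w ->
  Lip delta b ->
  let r := n%:R / ((m%:R - 1) * delta + alpha) in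
  bounded_Lw_wlip r delta w (commutator m b K)
  <->
  (exists2 C : R, 0 < C &
     forall (c : 'rV[R]_n) (rho : R), 0 < rho ->
     forall u : 'rV[R]_n, eball c rho u ->
     forall f : 'rV[R]_n -> R, locally_L1 (EFin \o f) ->
       (wlip_avg delta w (eball c rho)
          (fun x => (\sum_(0 <= k < m.+1)
             (m`!%:R / (k`!%:R * (m - k)`!%:R))
             * (Sterm m b K f c rho k u x
                - mean (eball c rho) (Sterm m b K f c rho k u)))%R)
        <= C%:E * wnorm r w f)%E).
Proof.
move=> m0 a0 an e0 _ mK _ hS hH d0; rewrite lt_min => /andP[de dm] hw hA lb r.
have mb := Lip_measurable d0 lb.
have [CK CK0 HK] := kernel_size a0 an e0 mK hS hH.
have [CH CH0 HH2] := hH; have [Cb Cb0 Hb] := lb.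
have HH x x' y : 2 * enorm (x - x') <= enorm (x - y) ->
    `|K (x - y) - K (x' - y)| <=
    CH * (enorm (x - x') `^ eta / enorm (x - y) `^ (n%:R - alpha + eta)).
  by move=> h; apply: le_trans (HH2 _ _ _ h); rewrite lerDl.
have n0 : 0 < n%:R :> R by exact: lt_trans an.
have mR0 : 0 < m%:R :> R by rewrite ltr0n.
have m1 : 1 <= m%:R :> R by rewrite ler1n.
have mdn : m%:R * delta + alpha < n%:R.
  by rewrite -ltrBrDr mulrC -ltr_pdivlMr.
have md0 : 0 < m%:R * delta by rewrite mulr_gt0.
have m1d0 : 0 <= (m%:R - 1) * delta by rewrite mulr_ge0 ?subr_ge0// ltW.
have e1 : 0 < (m%:R - 1) * delta + alpha by rewrite ltr_wpDl.
have e2 : (m%:R - 1) * delta + alpha < m%:R * delta + alpha by rewrite mulrBl mul1r; lra.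
have e3 : 0 < m%:R * delta + alpha by exact: lt_trans e2.
have s1 : 1 < n%:R / (m%:R * delta + alpha) by rewrite ltr_pdivlMr// mul1r.
have sr : n%:R / (m%:R * delta + alpha) < r by rewrite ltr_pM2l// ltf_pV2.
have r0 : 0 < r by rewrite divr_gt0.
pose p := n%:R - (m%:R - 1) * delta - alpha.
have p0 : 0 <= p by rewrite /p; lra.
have rp : 1 - r^-1 = p / n%:R.
  by rewrite /r invf_div /p -addrA -opprD [RHS]mulrBl mulfV// gt_eqF.
have [w0' [/measurable_EFinP mw _]] := hw.
have w0 x : 0 <= w x by have := w0' x; rewrite /= lee_fin.
have [CW CW0 HW] := A_infty_hoelder s1 sr hw hA.
have [CA _ hCA] := A_infty_eball s1 hw hA.
have HM c rho : 0 < rho -> 0 < wsup w (eball c rho) /\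
    ('N[leb R n]_+oo[EFin \o (w \* \1_(eball c rho))%R] = (wsup w (eball c rho))%:E)%E.
  by move=> rho0; have [] := hCA c rho rho0.
have [Cfar Cfar0 Hcomm] := far_commutator_le an e0 CK0 CH0 HK HH d0 Cb0 Hb mb m0.
have [Cterm Cterm0 Hterm] := far_terms_le eta an CK0 HK d0 Cb0 Hb mb m.
have [C1 C10 Hfar] := far_error_lip_le p0 n0 rp w0 CW0 HM HW d0 de (erefl p).
have [C2 C20 Hnear] :=
  near_part_lip_le p0 n0 rp w0 CW0 HM HW d0 m0 a0 (erefl p) mdn mK mb CK0 Cb0 HK Hb.
apply: (bounded_iff_Ssum_bounded r0 m0 mK mb mw HM _ Cfar0 Cterm0 C10 C20 _ Hcomm Hterm _ Hfar Hnear).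
- exact: in_Lw_locally_L1 p0 n0 rp w0 CW0 HM HW.
- by move=> c rho rho0; exact: (symbol_integrable d0 Cb0 Hb mb c rho0).
- exact: annulus_kernel_bounded an CK0 HK d0 Cb0 Hb mb.
- move=> c rho rho0; exists (lip_far delta Cb * rho `^ delta) => x Bx.
  exact: symbol_near_mean.
- by move=> f c rho mf; exact: measurable_near_part.
Qed.
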